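(* Let $T>0$, $\alpha\in(0,1)$, and $u_0\in\mathcal H^{1+\eta}(\mathbb T^2)\cap W^{1,\infty}(\mathbb T^2)$ for some $\eta\in(0,4)$. For each $p>1$ there exists a constant $C=C(\alpha,p,\sigma,L,T,\|u_0\|_{W^{1,\infty}})>0$ such that for all $N\in\mathbb N$ $$\left(\mathbb E\left\|f\left(\nabla u^{(N)}\right)\right\|_{L^p([0,T]\times\mathbb T^2,\mathbb R^2)}^p\right)^{\frac1p}\le C\,N^{-\frac{2\alpha}{p+2}}.$$ In particular, the same convergence rate holds for the nonlinearity of $u_h^{(N)}$, i.e. with $f(\nabla u_h^{(N)})$ in place of $f(\nabla u^{(N)})$.
   Context: $\mathbb T^2=[0,L]^2$ is the two-dimensional torus of side length $L>0$ (periodic boundary conditions). For $k=(k_1,k_2)\in\mathbb Z^2$, $e_k(x)=\omega_{k_1}(x_1)\omega_{k_2}(x_2)$, where $\omega_j(z)=\sqrt{2/L}\,\sin(2\pi jz/L)$ for $j>0$, $\omega_0(z)=1/\sqrt L$, $\omega_j(z)=\sqrt{2/L}\,\cos(2\pi jz/L)$ for $j<0$; these form an orthonormal basis of $L^2(\mathbb T^2)$ with $-\Delta e_k=\mu_ke_k$, $\mu_k=(2\pi|k|/L)^2$, $|k|$ the Euclidean norm. For $s\in\mathbb R$, $\mathcal H^s=\mathcal H^s(\mathbb T^2)$ is the space of mean-zero $u=\sum_{k\in\mathbb Z^2\setminus\{0\}}u_ke_k$ with $\|u\|_{\mathcal H^s}^2=\sum_{k\ne0}\mu_k^s|u_k|^2<\infty$.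 $A=-\Delta^2$, so $e^{tA}\sum_{k\neq0}u_ke_k=\sum_{k\neq0}e^{-t\mu_k^2}u_ke_k$. For $N\in\mathbb N$, $P_N\sum_ku_ke_k=\sum_{0<|k|\le N}u_ke_k$. $f(z)=\frac{z}{1+|z|^2}$ for $z\in\mathbb R^2$, and $\mathfrak F(u)=-\nabla\cdot f(\nabla u)\in\mathcal H^{-1}$ for $u\in\mathcal H^1$. $(\beta_k)_{k\in\mathbb Z^2\setminus\{0\}}$ are i.i.d. standard real Brownian motions, $Z_k(t)=\int_0^te^{-(t-s)\mu_k^2}\,d\beta_k(s)$, and $P_NZ^{(\alpha)}(t)=\sum_{0<|k|\le N}\mu_k^{\alpha/2}Z_k(t)e_k$. The noise intensity $\sigma>0$ is fixed. For $N\in\mathbb N$, $u^{(N)}$ is the mild solution ($\mathcal H^1$-valued, time-continuous process) of $$u^{(N)}(t)=e^{tA}u_0+\int_0^te^{(t-s)A}\mathfrak F(u^{(N)}(s))\,ds+\sigma P_NZ^{(\alpha)}(t),\quad t\in[0,T].$$ For $n\in\mathbb N$ and $h=T/n$, write $\lfloor s\rfloor_h=jh$ if $s\in[jh,(j+1)h)$, and let $$u_h^{(N)}(t)=e^{tA}P_Nu_0+\int_0^te^{(t-s)A}P_N\mathfrak F(u_h^{(N)}(\lfloor s\rfloor_h))\,ds+\sigma P_NZ^{(\alpha)}(t),\quad t\in[0,T].$$ *)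

(* Defs.v *)
From HB Require Import structures.
From mathcomp Require Import all_boot all_order all_algebra.
From mathcomp Require Import all_classical all_reals all_analysis.
Set Implicit Arguments.
Unset Strict Implicit.
Unset Printing Implicit Defensive.
Import Order.TTheory GRing.Theory Num.Theory.
Import numFieldNormedType.Exports.
Local Open Scope classical_set_scope.
Local Open Scope ring_scope.

Local Notation mu1 := (@lebesgue_measure _).
Local Notation mu2 := (mu1 \x mu1)%E.

Section torus.
Context {R : realType}.
Variable L : R.

Definition torus : set (R * R) := `[0, L] `*` `[0, L].

(* An element of H^s is represented by its family of coefficients in the basis (e_k),
   with zero coefficient at 0. *)
Definition coef : Type := int * int -> R.

Definition nzfreq : set (int * int) := [set k | k != 0].

Definition freq_norm (k : int * int) : R :=
  Num.sqrt ((k.1%:~R) ^+ 2 + (k.2%:~R) ^+ 2).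

Definition mu_ (k : int * int) : R := (2 * pi * freq_norm k / L) ^+ 2.

Definition omega (j : int) (z : R) : R :=
  if 0 < j then Num.sqrt (2 / L) * sin (2 * pi * j%:~R * z / L)
  else if j == 0 then (Num.sqrt L)^-1
  else Num.sqrt (2 / L) * cos (2 * pi * j%:~R * z / L).

Definition e_ (k : int * int) (x : R * R) : R := omega k.1 x.1 * omega k.2 x.2.
Definition d1e_ (k : int * int) (x : R * R) : R :=
  derive1 (omega k.1) x.1 * omega k.2 x.2.
Definition d2e_ (k : int * int) (x : R * R) : R :=
  omega k.1 x.1 * derive1 (omega k.2) x.2.

Definition Hs_sqnorm (s : R) (u : coef) : \bar R :=
  (\esum_(k in nzfreq) (mu_ k `^ s * `|u k| ^+ 2)%:E)%E.

Definition Hs (s : R) : set coef :=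
  [set u | u 0 = 0 /\ (Hs_sqnorm s u < +oo)%E].

Definition semigroup (t : R) (u : coef) : coef :=
  fun k => expR (- t * mu_ k ^+ 2) * u k.

Definition low_freq (N : nat) : set (int * int) :=
  [set k | 0 < freq_norm k <= N%:R].

Definition proj (N : nat) (u : coef) : coef :=
  fun k => if k \in low_freq N then u k else 0.

(* [g] is the L^2 limit on the torus of the sums of [u k * b k x] over
   0 < |k| <= n; [L2sum b u] is a representative of this limit. *)
Definition is_L2sum (b : int * int -> R * R -> R) (u : coef) (g : R * R -> R)
    : Prop :=
  measurable_fun torus g /\
  (fun n : nat => \int[mu2]_(x in torus)
     ((g x - \sum_(k \in low_freq n) u k * b k x) ^+ 2)%:E)%E @ \oo --> 0%E.

Definition L2sum (b : int * int -> R * R -> R) (u : coef) : R * R -> R :=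
  xget (cst 0) [set g | is_L2sum b u g].

(* For u in H^1, [grad u] is a representative of the L^2 class of the weak
   gradient; every use below depends on u only through this class. *)
Definition grad (u : coef) (x : R * R) : R * R := (L2sum d1e_ u x, L2sum d2e_ u x).

Definition enorm (z : R * R) : R := Num.sqrt (z.1 ^+ 2 + z.2 ^+ 2).

Definition f_ (z : R * R) : R * R :=
  (z.1 / (1 + enorm z ^+ 2), z.2 / (1 + enorm z ^+ 2)).

(* Coefficients of - div (f (grad u)) in H^-1: the distributional divergence
   tested against e_k, hence without sign after integration by parts. *)
Definition frakF (u : coef) : coef := fun k =>
  \int[mu2]_(x in torus)
    ((f_ (grad u x)).1 * d1e_ k x + (f_ (grad u x)).2 * d2e_ k x).

Definition Linfty_norm (v : R * R -> R) : \bar R :=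
  Lnorm mu2 +oo%E (EFin \o (v \_ torus)).

Definition W1infty_norm (u : coef) : \bar R :=
  (Linfty_norm (L2sum e_ u) + Linfty_norm (fun x => enorm (grad u x)))%E.

(* Norm of f(grad u) in L^p([0,T] x torus; R^2).  The space-time integral is
   iterated, which makes it independent of the representatives [grad (u t)]
   chosen at the different times. *)
Definition Lp_norm_f_grad (p T : R) (u : R -> coef) : \bar R :=
  ((\int[mu1]_(t in `[0%R, T]) \int[mu2]_(x in torus)
     (enorm (f_ (grad (u t) x)) `^ p)%:E) `^ p^-1)%E.

End torus.

Section probability.
Context {R : realType} {d : measure_display} {Omega : measurableType d}.
Variable P : probability Omega R.

Definition mutually_independent (I : choiceType) (D : set I)
    (G : I -> set (set Omega)) : Prop :=
  forall (s : seq I) (A : I -> set Omega), uniq s ->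
    (forall i, i \in s -> D i /\ G i (A i)) ->
    P (\big[setI/setT]_(i <- s) A i) = (\prod_(i <- s) P (A i))%E.

Definition sigma_process (D : set R) (X : R -> Omega -> R) : set (set Omega) :=
  <<s [set A | exists t B, [/\ D t, measurable B & A = X t @^-1` B]] >>.

Definition sigma_var (X : Omega -> R) : set (set Omega) :=
  [set A | exists2 B, measurable B & A = X @^-1` B].

Record is_brownian (B : R -> {RV P >-> R}) : Prop := {
  brownian0 : {ae P, forall w, B 0 w = 0} ;
  brownian_indep : forall t : nat -> R,
    0 <= t 0%N -> (forall i, t i <= t i.+1) ->
    mutually_independent setT
      (fun i : nat => sigma_var (fun w => B (t i.+1) w - B (t i) w)) ;
  brownian_gauss : forall s t : R, 0 <= s -> s < t ->
    forall V : set R, measurable V ->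
    P ((fun w => B t w - B s w) @^-1` V) = normal_prob 0 (Num.sqrt (t - s)) V ;
  brownian_cont :
    {ae P, forall w, {within `[0, +oo[, continuous (fun t => B t w)}} }.

Definition iid_brownian (beta : int * int -> R -> {RV P >-> R}) : Prop :=
  (forall k, k != 0 -> is_brownian (beta k)) /\
  mutually_independent nzfreq
    (fun k => sigma_process `[0, +oo[ (fun t => beta k t : Omega -> R)).

Definition is_subdivision (t : R) (m : nat) (tau : nat -> R) : Prop :=
  [/\ tau 0%N = 0, tau m = t & forall i, (i < m)%N -> tau i <= tau i.+1].

Definition step_fun (m : nat) (tau c : nat -> R) (s : R) : R :=
  \sum_(i < m) c i * \1_(`[tau i, tau i.+1[) s.

Definition step_integral (B : R -> Omega -> R) (m : nat) (tau c : nat -> R)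
    (w : Omega) : R :=
  \sum_(i < m) c i * (B (tau i.+1) w - B (tau i) w).

(* I is the Wiener integral of the deterministic integrand phi over [0, t]:
   the L^2(P) limit of the integrals of step functions tending to phi in
   L^2(0, t). *)
Definition is_wiener_integral (B : R -> {RV P >-> R}) (t : R) (phi : R -> R)
    (I : {RV P >-> R}) : Prop :=
  exists (m : nat -> nat) (tau c : nat -> nat -> R),
  [/\ forall n, is_subdivision t (m n) (tau n),
      (fun n => \int[mu1]_(s in `[0%R, t])
         ((phi s - step_fun (m n) (tau n) (c n) s) ^+ 2)%:E)%E @ \oo --> 0%E &
      (fun n => \int[P]_w
         ((I w - step_integral (fun t => B t) (m n) (tau n) (c n) w) ^+ 2)%:E)%E
        @ \oo --> 0%E].

(* As usual, the process Z_k is the version with continuous paths. *)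
Definition is_stoch_conv (L : R) (beta Z : int * int -> R -> {RV P >-> R})
    : Prop :=
  forall k, k != 0 ->
    (forall t, 0 <= t ->
       is_wiener_integral (beta k) t
         (fun s => expR (- (t - s) * mu_ L k ^+ 2)) (Z k t)) /\
    {ae P, forall w, {within `[0, +oo[, continuous (fun t => Z k t w)}}.

Definition Zalpha (L alpha : R) (Z : int * int -> R -> {RV P >-> R})
    (t : R) (w : Omega) : coef :=
  fun k => mu_ L k `^ (alpha / 2) * Z k t w.

Definition measurable_coefs (T : R) (u : R -> Omega -> @coef R) : Prop :=
  forall t k, 0 <= t <= T -> measurable_fun setT (fun w => u t w k).

(* The integrals of H^-1-valued functions are computed coefficientwise. *)
Record is_mild_solution (L T alpha sigma : R)
    (Z : int * int -> R -> {RV P >-> R}) (u0 : coef) (N : nat)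
    (u : R -> Omega -> @coef R) : Prop := {
  mild_meas : measurable_coefs T u ;
  mild_H1 : {ae P, forall w, forall t, 0 <= t <= T -> Hs L 1 (u t w)} ;
  mild_cont : {ae P, forall w, forall t, 0 <= t <= T ->
    Hs_sqnorm L 1 (u s w - u t w) @[s --> within `[0, T] (nbhs t)] --> 0%E} ;
  mild_eq : {ae P, forall w, forall t, 0 <= t <= T -> forall k,
    u t w k = semigroup L t u0 k
      + \int[mu1]_(s in `[0, t]) semigroup L (t - s) (frakF L (u s w)) k
      + sigma * proj N (Zalpha L alpha Z t w) k} }.

Definition floor_h (h s : R) : R := (Num.floor (s / h))%:~R * h.

Record is_approximation (L T alpha sigma : R)
    (Z : int * int -> R -> {RV P >-> R}) (u0 : coef) (N n : nat)
    (u : R -> Omega -> @coef R) : Prop := {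
  approx_meas : measurable_coefs T u ;
  approx_eq : {ae P, forall w, forall t, 0 <= t <= T -> forall k,
    u t w k = semigroup L t (proj N u0) k
      + \int[mu1]_(s in `[0%R, t])
          semigroup L (t - s) (proj N (frakF L (u (floor_h (T / n%:R) s) w))) k
      + sigma * proj N (Zalpha L alpha Z t w) k} }.

End probability.

(* Main.v *)
Require Import Defs.
From HB Require Import structures.
From mathcomp Require Import all_boot all_order all_algebra.
From mathcomp Require Import all_classical all_reals all_analysis.
From mathcomp Require Import measurable_realfun ring lra zify.

(** The function f is bounded by 1 and |f z| <= 1 / |z|, so f (grad u) is small
    wherever the gradient is large, and the rough noise makes the gradient large
    with high probability.  Write u (t) = e^{tA} a + V (t) + sigma P_N Z (t), with a
    the initial value and V the drift integral.  The mild solution and the time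
    discretization differ only in a and in the integrand defining V.

    The drift is bounded pathwise and uniformly in u.  As |f| <= 1, Bessel's
    inequality gives sum_k frakF_k^2 / mu_k <= 2 L^2 (sum_frakF_le), and the
    smoothing of the semigroup turns this into sum_k mu_k^{1/2} |V_k| <= K, where K
    depends on L and T only (drift_sum_bounded).  Hence |d_i V| <= 2 K / L everywhere
    on the torus.  For t > 0 the gradient of e^{tA} a is an absolutely convergent
    series of explicit functions: a deterministic shift.

    The gradient of sigma P_N Z (t, x) is a centred Gaussian vector in the plane.  As
    soon as t exceeds a multiple of N^-4, its covariance is at least a constant times
    N^{2 alpha} times the identity, at every x (noise_variance_ge).  So, whatever the
    shift m, it lies in a disc of radius rho around -m with probability at most
    C rho^2 N^{-2 alpha} (noise_small_ball).  This small ball estimate is drawn from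
    a bound on the characteristic function alone, tested against a product of two
    Fejer kernels (small_ball), and the bound on the characteristic function
    survives the L^2 limits which define Wiener integrals (charfun_wiener_le).

    For r > 0, either |grad u| > r and |f (grad u)|^p <= r^-p, or the sum of the noise
    and the shift lies in a disc of radius 2 (r + 2 K / L) (small_or_bad).  Hence
      E int int |f (grad u)|^p <= C (N^-4 + r^-p + (r + 2 K / L)^2 N^{-2 alpha}),
    and r = N^{2 alpha / (p + 2)} balances the last two terms (moment_const_rate).

    Solutions are not known to be jointly measurable in time and chance.  But the
    integral of any nonnegative function, a supremum over the simple functions below
    it, is monotone and superadditive, which suffices for upper bounds.  Fubini's
    theorem is applied only to the event that noise plus shift is small, which is
    jointly measurable because of explicit series and continuous paths. *)

Set Implicit Arguments.
Unset Strict Implicit.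
Unset Printing Implicit Defensive.
Import Order.TTheory GRing.Theory Num.Theory.
Import numFieldNormedType.Exports.
Local Open Scope classical_set_scope.
Local Open Scope ring_scope.

(** * Lower integrals *)

Section lower_integral.
Context d (T : measurableType d) (R : realType).
Variable mu : {measure set T -> \bar R}.
Local Open Scope ereal_scope.
Import HBNNSimple.

(** The integral of a nonnegative function is the supremum of the integrals of the
    simple functions below it, hence the comparison holds for arbitrary functions. *)
Lemma le_lower_integral (D : set T) (f g : T -> \bar R) :
  (forall x, D x -> 0 <= f x) -> (forall x, D x -> f x <= g x) ->
  \int[mu]_(x in D) f x <= \int[mu]_(x in D) g x.
Proof.
move=> f0 fg.
have g0 x : D x -> 0 <= g x by move=> Dx; exact: le_trans (f0 x Dx) (fg x Dx).
rewrite !ge0_integralE// ge_ereal_sup// => _ [h/= hf] <-.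
apply: le_ereal_sup_tmp; exists (sintegral mu h) => //; exists h => // x /=.
by apply: le_trans (hf x) _; exact: lee_restrict.
Qed.

(** The sum of two simple minorants is a simple minorant of the sum. *)
Lemma lower_integralD (D : set T) (f g : T -> \bar R) :
  (forall x, D x -> 0 <= f x) -> (forall x, D x -> 0 <= g x) ->
  \int[mu]_(x in D) f x + \int[mu]_(x in D) g x
    <= \int[mu]_(x in D) (f x + g x).
Proof.
move=> f0 g0.
have fg0 x : D x -> 0 <= f x + g x by move=> Dx; rewrite adde_ge0 ?f0 ?g0.
have If0 := integral_ge0 mu f0; have Ig0 := integral_ge0 mu g0.
have [->|Iy] := eqVneq (\int[mu]_(x in D) (f x + g x)) +oo; first exact: leey.
have Ifg0 := integral_ge0 mu fg0.
have Ifin : \int[mu]_(x in D) (f x + g x) \is a fin_num.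
  by rewrite ge0_fin_numE// ltey.
have Igfin : \int[mu]_(x in D) g x \is a fin_num.
  rewrite ge0_fin_numE//; apply: le_lt_trans (_ : _ < +oo); last by rewrite ltey; exact: Iy.
  by apply: le_lower_integral => // x Dx; rewrite leeDr// f0.
rewrite -leeBrDr// [X in X <= _]ge0_integralE//.
rewrite ge_ereal_sup// => _ [h/= hf] <-.
have hfin : sintegral mu h \is a fin_num.
  rewrite ge0_fin_numE ?sintegral_ge0//.
  apply: le_lt_trans (_ : _ < +oo); last by rewrite ltey; exact: Iy.
  rewrite ge0_integralE//; apply: ereal_sup_ubound; exists h => // x.
  apply: le_trans (hf x) _; rewrite /patch; case: ifP => // /set_mem Dx.
  by rewrite leeDl// g0.
rewrite leeBrDr// addeC -leeBrDr// [X in X <= _]ge0_integralE//.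
rewrite ge_ereal_sup// => _ [k/= kg] <-.
rewrite leeBrDr// -sintegralD//.
rewrite ge0_integralE//; apply: ereal_sup_ubound; exists (add_nnsfun k h) => //= x.
rewrite EFinD; apply: le_trans (leeD (kg x) (hf x)) _.
by rewrite /patch; case: ifP => [_|_]; rewrite ?adde0// addeC.
Qed.

Lemma lower_integralZ (D : set T) (f : T -> \bar R) (c : R) :
  (0 <= c)%R -> (forall x, D x -> 0 <= f x) ->
  c%:E * \int[mu]_(x in D) f x <= \int[mu]_(x in D) (c%:E * f x).
Proof.
rewrite le_eqVlt => /predU1P[<- f0|c0 f0].
  rewrite mul0e; apply: integral_ge0 => x _; by rewrite mul0e.
have cf0 x : D x -> 0 <= c%:E * f x.
  by move=> Dx; rewrite mule_ge0 ?lee_fin ?(ltW c0) ?f0.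
rewrite -lee_pdivlMl// [leLHS]ge0_integralE// ge_ereal_sup// => _ [h/= hf] <-.
rewrite lee_pdivlMl// -sintegralrM ge0_integralE//.
apply: ereal_sup_ubound; exists (scale_nnsfun h (ltW c0)) => //= x.
rewrite EFinM; have /(lee_wpmul2l (_ : 0 <= c%:E)) := hf x.
move=> /(_ _)/le_trans; apply; first by rewrite lee_fin ltW.
by rewrite /patch; case: ifP => _; rewrite ?mule0.
Qed.

Lemma sum_lower_integral (I : Type) (s : seq I) (D : set T)
    (f : I -> T -> \bar R) :
  (forall i x, D x -> 0 <= f i x) ->
  \sum_(i <- s) \int[mu]_(x in D) f i x
    <= \int[mu]_(x in D) \sum_(i <- s) f i x.
Proof.
move=> f0; elim: s => [|i s IHs].
  rewrite big_nil; apply: integral_ge0 => x _; by rewrite big_nil.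
rewrite big_cons; under [leRHS]eq_integral do rewrite big_cons.
apply: le_trans (leeD (lexx _) IHs) _; apply: lower_integralD => [x Dx|x Dx].
  exact: f0.
by apply: sume_ge0 => j _; exact: f0.
Qed.

(** The positive and the negative parts of f both have a lower integral between 0 and
    that of |f|, so their difference is bounded by it. *)
Lemma normr_Rintegral_le (D : set T) (f : T -> R) :
  `|\int[mu]_(x in D) f x|%R%:E <= \int[mu]_(x in D) `|f x|%:E.
Proof.
have I0 : 0 <= \int[mu]_(x in D) `|f x|%:E.
  by apply: integral_ge0 => x _; rewrite lee_fin.
have [->|Iy] := eqVneq (\int[mu]_(x in D) `|f x|%:E) +oo; first exact: leey.
have Ilt : \int[mu]_(x in D) `|f x|%:E < +oo by rewrite ltey.
have lep : \int[mu]_(x in D) (EFin \o f)^\+ x <= \int[mu]_(x in D) `|f x|%:E.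
  apply: le_lower_integral => x _ //=.
  by rewrite funeposE/= -EFin_max lee_fin ge_max ler_norm/=.
have len : \int[mu]_(x in D) (EFin \o f)^\- x <= \int[mu]_(x in D) `|f x|%:E.
  apply: le_lower_integral => x _ //=.
  by rewrite funenegE/= -EFin_max lee_fin ge_max -normrN ler_norm/=.
have p0 : 0 <= \int[mu]_(x in D) (EFin \o f)^\+ x by exact: integral_ge0.
have n0 : 0 <= \int[mu]_(x in D) (EFin \o f)^\- x by exact: integral_ge0.
rewrite /Rintegral integralE.
move: lep len p0 n0 Ilt I0.
move: (\int[mu]_(x in D) _) => a; move: (\int[mu]_(x in D) _) => b.
move: (\int[mu]_(x in D) _) => c.
case: c => [c| |] //; case: a => [a| |]//; case: b => [b| |]//=.
rewrite !lee_fin => ac bc a0 b0 _ c0; rewrite ler_norml; apply/andP; split; lra.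
Qed.

Lemma bounded_integrable (D : set T) (f : T -> R) (M : R) :
  measurable D -> mu D < +oo -> measurable_fun D f ->
  (forall x, D x -> (`|f x| <= M)%R) -> mu.-integrable D (EFin \o f).
Proof.
move=> mD Dfin mf fM; apply: measurable_bounded_integrable => //.
exists M; split; first exact: num_real.
by move=> M' MM' x Dx /=; apply: le_trans (fM x Dx) _; exact: ltW.
Qed.

End lower_integral.

(** * Trigonometric basis of an interval *)

Section FTC.
Context {R : realType}.
Local Notation mu := (@lebesgue_measure R).

Lemma integral_FTC (f F : R -> R) (a b : R) : a < b ->
  (forall x, a <= x <= b -> is_derive x 1 F (f x)) ->
  (forall x, a <= x <= b -> {for x, continuous f}) ->
  (\int[mu]_(x in `[a, b]) (f x)%:E = (F b - F a)%:E)%E.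
Proof.
move=> ab dF cf.
have cF x : a <= x <= b -> {for x, continuous F}.
  move=> xab; apply: differentiable_continuous; apply/derivable1_diffP.
  by have := dF x xab => -[].
rewrite (@continuous_FTC2 _ f F)//.
- apply: continuous_in_subspaceT => x /set_mem; rewrite /= in_itv/= => xab.
  exact: cf.
- split.
  + move=> x; rewrite in_itv/= => /andP[ax xb].
    by have [|] := dF x; rewrite ?(ltW ax) ?(ltW xb).
  + by apply: cvg_at_right_filter; apply: cF; rewrite lexx ltW.
  + by apply: cvg_at_left_filter; apply: cF; rewrite lexx ltW.
- move=> x; rewrite in_itv/= => /andP[ax xb].
  have H : is_derive x 1 F (f x) by apply: dF; rewrite !ltW.
  by rewrite derive1E derive_val.
Qed.

End FTC.

Lemma is_derive_affine (R : realType) (a b z : R) :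
  is_derive z 1 (fun z : R => a * z + b) a.
Proof. by apply: is_derive_eq; rewrite addr0 [LHS]mulr1. Qed.

Lemma measurable_cos_comp d (T : measurableType d) (R : realType) (D : set T)
    (g : T -> R) : measurable_fun D g -> measurable_fun D (fun x => cos (g x)).
Proof.
move=> mg; apply: (measurableT_comp (f := @cos R)) mg.
by apply: continuous_measurable_fun; exact: continuous_cos.
Qed.

Section trigonometric_basis.
Context {R : realType}.
Variable L : R.
Hypothesis L_gt0 : 0 < L.
Local Notation mu := (@lebesgue_measure R).

Definition lam (j : int) : R := 2 * pi * j%:~R / L.

Let kap (j : int) : R := if j == 0 then (Num.sqrt L)^-1 else Num.sqrt (2 / L).
Let phase (j : int) : R := if 0 < j then - (pi / 2) else 0.

(** A phase shift merges the three cases of the basis into one cosine, so that the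
    products of two basis functions are handled by one addition formula. *)
Let omegaE j z : omega L j z = kap j * cos (lam j * z + phase j).
Proof.
rewrite /omega /kap /phase /lam; have [j0|j0|<-] := ltgtP 0 j.
- rewrite cosBpihalf; congr (_ * sin _); field; exact: lt0r_neq0.
- rewrite addr0; congr (_ * cos _); field; exact: lt0r_neq0.
- by rewrite !(mulr0, mul0r) addr0 cos0 mulr1.
Qed.

Let kap_ge0 j : 0 <= kap j.
Proof. by rewrite /kap; case: ifP => _; rewrite ?invr_ge0 ?sqrtr_ge0. Qed.

Let kap_le j : kap j <= Num.sqrt (2 / L).
Proof.
rewrite /kap; case: ifP => // _; rewrite -(sqrtrV (ltW L_gt0)).
by apply: ler_wsqrtr; rewrite ler_peMl ?ler1n// invr_ge0 ltW.
Qed.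

Lemma normr_omega_le j z : `|omega L j z| <= Num.sqrt (2 / L).
Proof.
rewrite omegaE normrM ger0_norm//; apply: le_trans (kap_le j).
by rewrite ler_piMr// cos_max.
Qed.

(** Differentiation exchanges the sine of frequency j and the cosine of frequency -j:
    derivatives of basis functions are multiples of basis functions. *)
Lemma is_derive_omega (j : int) (z : R) : is_derive z 1 (omega L j) (lam j * omega L (- j) z).
Proof.
have -> : omega L j = (fun z => kap j * cos (lam j * z + phase j)).
  by apply/funext => x; rewrite omegaE.
have -> : lam j * omega L (- j) z
    = kap j * (- sin (lam j * z + phase j) * lam j).
  rewrite omegaE /kap oppr_eq0 /phase oppr_gt0.
  have lamN : lam (- j) = - lam j by rewrite /lam mulrNz; ring.
  rewrite lamN; have [j0|j0|<-] := ltgtP 0 j.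
  - by rewrite addr0 mulNr cosN sinBpihalf; ring.
  - by rewrite addr0 mulNr cosBpihalf sinN; ring.
  - by rewrite /lam; ring.
have h := is_derive_affine (lam j) (phase j) z.
by apply: is_derive_eq; rewrite //.
Qed.

Lemma derive1_omega (j : int) (z : R) : derive1 (omega L j) z = lam j * omega L (- j) z.
Proof. by rewrite derive1E; have := is_derive_omega j z => H; rewrite derive_val. Qed.

Lemma continuous_omega j : continuous (omega L j).
Proof.
move=> z; apply: differentiable_continuous; apply/derivable1_diffP.
by have [] := is_derive_omega j z.
Qed.

Lemma integral_cos_period (m : int) (c : R) :
  (\int[mu]_(z in `[0%R, L]) (cos (lam m * z + c))%:E
    = (if m == 0 then L * cos c else 0)%:E)%E.
Proof.
have dlin (z : R) := is_derive_affine (lam m) c z.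
have ccos : forall z, {for z, continuous (fun z => cos (lam m * z + c))}.
  move=> z; apply: (@continuous_comp _ _ _ (fun z => lam m * z + c)).
    by apply: cvgD; [apply: cvgM; [exact: cvg_cst|exact: cvg_id]|exact: cvg_cst].
  exact: continuous_cos.
have [->|m0] := eqVneq m 0.
  have -> : lam 0 = 0 by rewrite /lam; ring.
  under eq_integral do rewrite mul0r add0r.
  rewrite integral_cst//= lebesgue_measure_itv/= lte_fin L_gt0 oppr0 adde0.
  by rewrite -EFinM mulrC.
have lam0 : lam m != 0.
  by rewrite /lam !mulf_neq0 ?invr_eq0 ?(gt_eqF L_gt0) ?intr_eq0 ?(gt_eqF (pi_gt0 R)).
have dF (x : R) : 0 <= x <= L -> is_derive x 1
    (fun z : R => (lam m)^-1 * sin (lam m * z + c)) (cos (lam m * x + c)).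
  move=> _; have h := dlin x; apply: is_derive_eq.
  by rewrite /GRing.scale/= mulrCA mulVf// mulr1.
rewrite (integral_FTC L_gt0 dF); last by move=> x _; exact: ccos.
have sN : forall y k, sin (y + (2 * pi) * k%:~R) = sin y :> R.
  move=> y k; have p n x : sin (x + 2 * pi * n%:R) = sin x :> R.
    rewrite (_ : 2 * pi * n%:R = (pi *+ 2) *+ n); last by rewrite -[RHS]mulr_natr -[pi *+ 2]mulr_natr [pi * _]mulrC.
    exact: (periodicn (@sinD2pi R)).
  case: k => n; first by rewrite -pmulrn p.
  by rewrite NegzE mulrNz -pmulrn -[LHS](p n.+1); congr sin; ring.
rewrite mulr0 add0r (_ : lam m * L + c = c + 2 * pi * m%:~R).
  by rewrite sN subrr.
by rewrite /lam; field; exact: lt0r_neq0.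
Qed.

Lemma integral_omegaM (j l : int) :
  \int[mu]_(z in `[0, L]) (omega L j z * omega L l z) = (j == l)%:R.
Proof.
have lamD : lam (j - l) = lam j - lam l by rewrite /lam rmorphB/=; ring.
have lamS : lam (j + l) = lam j + lam l by rewrite /lam rmorphD/=; ring.
rewrite /Rintegral.
have fcos (m : int) (c : R) : measurable_fun (`[0, L] : set R) (fun z => cos (lam m * z + c)).
  apply: measurable_funTS; apply: measurable_cos_comp.
  by apply: measurable_funD => //; apply: measurable_funM.
have icos (m : int) (c : R) : mu.-integrable `[0, L] (EFin \o (fun z => cos (lam m * z + c))).
  apply: (@bounded_integrable _ _ _ _ _ _ 1) => //.
  - by rewrite [ltLHS]lebesgue_measure_itv/= lte_fin L_gt0 -EFinB ltry.
  - exact: fcos.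
  - by move=> x _; exact: cos_max.
have -> : (fun z => (omega L j z * omega L l z)%:E) = (fun z =>
    (kap j * kap l / 2)%:E * ((cos (lam (j - l) * z + (phase j - phase l)))%:E
       + (cos (lam (j + l) * z + (phase j + phase l)))%:E))%E.
  apply/funext => z; rewrite -EFinD -EFinM; congr EFin.
  rewrite !omegaE lamD lamS.
  have -> : (lam j - lam l) * z + (phase j - phase l) =
    (lam j * z + phase j) - (lam l * z + phase l) by ring.
  have -> : (lam j + lam l) * z + (phase j + phase l) =
    (lam j * z + phase j) + (lam l * z + phase l) by ring.
  move: (lam j * z + phase j) (lam l * z + phase l) => A B.
  by rewrite cosB cosD; field.
rewrite integralZl//; last by apply: integrableD => //; exact: icos.
rewrite integralD//; [|exact: icos|exact: icos].
rewrite !integral_cos_period -EFinD -EFinM/=.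
have kap0 : kap 0 * kap 0 = L^-1.
  by rewrite /kap eqxx -invfM -expr2 sqr_sqrtr// ltW.
have kapn (i : int) : i != 0 -> kap i * kap i = 2 / L.
  move=> i0; rewrite /kap (negbTE i0) -expr2 sqr_sqrtr// divr_ge0//.
  exact: ltW.
have [<-|jl] := eqVneq j l.
  rewrite !subrr eqxx cos0; have [->|j0] := eqVneq j 0.
    rewrite addr0 eqxx /phase ltxx addr0 cos0 kap0/= mulr1.
    by field; exact: lt0r_neq0.
  rewrite kapn// ifF; last by apply/negbTE; lia.
  rewrite mulr1 addr0 /=; by field; exact: lt0r_neq0.
rewrite subr_eq0 (negbTE jl) add0r; case: ifPn => [/eqP jl0|_]; last by rewrite mulr0.
have -> : l = - j by apply/eqP; rewrite -addr_eq0 addrC jl0.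
have j0 : j != 0 by apply: contraNN jl => /eqP j0; lia.
rewrite (_ : phase j + phase (- j) = - (pi / 2)); last first.
  by rewrite /phase oppr_gt0; case: ltgtP j0 => //; rewrite ?addr0 ?add0r.
by rewrite cosN cos_pihalf !mulr0.
Qed.

End trigonometric_basis.

(** * Fourier series on the torus and the nonlinearity *)

Section bessel.
Context d (T : measurableType d) (R : realType).
Variables (mu : {measure set T -> \bar R}) (D : set T).
Hypotheses (mD : measurable D) (Dfin : (mu D < +oo)%E).
Variables (I : eqType) (e : I -> T -> R) (E : R).
Hypothesis me : forall k, measurable_fun D (e k).
Hypothesis eE : forall k x, D x -> `|e k x| <= E.
Hypothesis orth : forall k l, \int[mu]_(x in D) (e k x * e l x) = (k == l)%:R.

(** The integral of the square of g - S, with S the projection of g, is nonnegative. *)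
Lemma bessel_ineq (s : seq I) (g : T -> R) (M : R) : uniq s ->
  measurable_fun D g -> (forall x, D x -> `|g x| <= M) ->
  \sum_(k <- s) (\int[mu]_(x in D) (g x * e k x)) ^+ 2
    <= \int[mu]_(x in D) (g x) ^+ 2.
Proof.
move=> us mg gM.
have bi (f : T -> R) (K : R) : measurable_fun D f ->
    (forall x, D x -> `|f x| <= K) -> mu.-integrable D (EFin \o f).
  by move=> mf fK; refine (bounded_integrable mD Dfin mf fK).
pose c k := \int[mu]_(x in D) (g x * e k x).
pose S x := \sum_(k <- s) c k * e k x.
have mS : measurable_fun D S.
  by apply: measurable_sum => k; apply: measurable_funM => //; exact: me.
have Sb x : D x -> `|S x| <= \sum_(k <- s) `|c k| * E.
  move=> Dx; apply: le_trans (ler_norm_sum _ _ _) _; apply: ler_sum => k _.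
  by rewrite normrM ler_wpM2l// eE.
set B := \sum_(k <- s) _ in Sb.
have ige k : mu.-integrable D (EFin \o (fun x => g x * e k x)).
  apply: (bi _ (M * E)).
    by apply: measurable_funM => //; exact: me.
  by move=> x tx; rewrite normrM ler_pM// ?gM// eE.
have ieS k : mu.-integrable D (EFin \o (fun x => S x * e k x)).
  apply: (bi _ (B * E)).
    by apply: measurable_funM => //; exact: me.
  by move=> x tx; rewrite normrM ler_pM// ?Sb// eE.
have sumI (h : T -> R) : (forall k, mu.-integrable D (EFin \o (fun x => h x * e k x))) ->
    \int[mu]_(x in D) (h x * S x) =
    \sum_(k <- s) c k * \int[mu]_(x in D) (h x * e k x).
  move=> ih; rewrite /S; elim: s {us S mS B Sb ieS} => [|k s IHs].
    rewrite big_nil (_ : (fun _ => _) = cst 0).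
      by rewrite Rintegral_cst// mul0r.
    by apply/funext => x; rewrite big_nil mulr0.
  rewrite big_cons -IHs -RintegralZl// -RintegralD//.
  - by apply: eq_Rintegral => x _; rewrite big_cons mulrDr; ring.
  - have := integrableZl mD (c k) (ih k); exact.
  - apply: (eq_integrable mD (fun x => \sum_(j <- s) (c j)%:E * (h x * e j x)%:E)%E).
      move=> x _; rewrite /= sumEFin; congr EFin.
      by rewrite mulr_sumr; apply: eq_bigr => j _; ring.
    apply: integrable_sum => // j _; have := integrableZl mD (c j) (ih j); exact.
have gS : \int[mu]_(x in D) (g x * S x) = \sum_(k <- s) c k ^+ 2.
  by rewrite sumI//; apply: eq_bigr => k _; rewrite expr2.
have Se k : k \in s -> \int[mu]_(x in D) (e k x * S x) = c k.
  move=> ks; rewrite sumI; last first.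
    move=> j; apply: (bi _ (E * E)).
      by apply: measurable_funM => //; exact: me.
    by move=> x tx; rewrite normrM ler_pM// eE.
  under eq_bigr do rewrite orth.
  rewrite (bigD1_seq k)//= eqxx mulr1 big1 ?addr0// => j jk.
  by rewrite eq_sym (negbTE jk) mulr0.
have SS : \int[mu]_(x in D) (S x * S x) = \sum_(k <- s) c k ^+ 2.
  rewrite sumI// big_seq [RHS]big_seq; apply: eq_bigr => k ks.
  rewrite expr2 -[in X in _ = _ * X](Se k ks); congr (_ * _).
  by apply: eq_Rintegral => x _; rewrite mulrC.
have ig2 : mu.-integrable D (EFin \o (fun x => g x ^+ 2)).
  apply: (bi _ (M ^+ 2)); first exact: measurable_funX.
  by move=> x tx; rewrite normrX ler_pXn2r ?nnegrE// ?gM//; apply: le_trans (gM x tx).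
have igS : mu.-integrable D (EFin \o (fun x => g x * S x)).
  apply: (bi _ (M * B)); first exact: measurable_funM.
  by move=> x tx; rewrite normrM ler_pM// ?gM// Sb.
have iSS : mu.-integrable D (EFin \o (fun x => S x * S x)).
  apply: (bi _ (B * B)); first exact: measurable_funM.
  by move=> x tx; rewrite normrM ler_pM// ?Sb.
have : 0 <= \int[mu]_(x in D) ((g x ^+ 2 - g x * S x) - (g x * S x - S x * S x)).
  apply: Rintegral_ge0 => x _.
  rewrite (_ : _ - _ = (g x - S x) ^+ 2) ?sqr_ge0//; ring.
rewrite RintegralB//; last 2 first.
- have := integrableB mD ig2 igS; exact.
- have := integrableB mD igS iSS; exact.
rewrite RintegralB// RintegralB// gS SS subrr subr0 subr_ge0; exact.
Qed.

End bessel.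

Lemma Rintegral_setXM d1 d2 (T1 : measurableType d1) (T2 : measurableType d2)
    (R : realType) (m1 : {sigma_finite_measure set T1 -> \bar R})
    (m2 : {sigma_finite_measure set T2 -> \bar R}) (D1 : set T1) (D2 : set T2)
    (a : T1 -> R) (b : T2 -> R) :
  measurable D1 -> measurable D2 ->
  m1.-integrable D1 (EFin \o a) -> m2.-integrable D2 (EFin \o b) ->
  (m1 \x m2)%E.-integrable (D1 `*` D2) (EFin \o (fun x => a x.1 * b x.2)) ->
  \int[(m1 \x m2)%E]_(x in D1 `*` D2) (a x.1 * b x.2) =
  (\int[m1]_(x in D1) a x) * (\int[m2]_(x in D2) b x).
Proof.
move=> mD1 mD2 ia ib iab.
rewrite /Rintegral integral_mkcond -integral12_prod_meas1; last first.
  by apply/(integrable_mkcond _ _).1 => //; exact: measurableX.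
have -> : (fun x => \int[m2]_y ((fun z : T1 * T2 => (a z.1 * b z.2)%:E) \_ (D1 `*` D2)) (x, y))%E
  = (fun x => ((EFin \o a) \_ D1) x * \int[m2]_(y in D2) (b y)%:E)%E.
  apply/funext => x; rewrite [in RHS]integral_mkcond.
  have ib' : m2.-integrable setT ((EFin \o b) \_ D2) by apply/(integrable_mkcond _ _).1.
  have [xD|xD] := boolP (x \in D1).
    rewrite [X in (X * _)%E]patchE xD -[RHS](integralZl measurableT ib').
    apply: eq_integral => y _; rewrite !patchE in_setX/= xD/=.
    by case: ifP => _; rewrite ?mule0.
  rewrite [X in (X * _)%E]patchE (negbTE xD) mul0e; apply: integral0_eq => y _.
  by rewrite patchE in_setX/= (negbTE xD).
have ibfin := integrable_fin_num mD2 ib.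
rewrite -(fineK ibfin) integralZr//; last by apply/(integrable_mkcond _ _).1.
rewrite -integral_mkcond.
have iafin := integrable_fin_num mD1 ia.
by rewrite -(fineK iafin).
Qed.

Section torus_fourier.
Context {R : realType}.
Variable L : R.
Hypothesis L_gt0 : 0 < L.
Local Notation mu := (@lebesgue_measure R).
Local Notation mu2 := ((@lebesgue_measure R) \x (@lebesgue_measure R))%E.

Lemma mu_lam (k : int * int) : mu_ L k = lam L k.1 ^+ 2 + lam L k.2 ^+ 2.
Proof.
rewrite /mu_ /lam /freq_norm !expr_div_n !exprMn sqr_sqrtr; last first.
  by rewrite addr_ge0// sqr_ge0.
by rewrite mulrDr mulrDl.
Qed.

Lemma d1eE k x : d1e_ L k x = lam L k.1 * e_ L (- k.1, k.2) x.
Proof. by rewrite /d1e_ derive1_omega// /e_/= mulrA. Qed.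

Lemma d2eE k x : d2e_ L k x = lam L k.2 * e_ L (k.1, - k.2) x.
Proof. by rewrite /d2e_ derive1_omega// /e_/= mulrCA. Qed.

(** The sigma-algebra is spelled out in the form which underlies the product of two
    Lebesgue measures. *)
Lemma measurable_torus : @measurable _
  (g_sigma_algebraType (R.-ocitv.-measurable)
   * g_sigma_algebraType (R.-ocitv.-measurable))%type (torus L).
Proof. by apply: measurableX; exact: measurable_itv. Qed.

Lemma measure_torus : mu2 (torus L) = (L ^+ 2)%:E.
Proof.
have h : mu `[0%R, L]%classic = L%:E.
  by rewrite lebesgue_measure_itv/= lte_fin L_gt0 -EFinB subr0.
transitivity (mu `[0%R, L]%classic * mu `[0%R, L]%classic)%E.
  exact: product_measure1E.
by rewrite h -EFinM -expr2.
Qed.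

Lemma measure_torus_lty : (mu2 (torus L) < +oo)%E.
Proof. by rewrite measure_torus ltry. Qed.

Lemma measurable_e k (D : set (R * R)) : measurable_fun D (e_ L k).
Proof.
apply: measurable_funTS; apply: measurable_funM.
- apply: (measurableT_comp (f := omega L k.1)) => //.
  by apply: continuous_measurable_fun; exact: continuous_omega.
- apply: (measurableT_comp (f := omega L k.2)) => //.
  by apply: continuous_measurable_fun; exact: continuous_omega.
Qed.

Lemma normr_e_le k x : `|e_ L k x| <= 2 / L.
Proof.
have h : 0 <= 2 / L by rewrite divr_ge0// ltW.
rewrite /e_ normrM -[leRHS](sqr_sqrtr h) expr2.
by apply: ler_pM => //; exact: normr_omega_le.
Qed.

Lemma torus_integrable (f : R * R -> R) (M : R) :
  measurable_fun (torus L) f -> (forall x, torus L x -> `|f x| <= M) ->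
  mu2.-integrable (torus L) (EFin \o f).
Proof.
move=> mf fM; refine (@bounded_integrable _ _ _ mu2 (torus L) f M _ measure_torus_lty mf fM).
exact: measurable_torus.
Qed.

Lemma Rintegral_torusM (a b : R -> R) : continuous a -> continuous b ->
  \int[mu2]_(x in torus L) (a x.1 * b x.2) =
  (\int[mu]_(x in `[0, L]) a x) * (\int[mu]_(x in `[0, L]) b x).
Proof.
move=> ca cb.
have bnd (c : R -> R) : continuous c -> exists K, forall x, x \in `[0, L] -> `|c x| <= K.
  move=> cc; have [] := @EVT_max _ (fun x => `|c x|) 0 L (ltW L_gt0).
    apply: continuous_subspaceT => x; apply: continuous_comp; [exact: cc|exact: norm_continuous].
  by move=> k _ kb; exists `|c k|.
have [K aK] := bnd a ca; have [K' bK'] := bnd b cb.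
have mc (c : R -> R) : continuous c -> measurable_fun setT c.
  exact: continuous_measurable_fun.
have fin : (mu `[0%R, L]%classic < +oo)%E.
  by rewrite lebesgue_measure_itv/= lte_fin L_gt0 -EFinB ltry.
apply: Rintegral_setXM => //.
- refine (@bounded_integrable _ _ _ mu `[0%R, L]%classic a K _ fin _ _) => //.
  by apply: measurable_funTS; exact: mc.
- refine (@bounded_integrable _ _ _ mu `[0%R, L]%classic b K' _ fin _ _) => //.
  by apply: measurable_funTS; exact: mc.
- apply: (@torus_integrable _ (K * K')).
    apply: measurable_funTS; apply: measurable_funM.
      by apply: (measurableT_comp (f := a)) => //; exact: mc.
    by apply: (measurableT_comp (f := b)) => //; exact: mc.
  by move=> x [x1 x2]; rewrite normrM ler_pM ?aK ?bK'.
Qed.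

Lemma integral_eM (k l : int * int) :
  \int[mu2]_(x in torus L) (e_ L k x * e_ L l x) = (k == l)%:R.
Proof.
have -> : \int[mu2]_(x in torus L) (e_ L k x * e_ L l x) =
  \int[mu2]_(x in torus L) ((omega L k.1 x.1 * omega L l.1 x.1)
     * (omega L k.2 x.2 * omega L l.2 x.2)).
  by apply: eq_Rintegral => x _; rewrite /e_ mulrACA.
rewrite (Rintegral_torusM (a := fun z => omega L k.1 z * omega L l.1 z)
  (b := fun z => omega L k.2 z * omega L l.2 z)).
- by rewrite !integral_omegaM// -natrM mulnb; case: k l => [? ?] [? ?].
- by move=> z; apply: continuousM; exact: continuous_omega.
- by move=> z; apply: continuousM; exact: continuous_omega.
Qed.

Lemma measurable_L2sum b (u : coef) : measurable_fun (torus L) (L2sum L b u).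
Proof.
rewrite /L2sum; case: xgetP => [g -> [mg _] //|_].
exact: measurable_cst.
Qed.

Lemma enorm_sqr (z : R * R) : enorm z ^+ 2 = z.1 ^+ 2 + z.2 ^+ 2.
Proof. by rewrite /enorm sqr_sqrtr// addr_ge0// sqr_ge0. Qed.

Lemma measurable_f_grad (u : coef) :
  measurable_fun (torus L) (fun x => (f_ (grad L u x)).1) /\
  measurable_fun (torus L) (fun x => (f_ (grad L u x)).2).
Proof.
have m1 := measurable_L2sum (d1e_ L) u; have m2 := measurable_L2sum (d2e_ L) u.
have mn : measurable_fun (torus L) (fun x => enorm (grad L u x)).
  apply: (measurableT_comp (f := @Num.sqrt R)).
    by apply: continuous_measurable_fun; exact: sqrt_continuous.
  by apply: measurable_funD; exact: measurable_funX.
have mi : measurable_fun (torus L) (fun x => (1 + enorm (grad L u x) ^+ 2)^-1).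
  apply: (measurableT_comp (f := fun y : R => (1 + y ^+ 2)^-1)) mn.
  by apply: continuous_measurable_fun; exact: continuous_oneDsqrV.
by split; apply: measurable_funM.
Qed.

Lemma enorm_f (z : R * R) : enorm (f_ z) = enorm z / (1 + enorm z ^+ 2).
Proof.
have d0 : 0 < 1 + enorm z ^+ 2 by rewrite ltr_pwDl// sqr_ge0.
rewrite {1}/enorm /f_/= !expr_div_n -mulrDl -enorm_sqr.
rewrite -expr_div_n sqrtr_sqr ger0_norm// divr_ge0 ?sqrtr_ge0// ltW//.
Qed.

Lemma enorm_f_le1 (z : R * R) : enorm (f_ z) <= 1.
Proof.
have d0 : 0 < 1 + enorm z ^+ 2 by rewrite ltr_pwDl// sqr_ge0.
have n0 : 0 <= enorm z by exact: sqrtr_ge0.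
by rewrite enorm_f ler_pdivrMr// mul1r; nra.
Qed.

Lemma enorm_f_leV (z : R * R) : 0 < enorm z -> enorm (f_ z) <= (enorm z)^-1.
Proof.
move=> n0; have d0 : 0 < 1 + enorm z ^+ 2 by rewrite ltr_pwDl// sqr_ge0.
by rewrite enorm_f ler_pdivrMr// ler_pdivlMl//; nra.
Qed.

Lemma normr_fst_le (z : R * R) : `|z.1| <= enorm z.
Proof. by rewrite -sqrtr_sqr ler_wsqrtr// lerDl sqr_ge0. Qed.

Lemma normr_snd_le (z : R * R) : `|z.2| <= enorm z.
Proof. by rewrite -sqrtr_sqr ler_wsqrtr// lerDr sqr_ge0. Qed.

(** Both partial derivatives of e_k are multiples of basis functions, so each component
    of f (grad u) enters through one of its Fourier coefficients. *)
Lemma frakFE (u : coef) k : frakF L u k =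
  lam L k.1 * \int[mu2]_(x in torus L) ((f_ (grad L u x)).1 * e_ L (- k.1, k.2) x)
  + lam L k.2 * \int[mu2]_(x in torus L) ((f_ (grad L u x)).2 * e_ L (k.1, - k.2) x).
Proof.
have [m1 m2] := measurable_f_grad u.
have ig (g : R * R -> R) j : measurable_fun (torus L) g ->
    (forall x, `|g x| <= 1) -> mu2.-integrable (torus L) (EFin \o (fun x => g x * e_ L j x)).
  move=> mg g1; apply: (@torus_integrable _ (1 * (2 / L))).
    by apply: measurable_funM => //; exact: measurable_e.
  by move=> x _; rewrite normrM ler_pM// normr_e_le.
have i1 j := ig _ j m1 (fun x => le_trans (normr_fst_le _) (enorm_f_le1 (grad L u x))).
have i2 j := ig _ j m2 (fun x => le_trans (normr_snd_le _) (enorm_f_le1 (grad L u x))).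
have mT := measurable_torus.
rewrite /frakF -(RintegralZl _ mT (i1 _)) -(RintegralZl _ mT (i2 _)).
rewrite -(RintegralD mT (integrableZl mT (lam L k.1) (i1 (- k.1, k.2)))
  (integrableZl mT (lam L k.2) (i2 (k.1, - k.2)))).
by apply: eq_Rintegral => x _; rewrite d1eE d2eE /=; ring.
Qed.

(** A bound on the nonlinearity in H^-1 that does not depend on u.  By frakFE and the
    Cauchy-Schwarz inequality in the plane, frakF_k^2 / mu_k is at most the sum of the
    squares of two Fourier coefficients of functions bounded by 1. *)
Lemma sum_frakF_le (u : coef) (s : seq (int * int)) : uniq s -> 0 \notin s ->
  \sum_(k <- s) frakF L u k ^+ 2 / mu_ L k <= 2 * L ^+ 2.
Proof.
move=> us s0; have [m1 m2] := measurable_f_grad u.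
have b1 x : torus L x -> `|(f_ (grad L u x)).1| <= 1.
  by move=> _; exact: le_trans (normr_fst_le _) (enorm_f_le1 _).
have b2 x : torus L x -> `|(f_ (grad L u x)).2| <= 1.
  by move=> _; exact: le_trans (normr_snd_le _) (enorm_f_le1 _).
have bes (g : R * R -> R) : measurable_fun (torus L) g -> (forall x, torus L x -> `|g x| <= 1) ->
    forall r : seq (int * int), uniq r ->
  \sum_(k <- r) (\int[mu2]_(x in torus L) (g x * e_ L k x)) ^+ 2 <= L ^+ 2.
  move=> mg g1 r ur.
  refine (le_trans (@bessel_ineq _ _ R mu2 (torus L) measurable_torus
    measure_torus_lty _ (e_ L) (2 / L) (fun k => @measurable_e k _)
    (fun k x _ => @normr_e_le k x) integral_eM r g 1 ur mg g1) _).
  have mT := measurable_torus.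
  have -> : L ^+ 2 = \int[mu2]_(x in torus L) 1.
    rewrite (Rintegral_cst _ mT) mul1r; exact: (esym (congr1 fine measure_torus)).
  apply: (le_Rintegral mT).
  - apply: (@torus_integrable _ 1); first exact: measurable_funX.
    by move=> x tx; rewrite normrX exprn_ile1// g1.
  - by apply: (@torus_integrable _ 1) => // x _; rewrite normr1.
  - by move=> x tx; rewrite -real_normK ?num_real// exprn_ile1// g1.
pose k1 (k : int * int) := (- k.1, k.2); pose k2 (k : int * int) := (k.1, - k.2).
have := bes _ m1 b1 (map k1 s).
have := bes _ m2 b2 (map k2 s).
rewrite !big_map !map_inj_uniq//; last 2 first.
- by move=> [a b] [a' b'] [/oppr_inj -> ->].
- by move=> [a b] [a' b'] [-> /oppr_inj ->].
move=> /(_ us) h2 /(_ us) h1.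
have -> : 2 * L ^+ 2 = L ^+ 2 + L ^+ 2 by ring.
apply: le_trans (lerD h1 h2); rewrite -big_split/= big_seq [leRHS]big_seq.
apply: ler_sum => k ks.
have k0 : 0 < mu_ L k.
  rewrite mu_lam lt_neqAle addr_ge0 ?sqr_ge0// andbT eq_sym paddr_eq0 ?sqr_ge0//.
  rewrite !sqrf_eq0; apply: contraNN s0 => /andP[].
  rewrite /lam !mulf_eq0 invr_eq0 (gt_eqF L_gt0) !intr_eq0 !(gt_eqF (pi_gt0 R)).
  rewrite !orbF pnatr_eq0/= => /eqP e1 /eqP e2.
  by move: ks; case: (k) e1 e2 => a b /= -> ->.
rewrite ler_pdivrMr// frakFE mu_lam.
rewrite /k1 /k2; set A := Rintegral _ _ _; set B := Rintegral _ _ _.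
move: A B (lam L k.1) (lam L k.2) => A B a b.
rewrite -subr_ge0 (_ : _ - _ = (a * B - b * A) ^+ 2) ?sqr_ge0//; ring.
Qed.

End torus_fourier.

(** * Sums over frequencies *)

Lemma ler_sum_subset (R : numDomainType) (I : eqType) (s t : seq I) (F : I -> R) :
  uniq s -> uniq t -> {subset s <= t} -> (forall i, 0 <= F i) ->
  \sum_(i <- s) F i <= \sum_(i <- t) F i.
Proof.
move=> us ut st F0.
have /(perm_big _) -> : perm_eq t (s ++ [seq i <- t | i \notin s]).
  apply: uniq_perm => //.
    rewrite cat_uniq us filter_uniq// andbT /=.
    by apply/hasPn => i; rewrite mem_filter => /andP[].
  move=> i; rewrite mem_cat mem_filter; case: (boolP (i \in s)) => //= /st -> //.
by rewrite big_cat/= lerDl sumr_ge0.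
Qed.

Section frequencies.
Context {R : realType}.
Implicit Types (k : int * int) (s : seq (int * int)).

Lemma freq_norm_sqr k :
  @freq_norm R k ^+ 2 = (k.1%:~R) ^+ 2 + (k.2%:~R) ^+ 2.
Proof. by rewrite /freq_norm sqr_sqrtr// addr_ge0// sqr_ge0. Qed.

Lemma freq_norm_ge0 k : 0 <= @freq_norm R k.
Proof. exact: sqrtr_ge0. Qed.

Lemma freq_norm_natE k :
  @freq_norm R k ^+ 2 = (`|k.1| ^ 2 + `|k.2| ^ 2)%N%:R.
Proof.
rewrite freq_norm_sqr natrD !natrX !natr_absz.
by rewrite !intr_norm !real_normK// ?num_real.
Qed.

Lemma freq_norm_ge1 k : k != 0 -> 1 <= @freq_norm R k.
Proof.
move=> k0; rewrite -(@ler_pXn2r _ 2)// ?nnegrE ?freq_norm_ge0//.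
rewrite expr1n freq_norm_natE (ler_nat R 1); case: k k0 => a b /= ab0.
rewrite addn_gt0 !expn_gt0 !orbF !absz_gt0 -negb_and.
by apply: contraNN ab0 => /andP[/eqP -> /eqP ->].
Qed.

Lemma freq_norm_gt0 k : (0 < @freq_norm R k) = (k != 0).
Proof.
apply/idP/idP => [|/freq_norm_ge1]; last exact: lt_le_trans.
by apply: contraTneq => ->; rewrite /freq_norm/= expr0n/= addr0 sqrtr0 ltxx.
Qed.

(** As |k|^2 >= max (1, |k_1|) max (1, |k_2|), the power |k|^-3 is dominated by a product
    of two of these weights, and they are summable. *)
Definition weight (i : nat) : R := (Num.sqrt (maxn 1 i)%:R) ^- 3.

Lemma weight_ge0 i : 0 <= weight i.
Proof. by rewrite invr_ge0 exprn_ge0// sqrtr_ge0. Qed.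

(** Telescoping: b^-3 <= 2 / a - 2 / b for positive a and b such that b^2 = a^2 + 1. *)
Lemma sum_weight n : \sum_(0 <= i < n) weight i <= 4.
Proof.
case: n => [|n]; first by rewrite big_geq.
rewrite big_nat_recl// {1}/weight maxnE/= sqrtr1 expr1n invr1.
(* The term i = 0 is apart: the telescoping starts at 1, and 1 + 3 = 4. *)
suff : n = 0%N \/ \sum_(0 <= i < n) weight i.+1 <= 3 - 2 / Num.sqrt n%:R.
  move=> [->|h]; first by rewrite big_geq// addr0; lra.
  have : 0 <= 2 / Num.sqrt n%:R :> R by rewrite divr_ge0// sqrtr_ge0.
  lra.
elim: n => [|n IHn]; first by left.
right; rewrite big_nat_recr//= /weight.
case: n IHn => [|n] IHn; first by rewrite big_geq// maxnE/= sqrtr1 expr1n invr1; lra.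
case: IHn => [//|IHn]; apply: le_trans (lerD IHn (lexx _)) _.
rewrite maxnE subSS subn0/= add1n.
set a := Num.sqrt n.+1%:R; set b := Num.sqrt n.+2%:R.
have a0 : 0 < a by rewrite sqrtr_gt0.
have b0 : 0 < b by rewrite sqrtr_gt0.
have b2 : b ^+ 2 = a ^+ 2 + 1 by rewrite !sqr_sqrtr// -natr1.
suff h : b ^- 3 <= 2 / a - 2 / b by rewrite -/b; lra.
have -> : 2 / a - 2 / b = 2 * (b ^+ 2 - a ^+ 2) / (a * b * (a + b)).
  by field; rewrite !gt_eqF//= addr_gt0.
rewrite b2 (addrC (a ^+ 2)) addrK mulr1.
have d0 : 0 < a * b * (a + b) by rewrite !mulr_gt0// addr_gt0.
rewrite ler_pdivlMr// ler_pdivrMl ?exprn_gt0//.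
have ab : a <= b by apply: ler_wsqrtr; rewrite ler_nat.
have : a * b * (a + b) <= b * b * (b + b).
  apply: ler_pM; [by rewrite mulr_ge0 ?ltW|by rewrite addr_ge0 ?ltW| |by rewrite lerD2r].
  by rewrite ler_pM2r.
by rewrite (_ : b ^+ 3 * 2 = b * b * (b + b)) ?expr3; [lra|ring].
Qed.

Lemma freq_norm3_le k : k != 0 ->
  (@freq_norm R k) ^- 3 <= weight `|k.1| * weight `|k.2|.
Proof.
move=> k0; have n0 := freq_norm_ge1 k0.
rewrite /weight -exprVn -!exprVn -exprMn -invfM.
set b := Num.sqrt _ * _; have b0 : 0 < b.
  by rewrite mulr_gt0// sqrtr_gt0 ltr0n leq_max.
rewrite lerXn2r ?nnegrE ?invr_ge0 ?freq_norm_ge0 ?(ltW b0)//.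
rewrite lef_pV2 ?posrE//; last exact: lt_le_trans n0.
rewrite -(@ler_pXn2r _ 2)// ?nnegrE ?freq_norm_ge0 ?(ltW b0)//.
rewrite freq_norm_natE exprMn !sqr_sqrtr// -natrM ler_nat.
case: k k0 {n0 b b0} => a b /= ab0.
have : (absz a != 0%N) || (absz b != 0%N).
  by rewrite -negb_and !absz_eq0; apply: contraNN ab0 => /andP[/eqP -> /eqP ->].
move: (absz a) (absz b) => m n.
by case: m => [|m]; case: n => [|n] //= _; rewrite ?maxnE/=; nia.
Qed.

Lemma sum_freq_norm3 s : uniq s -> 0 \notin s ->
  \sum_(k <- s) (@freq_norm R k) ^- 3 <= 64.
Proof.
move=> us s0.
have [B sB] : exists B, forall k, k \in s -> (maxn `|k.1| `|k.2| < B)%N.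
  exists (\max_(k <- s) maxn `|k.1| `|k.2|).+1 => k ks; rewrite ltnS.
  exact: (leq_bigmax_seq k).
pose r : seq int := [seq Posz i | i <- iota 0 B] ++ [seq - Posz i.+1 | i <- iota 0 B].
have ur : uniq r.
  rewrite cat_uniq !map_inj_uniq ?iota_uniq//=; last 2 first.
  - by move=> i j /oppr_inj [].
  - by move=> i j [].
  by rewrite andbT; apply/hasPn => _ /mapP[i _ ->]; apply/mapP => -[j _].
have rP (j : int) : (`|j| < B)%N -> j \in r.
  case: j => n nB; rewrite mem_cat; apply/orP; [left|right]; apply/mapP; exists n => //.
  - by rewrite mem_iota.
  - by rewrite mem_iota/=; apply: ltn_trans nB.
have wr : \sum_(j <- r) weight `|j| <= 8.
  rewrite big_cat/= !big_map.
  have := sum_weight B; rewrite /index_iota subn0 => h1.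
  have := sum_weight B.+1; rewrite big_nat_recl// /index_iota subn0 => h2.
  have h3 := weight_ge0 0.
  rewrite (_ : 8 = 4 + 4 :> R); last by lra.
  apply: lerD => //; apply: le_trans (_ : weight 0 + \sum_(i <- iota 0 B) weight i.+1 <= 4) => //.
  by rewrite lerDr.
apply: (@le_trans _ _ (\sum_(k <- s) weight `|k.1| * weight `|k.2|)).
  rewrite big_seq [leRHS]big_seq; apply: ler_sum => k ks; apply: freq_norm3_le.
  by apply: contraNneq s0 => <-.
apply: (@le_trans _ _ (\sum_(k <- [seq (i, j) | i <- r, j <- r]) weight `|k.1| * weight `|k.2|)).
  apply: ler_sum_subset => //.
  - by apply: allpairs_uniq => // [[a b] [a' b']] _ _ [-> ->].
  - move=> k /sB kB.
    apply/allpairsP; exists k; rewrite -surjective_pairing; split=> //; apply: rP;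
      by apply: leq_ltn_trans kB; rewrite ?leq_maxl ?leq_maxr.
  - by move=> k; rewrite mulr_ge0// weight_ge0.
rewrite big_allpairs/=.
under eq_bigr do rewrite -mulr_sumr.
rewrite -mulr_suml (_ : 64 = 8 * 8 :> R); last by lra.
by apply: ler_pM => //; apply: sumr_ge0 => j _; exact: weight_ge0.
Qed.

End frequencies.

(** * Pointwise sums of Fourier series *)

(** Uniqueness of L^2 limits, from (h - g)^2 <= 2 (h - S_n)^2 + 2 (g - S_n)^2. *)
Lemma ae_eq_L2_limit d (T : measurableType d) (R : realType)
    (mu : {measure set T -> \bar R}) (D : set T) (g h : T -> R)
    (S : nat -> T -> R) :
  measurable D -> measurable_fun D g -> measurable_fun D h ->
  (forall n, measurable_fun D (S n)) ->
  (fun n => \int[mu]_(x in D) ((g x - S n x) ^+ 2)%:E)%E @ \oo --> 0%E ->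
  (fun n => \int[mu]_(x in D) ((h x - S n x) ^+ 2)%:E)%E @ \oo --> 0%E ->
  {ae mu, forall x, D x -> h x = g x}.
Proof.
move=> mD mg mh mS gS hS.
have mgS n : measurable_fun D (fun x => ((g x - S n x) ^+ 2)%:E).
  by apply/measurable_EFinP; apply: measurable_funX; exact: measurable_funB.
have mhS n : measurable_fun D (fun x => ((h x - S n x) ^+ 2)%:E).
  by apply/measurable_EFinP; apply: measurable_funX; exact: measurable_funB.
have mf : measurable_fun D (fun x => ((h x - g x) ^+ 2)%:E).
  by apply/measurable_EFinP; apply: measurable_funX; exact: measurable_funB.
have le n : (\int[mu]_(x in D) ((h x - g x) ^+ 2)%:E <=
    2%:E * \int[mu]_(x in D) ((h x - S n x) ^+ 2)%:E +
    2%:E * \int[mu]_(x in D) ((g x - S n x) ^+ 2)%:E)%E.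
  rewrite -!ge0_integralZl//; [|by move=> *; rewrite lee_fin sqr_ge0..].
  rewrite -ge0_integralD//; first last.
  - exact: measurable_funeM.
  - by move=> x _; rewrite mule_ge0 ?lee_fin ?sqr_ge0.
  - exact: measurable_funeM.
  - by move=> x _; rewrite mule_ge0 ?lee_fin ?sqr_ge0.
  apply: le_lower_integral => x _; rewrite lee_fin ?sqr_ge0//.
  move: (h x) (g x) (S n x) => a b c.
  have := sqr_ge0 ((a - c) + (b - c)); nra.
have I0 : (\int[mu]_(x in D) ((h x - g x) ^+ 2)%:E = 0)%E.
  apply/eqP; rewrite eq_le integral_ge0 ?andbT; last first.
    by move=> x _; rewrite lee_fin sqr_ge0.
  have l : (fun n => 2%:E * \int[mu]_(x in D) ((h x - S n x) ^+ 2)%:E +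
    2%:E * \int[mu]_(x in D) ((g x - S n x) ^+ 2)%:E)%E @ \oo --> 0%E.
    have two (F : nat -> \bar R) : F @ \oo --> 0%E -> (2%:E * F n)%E @[n --> \oo] --> 0%E.
      by move=> F0; rewrite -(mule0 2%:E); apply: cvgeZl.
    by rewrite -(adde0 0%E); apply: cvgeD => //; exact: two.
  by rewrite -[leRHS](cvg_lim _ l)//; apply: lime_ge; [exact: (cvgP _ l)|exact: nearW].
have : ae_eq mu D (fun x => ((h x - g x) ^+ 2)%:E) (cst 0%E).
  apply/(ae_eq_integral_abs mu mD mf); rewrite -[RHS]I0.
  by apply: eq_integral => x _; rewrite gee0_abs// lee_fin sqr_ge0.
apply: filterS => x /[apply] /= -[] /eqP; rewrite sqrf_eq0 subr_eq0 => /eqP; exact.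
Qed.

Section low_frequencies.
Context {R : realType}.

Definition low_seq (n : nat) : seq (int * int) :=
  finmap.enum_fset (fset_set (@low_freq R n)).

Lemma finite_low_freq n : finite_set (@low_freq R n).
Proof.
pose r : seq int := [seq Posz i | i <- iota 0 n.+1] ++ [seq - Posz i | i <- iota 0 n.+1].
have rP (j : int) : (`|j| < n.+1)%N -> j \in r.
  move=> jn; rewrite mem_cat; apply/orP; have [j0|j0] := leP 0 j; [left|right];
    apply/mapP; exists `|j|%N; rewrite ?mem_iota//; lia.
apply: (@sub_finite_set _ _ [set` [seq (i, j) | i <- r, j <- r]]); last exact: finite_seq.
move=> k /= /andP[_ kn]; suff : k \in [seq (i, j) | i <- r, j <- r] by [].
apply/allpairsP; exists k; rewrite -surjective_pairing.
have : (`|k.1| ^ 2 + `|k.2| ^ 2 <= n ^ 2)%N.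
  rewrite -(ler_nat R) -freq_norm_natE natrX ler_pXn2r// ?nnegrE ?ler0n//.
  exact: freq_norm_ge0.
by move=> h; split=> //; apply: rP; nia.
Qed.

Lemma mem_low_seq n k : (k \in low_seq n) = (0 < @freq_norm R k <= n%:R).
Proof.
rewrite /low_seq in_fset_set; last exact: finite_low_freq.
by apply/idP/idP; rewrite inE.
Qed.

Lemma low_seq_uniq n : uniq (low_seq n).
Proof. exact: finmap.fset_uniq. Qed.

Lemma low_seq_neq0 n k : k \in low_seq n -> k != 0.
Proof. by rewrite mem_low_seq freq_norm_gt0 => /andP[]. Qed.

Lemma low_seq0 n : 0 \notin low_seq n.
Proof. by apply: contraTN (eqxx (0 : int * int)) => /low_seq_neq0. Qed.

Lemma low_seq_sub n m : (n <= m)%N -> {subset low_seq n <= low_seq m}.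
Proof.
move=> nm k; rewrite !mem_low_seq => /andP[-> kn] /=.
by apply: le_trans kn _; rewrite ler_nat.
Qed.

Lemma low_sumE n (F : int * int -> R) :
  \sum_(k \in @low_freq R n) F k = \sum_(k <- low_seq n) F k.
Proof. by rewrite fsbig_finite//; exact: finite_low_freq. Qed.

Lemma low_sum_diff n m (F : int * int -> R) : (n <= m)%N ->
  \sum_(k <- low_seq m) F k - \sum_(k <- low_seq n) F k =
  \sum_(k <- low_seq m | k \notin low_seq n) F k.
Proof.
move=> nm; rewrite (bigID (mem (low_seq n)))/= addrC -[RHS]addr0 -addrA; congr (_ + _).
apply/eqP; rewrite subr_eq0; apply/eqP; rewrite -big_filter; apply: perm_big.
apply: uniq_perm; rewrite ?filter_uniq ?low_seq_uniq// => k.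
by rewrite mem_filter; case: (boolP (k \in low_seq n)) => //= /(low_seq_sub nm).
Qed.

End low_frequencies.

Arguments low_seq : clear implicits.

Section partial_sums.
Context {R : realType}.
Variable L : R.
Hypothesis L_gt0 : 0 < L.
Local Notation mu2 := ((@lebesgue_measure R) \x (@lebesgue_measure R))%E.

Section absolute_convergence.
Variables (b : int * int -> R * R -> R) (beta : int * int -> R) (u : @coef R).
Variable B : R.
Hypothesis mb : forall k, measurable_fun (torus L) (b k).
Hypothesis b_le : forall k x, `|b k x| <= beta k.
Hypothesis u_sum : forall n, \sum_(k <- low_seq R n) beta k * `|u k| <= B.

Let S n x := \sum_(k <- low_seq R n) u k * b k x.
Let s n := \sum_(k <- low_seq R n) beta k * `|u k|.

Let beta_ge0 k : 0 <= beta k.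
Proof. by apply: le_trans (b_le k (0, 0)). Qed.

Let S_le n m x : (n <= m)%N -> `|S m x - S n x| <= s m - s n.
Proof.
move=> nm; rewrite /S /s !low_sum_diff//; apply: le_trans (ler_norm_sum _ _ _) _.
by apply: ler_sum => k _; rewrite normrM mulrC ler_wpM2r.
Qed.

Let s_nd : nondecreasing_seq s.
Proof.
move=> n m nm; rewrite -subr_ge0; apply: le_trans (S_le (0, 0) nm) => //.
Qed.

Let s_cvg : cvgn s.
Proof.
apply: nondecreasing_is_cvgn s_nd _; exists B => _ [n _ <-]; exact: u_sum.
Qed.

Let S_cvg x : cvgn (S ^~ x).
Proof.
have -> : S ^~ x = (fun n => (S n x + s n) - s n).
  by apply/funext => n; rewrite addrK.
apply: is_cvgB => //; apply: nondecreasing_is_cvgn.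
  move=> n m nm; have := S_le x nm; rewrite ler_norml => /andP[h _].
  by rewrite -subr_ge0; lra.
exists (2 * B) => _ [n _ <-].
have h : `|S n x| <= s n.
  apply: le_trans (ler_norm_sum _ _ _) _; apply: ler_sum => k _.
  by rewrite normrM mulrC ler_wpM2r.
have := u_sum n; rewrite -/(s n) => h'; have := ler_norm (S n x); lra.
Qed.

(** The pointwise limit of the partial sums.  Unlike the representative selected in
    L2sum, it is measurable in the parameters on which the coefficients depend
    measurably. *)
Definition abs_sum (x : R * R) : R := limn (S ^~ x).

Lemma abs_sum_cvg x :
  (fun n => \sum_(k <- low_seq R n) u k * b k x) @ \oo --> abs_sum x.
Proof. exact: S_cvg. Qed.

(** The tail of a dominated series is small uniformly in x, hence in L^2. *)
Lemma is_L2sum_abs_sum : is_L2sum L b u abs_sum.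
Proof.
have mS n : measurable_fun (torus L) (S n).
  by apply: measurable_sum => k; exact: measurable_funM.
have mg : measurable_fun (torus L) abs_sum.
  by apply: (@measurable_fun_cvg _ _ _ _ S) => // x _; exact: S_cvg.
split => //.
have gS n x : `|abs_sum x - S n x| <= limn s - s n.
  have h : (fun m => `|S m x - S n x|) @ \oo --> `|abs_sum x - S n x|.
    by apply: cvg_norm; apply: cvgB; [exact: S_cvg|exact: cvg_cst].
  have h' : (fun m => s m - s n) @ \oo --> limn s - s n.
    by apply: cvgB => //; exact: cvg_cst.
  apply: ler_cvg_to h h' _; near=> m; apply: S_le; near: m; exact: nbhs_infty_ge.
have up : (fun n => ((limn s - s n) ^+ 2 * L ^+ 2)%:E) @ \oo --> 0%E.
  apply: cvg_EFin; first exact: nearW.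
  rewrite (_ : 0 = 0 ^+ 2 * L ^+ 2); last by rewrite expr0n mul0r.
  apply: cvgM; last exact: cvg_cst.
  rewrite expr2; apply: cvgM.
  - by rewrite -(subrr (limn s)); apply: cvgB => //; exact: cvg_cst.
  - by rewrite -(subrr (limn s)); apply: cvgB => //; exact: cvg_cst.
apply: squeeze_cvge (cvg_cst _) up.
apply: nearW => n; apply/andP; split.
  by apply: integral_ge0 => x _; rewrite lee_fin sqr_ge0.
have -> : ((limn s - s n) ^+ 2 * L ^+ 2)%:E
    = (\int[mu2]_(x in torus L) ((limn s - s n) ^+ 2)%:E)%E.
  rewrite (integral_cst _ (measurable_torus L)) EFinM; congr (_ * _)%E.
  exact/esym/measure_torus.
apply: le_lower_integral => x _; first by rewrite lee_fin sqr_ge0.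
rewrite lee_fin low_sumE -real_normK ?num_real//.
have := gS n x; rewrite /S => h; rewrite ler_pXn2r// ?nnegrE//.
exact: le_trans h.
Unshelve. all: by end_near. Qed.

End absolute_convergence.

Lemma L2sum_ae (b : int * int -> R * R -> R) (u : @coef R) (g : R * R -> R) :
  (forall k, measurable_fun (torus L) (b k)) -> is_L2sum L b u g ->
  {ae mu2, forall x, torus L x -> L2sum L b u x = g x}.
Proof.
move=> mb gP; have : is_L2sum L b u (L2sum L b u).
  by rewrite /L2sum; case: xgetP => [h -> //|/(_ g)].
move: (L2sum L b u) => h [mh hS]; move: gP => [mg gS].
have mS n : measurable_fun (torus L) (fun x => \sum_(k <- low_seq R n) u k * b k x).
  by apply: measurable_sum => k; exact: measurable_funM.
refine (@ae_eq_L2_limit _ _ R mu2 (torus L) g h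
  (fun n x => \sum_(k <- low_seq R n) u k * b k x) (measurable_torus L) mg mh mS _ _).
- by move: gS; under eq_fun do under eq_integral do rewrite low_sumE.
- by move: hS; under eq_fun do under eq_integral do rewrite low_sumE.
Qed.

End partial_sums.

(** * Smoothing of the drift *)

Section power_singularity.
Context {R : realType}.
Local Notation mu := (@lebesgue_measure R).

Lemma measurable_powR_affine (D : set R) (t a : R) :
  measurable_fun D (fun s => (t - s) `^ a).
Proof.
apply: measurable_funTS; apply: (measurableT_comp (measurable_powR a)).
by apply: measurable_funB => //; exact: measurable_cst.
Qed.

(** The primitive -8 (t - s)^{1/8} is used on the intervals [0, t - t / (n + 2)], which
    exhaust [0, t[ and avoid the singularity. *)
Lemma integral_singularity (t : R) : 0 < t ->
  (\int[mu]_(s in `[0%R, t[) ((t - s) `^ (8^-1 - 1))%:E <= (8 * t `^ 8^-1)%:E)%E.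
Proof.
move=> t0.
pose F n := [set` `[0, t - t * n.+2%:R^-1] ] : set R.
have Fle n : 0 < t - t * n.+2%:R^-1.
  by rewrite subr_gt0 gtr_pMr// invf_lt1// ltr1n.
have FU : \bigcup_n F n = `[0, t[%classic.
  apply/seteqP; split => s /=.
    move=> [n _]; rewrite /F /= !in_itv/= => /andP[-> h] /=.
    by apply: le_lt_trans h _; rewrite gtrBl mulr_gt0// invr_gt0.
  rewrite in_itv/= => /andP[s0 st].
  have ts : 0 < t - s by rewrite subr_gt0.
  exists (Num.truncn (t / (t - s))) => //; rewrite /F/= in_itv/= s0/=.
  have := truncnS_gt (t / (t - s)); rewrite ltr_pdivrMr// => h.
  rewrite lerBrDl -lerBrDr ler_pdivrMr// mulrC; apply: ltW; apply: lt_trans h _.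
  by rewrite ltr_pM2r// ltr_nat.
have nd : nondecreasing_seq F.
  apply/nondecreasing_seqP => n; apply/subsetPset => s; rewrite /F/= !in_itv/= => /andP[-> h] /=.
  apply: le_trans h _; rewrite lerD2l lerN2 ler_wpM2l ?(ltW t0)//.
  by rewrite lef_pV2 ?posrE// ler_nat.
have step n : (\int[mu]_(s in F n) ((t - s) `^ (8^-1 - 1))%:E <= (8 * t `^ 8^-1)%:E)%E.
  have dG (x : R) : 0 <= x <= t - t * n.+2%:R^-1 ->
      is_derive x 1 (fun s : R => - 8 * (t - s) `^ 8^-1) ((t - x) `^ (8^-1 - 1)).
    move=> /andP[_ xt].
    have tx : 0 < t - x.
      by rewrite subr_gt0; apply: le_lt_trans xt _; rewrite gtrBl mulr_gt0// invr_gt0.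
    have h1 := is_derive1_powR 8^-1 tx.
    have h2 := is_derive_affine (-1) t x.
    have h2' : is_derive x 1 (fun s : R => t - s) (-1).
      by move: h2; congr (is_derive _ _ _ _); apply/funext => s; rewrite mulN1r addrC.
    have h3 := @is_derive1_comp R (fun y => y `^ 8^-1) (fun s => t - s) x _ _ h1 h2'.
    have h4 := is_deriveZ (-8) h3.
    apply: is_derive_eq h4 _.
    by rewrite /GRing.scale/=; field.
  rewrite (integral_FTC (Fle n) dG).
    rewrite subr0 lee_fin.
    have := powR_ge0 (t - (t - t * n.+2%:R^-1)) 8^-1; lra.
  move=> x /andP[_ xt].
  have tx : 0 < t - x.
    by rewrite subr_gt0; apply: le_lt_trans xt _; rewrite gtrBl mulr_gt0// invr_gt0.
  have h1 := is_derive1_powR (8^-1 - 1) tx.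
  apply: (@continuous_comp _ _ _ (fun s => t - s) (fun y => y `^ (8^-1 - 1))).
    by apply: cvgB; [exact: cvg_cst|exact: cvg_id].
  apply: differentiable_continuous; apply/derivable1_diffP; by case: h1.
have cv : (\int[mu]_(s in F n) ((t - s) `^ (8^-1 - 1))%:E)%E @[n --> \oo]
    --> (\int[mu]_(s in \bigcup_n F n) ((t - s) `^ (8^-1 - 1))%:E)%E.
  apply: ge0_nondecreasing_set_cvg_integral => //.
  - by move=> i; exact: measurable_itv.
  - by move=> i; apply/measurable_EFinP; exact: measurable_powR_affine.
  - by move=> i x _; rewrite lee_fin powR_ge0.
rewrite -FU -(cvg_lim _ cv)//; apply: lime_le; last exact: nearW.
exact: (cvgP _ cv).
Qed.

End power_singularity.

Section drift.
Context {R : realType}.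
Variable L : R.
Hypothesis L_gt0 : 0 < L.
Local Notation mu := (@lebesgue_measure R).

(** The square root of mu_k, which is the size of the gradient of e_k. *)
Definition nu (k : int * int) : R := 2 * pi * freq_norm k / L.

Lemma nuE k : nu k = 2 * pi / L * freq_norm k.
Proof. by rewrite /nu mulrAC. Qed.

Lemma mu_nu k : mu_ L k = nu k ^+ 2. Proof. by []. Qed.

Lemma nu_ge0 k : 0 <= nu k.
Proof.
by rewrite /nu divr_ge0 ?(ltW L_gt0)// !mulr_ge0 ?pi_ge0// freq_norm_ge0.
Qed.

Lemma nu_gt0 k : k != 0 -> 0 < nu k.
Proof.
by move=> k0; rewrite /nu divr_gt0// !mulr_gt0 ?pi_gt0// freq_norm_gt0.
Qed.

Definition sum_nu3 : R := 64 * (L / (2 * pi)) ^+ 3.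

Lemma sum_nu3_ge0 : 0 <= sum_nu3.
Proof.
by rewrite mulr_ge0// exprn_ge0// divr_ge0 ?(ltW L_gt0)// mulr_ge0// pi_ge0.
Qed.

Lemma sum_nu3_le n : \sum_(k <- low_seq R n) nu k ^- 3 <= sum_nu3.
Proof.
have -> : \sum_(k <- low_seq R n) nu k ^- 3 =
    (L / (2 * pi)) ^+ 3 * \sum_(k <- low_seq R n) (@freq_norm R k) ^- 3.
  rewrite mulr_sumr; apply: eq_bigr => k _.
  by rewrite nuE exprMn invfM -exprVn invf_div.
rewrite /sum_nu3 mulrC ler_wpM2r//.
  by rewrite exprn_ge0// divr_ge0 ?(ltW L_gt0)// mulr_ge0// pi_ge0.
by apply: sum_freq_norm3; [exact: low_seq_uniq|exact: low_seq0].
Qed.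

Lemma pow7_le_expR (y : R) : 0 <= y -> y ^+ 7 <= expR (2 * y ^+ 4).
Proof.
move=> y0; have := @expR_ge1Dxn R (2 * y ^+ 4) 1 (mulr_ge0 _ (exprn_ge0 4 y0)).
move=> /(_ (ler0n R 2)); apply: le_trans.
have -> : 1 + (2 * y ^+ 4) ^+ 2 / 2`!%:R = 1 + 2 * y ^+ 8.
  by rewrite (_ : 2`!%:R = 2) //; field.
have [y1|/ltW y1] := leP y 1.
  have h : y ^+ 7 <= 1 by rewrite exprn_ile1.
  by apply: le_trans h _; rewrite lerDl mulr_ge0// exprn_ge0.
apply: le_trans (_ : y ^+ 8 <= _); first by apply: ler_weXn2l.
have := exprn_ge0 8 y0; lra.
Qed.

Let young (p v e f : R) : 0 < p -> 0 < v ->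
  2 * (v * (e * `|f|)) <= p * v ^+ 4 * e ^+ 2 + p^-1 * (f ^+ 2 / v ^+ 2).
Proof.
move=> p0 v0; rewrite -subr_ge0 -[f ^+ 2]real_normK ?num_real//.
rewrite (_ : _ - _ = (p * (v ^+ 2 * e) - `|f| / v) ^+ 2 / p).
  by rewrite divr_ge0 ?sqr_ge0 ?ltW.
by field; rewrite (gt_eqF p0) (gt_eqF v0).
Qed.

(** With q = tau^{1/8}, Young's inequality gives
      2 nu e^{-tau nu^4} |F| <= q^7 nu^4 e^{-2 tau nu^4} + q^-7 F^2 / nu^2,
    and y^7 <= e^{2 y^4} at y = q^2 nu bounds the first term by q^-7 nu^-3.  The sum of
    nu_k^-3 converges in dimension two, and the price tau^{-7/8} is integrable at 0. *)
Lemma semigroup_sum_le (B tau : R) (F : @coef R) (n : nat) : 0 < tau ->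
  \sum_(k <- low_seq R n) F k ^+ 2 / mu_ L k <= B ->
  \sum_(k <- low_seq R n) nu k * `|semigroup L tau F k|
    <= (sum_nu3 + B) / 2 * tau `^ (8^-1 - 1).
Proof.
move=> tau0 FB; set q := tau `^ 8^-1.
have q0 : 0 < q by exact: powR_gt0.
have q8 : q ^+ 8 = tau.
  by rewrite -powR_mulrn ?ltW// /q -powRrM mulVf// powRr1// ltW.
have -> : tau `^ (8^-1 - 1) = q ^- 7.
  rewrite -powR_invn ?ltW// /q -powRrM; congr powR; lra.
apply: (@le_trans _ _ (\sum_(k <- low_seq R n)
    (2^-1 * q ^- 7) * (nu k ^- 3 + F k ^+ 2 / mu_ L k))); last first.
  rewrite -mulr_sumr big_split/=.
  have -> : (sum_nu3 + B) / 2 * q ^- 7 = 2^-1 * q ^- 7 * (sum_nu3 + B) by ring.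
  by rewrite ler_wpM2l ?lerD ?sum_nu3_le// mulr_ge0// invr_ge0 exprn_ge0// ltW.
rewrite big_seq [leRHS]big_seq; apply: ler_sum => k /low_seq_neq0 k0.
have v0 := nu_gt0 k0; set v := nu k in v0 *.
rewrite /semigroup normrM ger0_norm ?expR_ge0// mu_nu -/v.
set E := expR _; have E0 : 0 <= E by exact: expR_ge0.
have vE : q ^+ 7 * v ^+ 4 * E ^+ 2 <= q ^- 7 * v ^- 3.
  have y0 : 0 <= q ^+ 2 * v by rewrite mulr_ge0 ?exprn_ge0// ltW.
  have := pow7_le_expR y0.
  have -> : E ^+ 2 = (expR (2 * (q ^+ 2 * v) ^+ 4))^-1.
    rewrite /E -expRN -expRM_natl; congr expR; rewrite -q8; ring.
  move=> h; rewrite ler_pdivrMr ?expR_gt0//.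
  have c0 : 0 < q ^+ 7 * v ^+ 3 by rewrite mulr_gt0 ?exprn_gt0.
  rewrite -invfM (ler_pdivlMl _ _ c0).
  apply: le_trans h; rewrite le_eqVlt; apply/orP; left; apply/eqP; ring.
set f := F k.
have h2 := @young (q ^+ 7) v E f (exprn_gt0 7 q0) v0.
rewrite [leRHS](_ : _ = 2^-1 * (q ^- 7 * v ^- 3 + q ^- 7 * (f ^+ 2 / v ^+ 2))); last by ring.
by lra.
Qed.

(** K is chosen before F, so one constant serves all solutions at once.  The sum over
    k is moved inside the lower integral, where semigroup_sum_le applies at time t - s. *)
Lemma drift_sum_bounded (B T : R) : 0 <= B -> 0 < T ->
  exists2 K : R, 0 <= K & forall F : R -> @coef R,
    (forall s n, \sum_(k <- low_seq R n) F s k ^+ 2 / mu_ L k <= B) ->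
    forall t, 0 <= t <= T -> forall n,
    \sum_(k <- low_seq R n) nu k *
      `|\int[mu]_(s in `[0, t]) semigroup L (t - s) (F s) k| <= K.
Proof.
move=> B0 T0; have C0 : 0 <= (sum_nu3 + B) / 2.
  by rewrite divr_ge0// addr_ge0// sum_nu3_ge0.
exists ((sum_nu3 + B) / 2 * (8 * T `^ 8^-1)).
  by rewrite mulr_ge0// mulr_ge0// powR_ge0.
move=> F FB t /andP[t0 tT] n.
move: t0; rewrite le_eqVlt => /predU1P[<-|t0].
  rewrite big1 => [|k _]; first by rewrite mulr_ge0// mulr_ge0// powR_ge0.
  by rewrite set_itv1 Rintegral_set1 normr0 mulr0.
(* The bound on the integrand is void at s = t, a single point. *)
pose G (s : R) : \bar R := if s < t then
  ((sum_nu3 + B) / 2 * (t - s) `^ (8^-1 - 1))%:E else +oo%E.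
have mp (D : set R) :
    measurable_fun D (fun s => ((t - s) `^ (8^-1 - 1))%:E).
  by apply/measurable_EFinP; exact: measurable_powR_affine.
have mG : measurable_fun (`[0%R, t[%classic : set R) G.
  have : measurable_fun (`[0%R, t[%classic : set R)
      (fun s => ((sum_nu3 + B) / 2)%:E * ((t - s) `^ (8^-1 - 1))%:E)%E.
    exact: measurable_funeM.
  apply: eq_measurable_fun => s /set_mem.
  by rewrite /= in_itv/= /G => /andP[_ ->]; rewrite EFinM.
rewrite -lee_fin -sumEFin.
apply: (@le_trans _ _ (\sum_(k <- low_seq R n) \int[mu]_(s in `[0%R, t])
    ((nu k)%:E * (`|semigroup L (t - s) (F s) k|)%:E))%E).
  apply: lee_sum => k _; rewrite EFinM.
  apply: le_trans (lower_integralZ _ (nu_ge0 k) _); last by move=> s _; rewrite lee_fin.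
  by rewrite lee_wpmul2l ?lee_fin ?nu_ge0// normr_Rintegral_le.
apply: le_trans (sum_lower_integral _ _ _) _.
  by move=> k s _; rewrite mule_ge0// lee_fin nu_ge0.
apply: (@le_trans _ _ (\int[mu]_(s in `[0%R, t]) G s)%E).
  apply: le_lower_integral => s; rewrite /= in_itv/= => /andP[s0 st].
    by apply: sume_ge0 => k _; rewrite mule_ge0// lee_fin nu_ge0.
  rewrite /G; case: ltP => [{}st|_]; last exact: leey.
  under eq_bigr do rewrite -EFinM.
  rewrite sumEFin lee_fin; apply: semigroup_sum_le; first by rewrite subr_gt0.
  exact: FB.
rewrite -integral_itv_bndo_bndc//.
have -> : (\int[mu]_(s in `[0%R, t[) G s = ((sum_nu3 + B) / 2)%:E *
    \int[mu]_(s in `[0%R, t[) ((t - s) `^ (8^-1 - 1))%:E)%E.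
  rewrite -ge0_integralZl//; [|exact: mp|by move=> s _; rewrite lee_fin powR_ge0].
  by apply: eq_integral => s /set_mem; rewrite /= in_itv/= /G => /andP[_ ->]; rewrite EFinM.
rewrite [leRHS]EFinM; apply: lee_wpmul2l; first by rewrite lee_fin.
apply: le_trans (integral_singularity t0) _; rewrite lee_fin ler_wpM2l//.
by apply: ge0_ler_powR; rewrite ?nnegrE ?invr_ge0 ?(ltW t0) ?(ltW T0).
Qed.

End drift.

(** * Characteristic functions of Gaussian sums *)

Section equality_of_laws.
Context {R : realType}.

Lemma uniform_step_approx (h : R -> R) (M e : R) : 0 < e ->
  measurable_fun setT h -> (forall x, `|h x| <= M) ->
  exists (n : nat) (a : nat -> R) (B : nat -> set R),
    (forall i, measurable (B i)) /\
    forall x, `|h x - \sum_(i < n) a i * \1_(B i) x| <= e.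
Proof.
move=> e0 mh hM; pose y x := (h x + M) / e.
have y0 x : 0 <= y x.
  by rewrite divr_ge0 ?(ltW e0)//; have := hM x; rewrite ler_norml; lra.
exists (Num.truncn (2 * M / e)).+1, (fun i => i%:R * e - M),
  (fun i => y @^-1` [set` `[i%:R, i.+1%:R[ ]); split.
  move=> i; rewrite -[X in measurable X]setTI.
  suff : measurable_fun setT y by apply => //; exact: measurable_itv.
  by apply: measurable_funM => //; exact: measurable_funD.
move=> x; set j := Num.truncn (y x).
have jn : (j < (Num.truncn (2 * M / e)).+1)%N.
  rewrite ltnS; apply: le_truncn; rewrite ler_pM2r ?invr_gt0//.
  by have := hM x; rewrite ler_norml; lra.
have /andP[j1 j2] := truncn_itv (y0 x).
rewrite (bigD1 (Ordinal jn))//= big1 ?addr0; last first.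
  move=> i ij; rewrite indicE memNset ?mulr0//= in_itv/= => h1.
  move/eqP: ij; apply; apply: val_inj => /=; rewrite /j.
  by apply/esym/truncn_def.
rewrite indicE mem_set ?mulr1; last by rewrite /= in_itv/= j1.
have -> : h x = y x * e - M by rewrite /y divfK ?gt_eqF// addrK.
rewrite (_ : _ - _ = (y x - j%:R) * e); last by ring.
rewrite normrM (gtr0_norm e0) ler_piMl ?(ltW e0)// ger0_norm ?subr_ge0//.
by rewrite lerBlDl; apply: ltW; rewrite -/j natr1.
Qed.

Context d1 d2 (T1 : measurableType d1) (T2 : measurableType d2).
Variables (m1 : {measure set T1 -> \bar R}) (m2 : {measure set T2 -> \bar R}).
Variables (W1 : T1 -> R) (W2 : T2 -> R) (X1 : T1 -> R) (X2 : T2 -> R).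
Hypotheses (iW1 : m1.-integrable setT (EFin \o W1))
  (iW2 : m2.-integrable setT (EFin \o W2)).
Hypotheses (mX1 : measurable_fun setT X1) (mX2 : measurable_fun setT X2).
Hypothesis eqB : forall B : set R, measurable B ->
  \int[m1]_w (W1 w * \1_B (X1 w)) = \int[m2]_w (W2 w * \1_B (X2 w)).

Lemma weighted_integrable d (T : measurableType d) (m : {measure set T -> \bar R})
    (W X : T -> R) (h : R -> R) (M : R) :
  m.-integrable setT (EFin \o W) -> measurable_fun setT X ->
  measurable_fun setT h -> (forall x, `|h x| <= M) ->
  m.-integrable setT (EFin \o (fun w => W w * h (X w))).
Proof.
move=> iW mX mh hM.
have -> : (EFin \o (fun w => W w * h (X w))) = ((EFin \o W) \* (EFin \o (h \o X)))%E.
  by apply/funext => w; rewrite /= EFinM.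
apply: integrableMl => //; first exact: measurableT_comp.
exists M; split; first exact: num_real.
by move=> K MK w _ /=; apply: le_trans (hM _) (ltW MK).
Qed.

(** Bounded measurable functions are uniform limits of step functions.  The weights have
    two uses: a density on one side (normal_law_charfun), and a function of other random
    variables, independent of the one tested (charfun_sum_indep). *)
Lemma eq_expectation_of_law (h : R -> R) (M : R) :
  measurable_fun setT h -> (forall x, `|h x| <= M) ->
  \int[m1]_w (W1 w * h (X1 w)) = \int[m2]_w (W2 w * h (X2 w)).
Proof.
move=> mh hM.
pose c := \int[m1]_w `|W1 w| + \int[m2]_w `|W2 w|.
suff le e : 0 < e ->
    `|\int[m1]_w (W1 w * h (X1 w)) - \int[m2]_w (W2 w * h (X2 w))| <= e * c.
  have c0 : 0 <= c by rewrite addr_ge0//; apply: Rintegral_ge0.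
  apply/eqP; rewrite -subr_eq0 -normr_le0; apply/ler_addgt0Pr => e e0.
  rewrite add0r; apply: le_trans (le (e / (c + 1)) _) _.
    by rewrite divr_gt0// ltr_wpDl.
  by rewrite mulrAC ler_pdivrMr ?ltr_wpDl// ler_pM2l// lerDl.
move=> e0; have [n [a [B [mB happ]]]] := uniform_step_approx e0 mh hM.
pose h' x := \sum_(i < n) a i * \1_(B i) x.
have mh' : measurable_fun setT h'.
  by apply: measurable_sum => i; apply: measurable_funM => //; exact: measurable_indic.
have h'M x : `|h' x| <= M + e.
  have := happ x; have := hM x; rewrite -/(h' x) !ler_norml; lra.
have sumW d (T : measurableType d) (m : {measure set T -> \bar R}) (W X : T -> R) :
    m.-integrable setT (EFin \o W) -> measurable_fun setT X ->
    \int[m]_w (W w * h' (X w)) = \sum_(i < n) a i * \int[m]_w (W w * \1_(B i) (X w)).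
  move=> iW mX.
  have iB i : m.-integrable setT (EFin \o (fun w => W w * \1_(B i) (X w))).
    apply: (weighted_integrable (h := \1_(B i)) (M := 1) iW mX); first exact: measurable_indic.
    by move=> x; rewrite indicE; case: (_ \in _); rewrite ?normr1 ?normr0.
  transitivity (fine (\int[m]_w \sum_(i < n) ((a i)%:E * (W w * \1_(B i) (X w))%:E))%E).
    rewrite /Rintegral; congr fine; apply: eq_integral => w _.
    under eq_bigr do rewrite -EFinM.
    rewrite sumEFin; congr EFin; rewrite /h' mulr_sumr.
    by apply: eq_bigr => i _; ring.
  have iaB (i : 'I_n) : m.-integrable setT
      (fun w => (a i)%:E * (W w * \1_(B i) (X w))%:E)%E.
    exact: (integrableZl measurableT (a i) (iB i)).
  rewrite (integral_sum measurableT iaB).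
  under eq_bigr do rewrite (integralZl measurableT (iB _)).
  rewrite -sum_fine; last by move=> i _; rewrite fin_numM// integrable_fin_num.
  by apply: eq_bigr => i _; rewrite fineM// integrable_fin_num.
have dif d (T : measurableType d) (m : {measure set T -> \bar R}) (W X : T -> R) :
    m.-integrable setT (EFin \o W) -> measurable_fun setT X ->
    `|\int[m]_w (W w * h (X w)) - \int[m]_w (W w * h' (X w))| <= e * \int[m]_w `|W w|.
  move=> iW mX.
  have i1 : m.-integrable setT (EFin \o (fun w => W w * h (X w))).
    exact: (weighted_integrable (h := h) (M := M) iW mX).
  have i2 : m.-integrable setT (EFin \o (fun w => W w * h' (X w))).
    exact: (weighted_integrable (h := h') (M := M + e) iW mX).
  have i3 : m.-integrable setT (EFin \o (fun w => `|W w|)) by exact: integrable_norm.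
  rewrite -RintegralB// -RintegralZl//.
  have i12 := integrableB measurableT i1 i2.
  apply: le_trans (le_normr_Rintegral measurableT i12) _.
  apply: le_Rintegral => //.
  - exact: integrable_norm.
  - exact: (integrableZl measurableT e i3).
  - move=> w _ /=; rewrite -mulrBr normrM mulrC ler_wpM2r//; exact: happ.
have := dif _ _ _ _ _ iW1 mX1; have := dif _ _ _ _ _ iW2 mX2.
rewrite !sumW//; under [X in _ -> `|_ - X| <= _ -> _]eq_bigr do rewrite eqB//.
rewrite /c mulrDr distrC => h2 h1.
by apply: le_trans (ler_distD _ _ _) _; apply: lerD h1 h2.
Qed.

End equality_of_laws.

Lemma cvg_integral_exhaustion d (T : measurableType d) (R : realType)
    (mu : {measure set T -> \bar R}) (I : nat -> set T) (H : T -> R) :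
  (forall n, measurable (I n)) -> (forall x, \forall n \near \oo, I n x) ->
  mu.-integrable setT (EFin \o H) ->
  (\int[mu]_(x in I n) (H x)%:E)%E @[n --> \oo] --> (\int[mu]_x (H x)%:E)%E.
Proof.
move=> mI nI iH; have mH := measurable_int mu iH.
have -> : (fun n => \int[mu]_(x in I n) (H x)%:E)%E
    = (fun n => \int[mu]_x (((EFin \o H) \_ (I n)) x))%E.
  by apply/funext => n; rewrite integral_mkcond.
have ff : {ae mu, forall x, setT x ->
    ((EFin \o H) \_ (I n)) x @[n --> \oo] --> (EFin \o H) x}.
  apply: aeW => x _; apply: cvg_near_cst.
  by apply: filterS (nI x) => n Inx; rewrite patchE mem_set.
have fg : {ae mu, forall x n, setT x ->
    (`|((EFin \o H) \_ (I n)) x| <= (abse \o (EFin \o H)) x)%E}.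
  apply: aeW => x n _; rewrite patchE; case: ifP => _ //=.
  by rewrite normr0 lee_fin.
by have [_ _] := @dominated_convergence _ _ R mu setT measurableT _ _ _
  (fun n => (measurable_restrictT _ (mI n)).1 (measurable_funTS mH)) mH
  ff (integrable_abse iH) fg.
Qed.

Section normal_characteristic_function.
Context {R : realType}.
Local Notation mu := (@lebesgue_measure R).

Variable s : R.
Hypothesis s0 : 0 < s.
Local Notation g := (normal_pdf 0 s).

Let gE x : g x = normal_peak s * expR (- x ^+ 2 / (2 * s ^+ 2)).
Proof.
rewrite /normal_pdf (gt_eqF s0) /normal_fun subr0.
by rewrite -mulr_natl.
Qed.

Let is_derive_g (x : R) : is_derive x 1 g (- (x / s ^+ 2) * g x).
Proof.
have -> : g = (fun x => normal_peak s * expR (- x ^+ 2 / (2 * s ^+ 2))).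
  by apply/funext => y; rewrite gE.
apply: is_derive_eq.
rewrite /GRing.scale/=; field; exact: lt0r_neq0.
Qed.

Let integrable_g : mu.-integrable setT (EFin \o g).
Proof. exact: integrable_normal_pdf. Qed.

Let measurable_g : measurable_fun setT g.
Proof. exact: measurable_normal_pdf. Qed.

(** Up to a constant, |x| g (x) is below the Gaussian density of variance 2 s^2. *)
Let absx_le (x : R) : `|x * g x| <=
  (2 * s * normal_peak s / normal_peak (Num.sqrt 2 * s)) * normal_pdf 0 (Num.sqrt 2 * s) x.
Proof.
have s2 : Num.sqrt 2 * s != 0 by rewrite mulf_neq0 ?gt_eqF// sqrtr_gt0.
rewrite [in leRHS]/normal_pdf (negbTE s2) /normal_fun subr0.
rewrite mulrA divfK ?gt_eqF ?normal_peak_gt0// exprMn sqr_sqrtr//.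
rewrite gE normrM (ger0_norm (mulr_ge0 (normal_peak_ge0 _) (expR_ge0 _))).
rewrite [leLHS]mulrCA.
rewrite [leRHS](_ : _ = normal_peak s * (2 * s * expR (- x ^+ 2 / (2 * s ^+ 2 *+ 2)))); last by ring.
apply: ler_wpM2l; first exact: normal_peak_ge0.
set y := x / (2 * s); have -> : x = 2 * s * y by rewrite /y; field; exact: lt0r_neq0.
have s20 : 0 < 2 * s by rewrite mulr_gt0.
rewrite normrM (gtr0_norm s20) -[leLHS]mulrA; apply: ler_wpM2l; first exact: ltW.
have -> : - (2 * s * y) ^+ 2 / (2 * s ^+ 2) = - (y ^+ 2) + - (y ^+ 2).
  by field; exact: lt0r_neq0.
have -> : - (2 * s * y) ^+ 2 / (2 * s ^+ 2 *+ 2) = - (y ^+ 2).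
  by rewrite -mulr_natl; field; exact: lt0r_neq0.
rewrite expRD mulrA ler_piMl ?expR_ge0// expRN ler_pdivrMr ?expR_gt0// mul1r.
apply: le_trans (expR_ge1Dx _); rewrite -[y ^+ 2]real_normK ?num_real//.
by have := sqr_ge0 (`|y| - 2^-1); lra.
Qed.

Let integrable_xg : mu.-integrable setT (EFin \o (fun x => `|x * g x|)).
Proof.
set c := 2 * s * normal_peak s / normal_peak (Num.sqrt 2 * s).
apply: (le_integrable measurableT) (integrableZl measurableT c
  (integrable_normal_pdf 0 (Num.sqrt 2 * s))).
  apply/measurable_EFinP; apply: measurableT_comp => //.
  by apply: measurable_funM.
move=> x _; rewrite /= lee_fin normr_id.
by apply: le_trans (absx_le x) _; rewrite ler_norm.
Qed.

Let integrable_bM (h : R -> R) : measurable_fun setT h ->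
  (forall x, `|h x| <= 1) -> mu.-integrable setT (EFin \o (fun x => h x * g x)).
Proof.
move=> mh h1; apply: (le_integrable measurableT) integrable_g.
  by apply/measurable_EFinP; exact: measurable_funM.
by move=> x _; rewrite /= lee_fin normrM ler_piMl.
Qed.

Let integrable_xM (h : R -> R) : measurable_fun setT h ->
  (forall x, `|h x| <= 1) -> mu.-integrable setT (EFin \o (fun x => h x * (x * g x))).
Proof.
move=> mh h1; apply: (le_integrable measurableT) integrable_xg.
  by apply/measurable_EFinP; apply: measurable_funM => //; exact: measurable_funM.
by move=> x _; rewrite /= lee_fin normr_id normrM ler_piMl.
Qed.

Variable b : R.

Let lin_meas (F : R -> R) th : continuous F ->
  measurable_fun setT (fun x : R => F (th * x + b)).
Proof.
move=> cF; apply: (measurableT_comp (f := F)).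
  exact: continuous_measurable_fun.
by apply: measurable_funD => //; exact: measurable_funM.
Qed.

Let mcos th : measurable_fun setT (fun x : R => cos (th * x + b)).
Proof. by apply: lin_meas; exact: continuous_cos. Qed.
Let msin th : measurable_fun setT (fun x : R => sin (th * x + b)).
Proof. by apply: lin_meas; exact: continuous_sin. Qed.

Let phi th := \int[mu]_x (cos (th * x + b) * g x).

(** Integration by parts: the boundary terms vanish because g (n) = O (1 / n). *)
Let by_parts th :
  \int[mu]_x (sin (th * x + b) * (x * g x)) = s ^+ 2 * th * phi th.
Proof.
pose H x := th * (cos (th * x + b) * g x) - s ^- 2 * (sin (th * x + b) * (x * g x)).
have i1 := integrable_bM (mcos th) (fun x => cos_max _).
have i2 := integrable_xM (msin th) (fun x => sin_max _).
have iH : mu.-integrable setT (EFin \o H).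
  exact: (integrableB measurableT (integrableZl measurableT th i1)
    (integrableZl measurableT (s ^- 2) i2)).
pose G x := sin (th * x + b) * g x.
have dG (x : R) : is_derive x 1 G (H x).
  have h1 := is_derive_affine th b x; have h2 := is_derive_g x.
  apply: is_derive_eq; rewrite /GRing.scale/= /H; field; exact: lt0r_neq0.
have cG x : {for x, continuous H}.
  have cg : continuous g by apply: continuous_normal_pdf; rewrite gt_eqF.
  have cl : {for x, continuous (fun x : R => th * x + b)}.
    by apply: cvgD; [apply: cvgM; [exact: cvg_cst|exact: cvg_id]|exact: cvg_cst].
  apply: cvgB.
    apply: cvgM; first exact: cvg_cst.
    apply: cvgM; last exact: cg.
    apply: (@continuous_comp _ _ _ (fun x : R => th * x + b) cos) => //.
    exact: continuous_cos.
  apply: cvgM; first exact: cvg_cst.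
  apply: cvgM; last by apply: cvgM; [exact: cvg_id|exact: cg].
  apply: (@continuous_comp _ _ _ (fun x : R => th * x + b) sin) => //.
  exact: continuous_sin.
have cv : (\int[mu]_(x in [set` `[(- n.+1%:R)%R, (n.+1%:R)%R]]) (H x)%:E)%E @[n --> \oo]
    --> (\int[mu]_x (H x)%:E)%E.
  apply: cvg_integral_exhaustion iH => [n|x]; first exact: measurable_itv.
  near=> n; rewrite /= in_itv/= -ler_norml; apply: le_trans (_ : n%:R <= _).
    near: n; exact: nbhs_infty_ger.
  by rewrite ler_nat.
pose K := 2 * s * normal_peak s / normal_peak (Num.sqrt 2 * s) * normal_peak (Num.sqrt 2 * s).
have gK n : g n.+1%:R <= K * harmonic n.
  rewrite /= ler_pdivlMr// mulrC -[leLHS]ger0_norm ?mulr_ge0 ?normal_pdf_ge0//.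
  apply: le_trans (absx_le _) _; rewrite /K ler_wpM2l//.
    by rewrite divr_ge0 ?normal_peak_ge0// !mulr_ge0 ?normal_peak_ge0// ltW.
  by apply: normal_pdf_ub; rewrite mulf_neq0 ?gt_eqF// sqrtr_gt0.
have FTC n : (\int[mu]_(x in [set` `[(- n.+1%:R)%R, (n.+1%:R)%R]]) (H x)%:E
    = (G n.+1%:R - G (- n.+1%:R))%:E)%E.
  refine (integral_FTC (F := G) _ (fun x _ => dG x) (fun x _ => cG x)).
  by rewrite -subr_gt0 opprK addr_gt0.
have GK n : `|G n.+1%:R - G (- n.+1%:R)| <= 2 * K * harmonic n.
  apply: le_trans (ler_normB _ _) _; rewrite -mulrA mulr_natl mulr2n.
  have gN : g (- n.+1%:R) = g n.+1%:R by rewrite !gE sqrrN.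
  have h (c : R) : `|c| <= 1 -> `|c * g n.+1%:R| <= K * harmonic n.
    move=> c1; apply: le_trans (gK n); rewrite normrM (ger0_norm (normal_pdf_ge0 _ _ _)).
    by rewrite ler_piMl ?normal_pdf_ge0.
  by rewrite /G gN; apply: lerD; apply: h; exact: sin_max.
have h0 : 2 * K * harmonic n @[n --> \oo] --> 0.
  rewrite -[X in _ --> X](mulr0 (2 * K)); apply: cvgM; first exact: cvg_cst.
  exact: cvg_harmonic.
have cv0 : (\int[mu]_(x in [set` `[(- n.+1%:R)%R, (n.+1%:R)%R]]) (H x)%:E)%E @[n --> \oo] --> 0%E.
  under eq_fun do rewrite FTC.
  apply: cvg_EFin; first exact: nearW.
  apply: norm_cvg0; apply: squeeze_cvgr (cvg_cst 0) h0.
  by apply: nearW => n; rewrite normr_ge0/=; exact: GK.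
have H0 : (\int[mu]_x (H x)%:E = 0)%E by exact: (cvg_unique _ cv cv0).
have : \int[mu]_x H x = 0 by rewrite /Rintegral H0.
rewrite RintegralB//; [|exact: (integrableZl measurableT th i1)
  |exact: (integrableZl measurableT (s ^- 2) i2)].
rewrite !RintegralZl// => /eqP; rewrite subr_eq0 => /eqP h.
have s2 : s ^+ 2 != 0 by rewrite expf_neq0// gt_eqF.
by rewrite -mulrA h mulrA divff// mul1r.
Unshelve. all: by end_near. Qed.

Let is_derive_phi (th : R) : is_derive th 1 phi (- (s ^+ 2 * th) * phi th).
Proof.
pose f t x := cos (t * x + b) * g x.
have d1 (t x : R) : is_derive t 1 (f ^~ x) (- (sin (t * x + b) * (x * g x))).
  have h : is_derive t 1 (fun t : R => t * x + b) x.
    have := is_derive_affine x b t; congr (is_derive _ _ _ _).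
    by apply/funext => z; rewrite mulrC.
  by apply: is_derive_eq; rewrite /GRing.scale/=; ring.
have pE t x : partial1of2 f t x = - (sin (t * x + b) * (x * g x)).
  by rewrite partial1of2E; have := d1 t x => h; rewrite derive_val.
have Ith : `](th - 1), (th + 1)[%classic th.
  by rewrite /= in_itv/=; apply/andP; split; lra.
have intf t : `](th - 1), (th + 1)[%classic t -> mu.-integrable setT (EFin \o f t).
  by move=> _; apply: integrable_bM => // x; exact: cos_max.
have derf t x : `](th - 1), (th + 1)[%classic t -> setT x -> derivable (f ^~ x) t 1.
  by move=> _ _; have [] := d1 t x.
have G0 x : 0 <= `|x * g x| by [].
have Gub t x : `](th - 1), (th + 1)[%classic t -> setT x ->
    `|partial1of2 f t x| <= `|x * g x|.
  move=> _ _; rewrite pE normrN normrM ler_piMl//; exact: sin_max.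
have := derivable_under_integral measurableT Ith intf derf G0 integrable_xg Gub.
have := differentiation_under_integral measurableT Ith intf derf G0 integrable_xg Gub.
rewrite derive1E => dv dd; apply: DeriveDef => //.
rewrite [LHS]dv; under eq_Rintegral do rewrite pE -mulN1r.
rewrite RintegralZl//; last by apply: integrable_xM => // x; exact: sin_max.
by rewrite by_parts mulN1r mulNr.
Qed.

(** Differentiating under the integral and integrating by parts, the left-hand side
    solves y' = - s^2 th y in th.  The free phase b covers cosines and sines, so no
    complex numbers are involved. *)
Lemma normal_pdf_charfun th :
  \int[mu]_x (cos (th * x + b) * g x) = cos b * expR (- (th ^+ 2 * s ^+ 2) / 2).
Proof.
pose y t := phi t * expR (s ^+ 2 * t ^+ 2 / 2).
have dy (t : R) : is_derive t 1 y 0.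
  have h := is_derive_phi t.
  by apply: is_derive_eq; rewrite /GRing.scale/=; field.
have := is_derive_0_is_cst th 0 dy.
rewrite /y expr0n/= mulr0 mul0r expR0 mulr1.
have -> : phi 0 = cos b.
  rewrite /phi; under eq_Rintegral do rewrite mul0r add0r.
  rewrite (RintegralZl (cos b) measurableT integrable_g).
  by rewrite /Rintegral integral_normal_pdf mulr1.
move=> <-; rewrite -[RHS]mulrA -expRD (_ : _ + _ = 0) ?expR0 ?mulr1//; ring.
Qed.

End normal_characteristic_function.

Section gaussian_sums.
Context {R : realType} {d : measure_display} {Omega : measurableType d}.
Variable P : probability Omega R.
Local Notation mu := (@lebesgue_measure R).

Lemma bounded_integrableP (f : Omega -> R) (M : R) : measurable_fun setT f ->
  (forall w, `|f w| <= M) -> P.-integrable setT (EFin \o f).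
Proof.
move=> mf fM; have Pf : (P setT < +oo)%E by rewrite probability_setT ltry.
exact: (bounded_integrable measurableT Pf mf (fun w _ => fM w)).
Qed.

Lemma indic_integrableP (A : set Omega) : measurable A ->
  P.-integrable setT (EFin \o \1_A).
Proof.
move=> mA; apply: (@bounded_integrableP _ 1) => [|w]; first exact: measurable_indic.
by rewrite indicE; case: (_ \in _); rewrite ?normr1 ?normr0.
Qed.

Lemma Rintegral_indicP (A : set Omega) : measurable A ->
  \int[P]_w (\1_A w) = fine (P A).
Proof. by move=> mA; rewrite /Rintegral integral_indic// setIT. Qed.

Lemma normal_law_charfun (X : Omega -> R) (s : R) : 0 < s ->
  measurable_fun setT X ->
  (forall V, measurable V -> P (X @^-1` V) = normal_prob 0 s V) ->
  forall th b, \int[P]_w cos (th * X w + b)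
    = cos b * expR (- (th ^+ 2 * s ^+ 2) / 2).
Proof.
move=> s0 mX XV th b; rewrite -normal_pdf_charfun//.
have mh : measurable_fun setT (fun x : R => cos (th * x + b)).
  apply: measurable_cos_comp.
  by apply: measurable_funD => //; exact: measurable_funM.
have i1 : P.-integrable setT (EFin \o (cst 1)).
  by apply: (@bounded_integrableP _ 1) => // w; rewrite normr1.
have ig := integrable_normal_pdf 0 s.
have eqB (B : set R) : measurable B -> \int[P]_w (1 * \1_B (X w)) =
    \int[mu]_x (normal_pdf 0 s x * \1_B x).
  move=> mB.
  under eq_Rintegral do rewrite mul1r.
  rewrite (Rintegral_indicP (A := X @^-1` B)); last first.
    by rewrite -[X in measurable X]setTI; exact: mX.
  rewrite XV// /normal_prob [in LHS]integral_mkcond /Rintegral; congr fine.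
  apply: eq_integral => x _; rewrite patchE indicE; case: ifP => _.
    by rewrite mulr1.
  by rewrite mulr0.
have := @eq_expectation_of_law R _ _ _ _ P mu (cst 1) (normal_pdf 0 s) X id i1 ig mX
  (@measurable_id _ _ _) eqB (fun x => cos (th * x + b)) 1 mh (fun x => cos_max _).
under eq_Rintegral do rewrite mul1r.
by move=> ->; apply: eq_Rintegral => x _; rewrite mulrC.
Qed.

(** Independence is a statement on events, so one variable is split off at a time: the
    induction carries the indicator of an event on the variables not yet treated, and
    eq_expectation_of_law turns the event of the current variable into a trigonometric
    function of it.  The addition formula for the cosine needs the phase b to vary. *)
Lemma charfun_sum_indep (I : choiceType) (D : set I) (X : I -> Omega -> R)
    (v : I -> R) (th : I -> R) :
  (forall i, D i -> measurable_fun setT (X i)) ->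
  mutually_independent P D (fun i => sigma_var (X i)) ->
  (forall i, D i -> forall t b, \int[P]_w cos (t * X i w + b)
     = cos b * expR (- (t ^+ 2 * v i) / 2)) ->
  forall (s : seq I), uniq s -> (forall i, i \in s -> D i) ->
  forall b, \int[P]_w cos (\sum_(i <- s) th i * X i w + b)
    = cos b * expR (- (\sum_(i <- s) th i ^+ 2 * v i) / 2).
Proof.
move=> mX indep cX.
pose Int (s : seq I) (B : I -> set R) := \big[setI/setT]_(i <- s) (X i @^-1` B i).
have mInt s B : (forall i, i \in s -> D i) -> (forall i, measurable (B i)) ->
    measurable (Int s B).
  move=> sD mB; rewrite /Int big_seq; apply: bigsetI_measurable => i /sD Di.
  by rewrite -[X in measurable X]setTI; exact: mX.
have mS s b : (forall i, i \in s -> D i) ->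
    measurable_fun setT (fun w => cos (\sum_(i <- s) th i * X i w + b)).
  move=> sD; apply: measurable_cos_comp.
  apply: measurable_funD => //.
  rewrite (_ : (fun w => _) = (fun w => \sum_(i <- s) if i \in s then th i * X i w else 0)).
    apply: measurable_sum => i; case: (boolP (i \in s)) => // /sD Di.
    by apply: measurable_funM => //; exact: mX.
  by apply/funext => w; rewrite big_seq [RHS]big_seq; apply: eq_bigr => i ->.
suff claim s1 : forall s2 B b, uniq (s1 ++ s2) ->
    (forall i, i \in s1 ++ s2 -> D i) -> (forall i, measurable (B i)) ->
    \int[P]_w (cos (\sum_(i <- s1) th i * X i w + b) * \1_(Int s2 B) w)
    = (cos b * expR (- (\sum_(i <- s1) th i ^+ 2 * v i) / 2)) *
      \prod_(i <- s2) fine (P (X i @^-1` B i)).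
  move=> s us sD b; have := claim s [::] (fun=> setT) b.
  rewrite cats0 => /(_ us sD (fun=> measurableT)).
  rewrite big_nil mulr1 => <-; apply: eq_Rintegral => w _.
  by rewrite /Int big_nil indicE in_setT mulr1.
elim: s1 => [|x s1 IH] s2 B b us sD mB.
  under eq_Rintegral do rewrite big_nil add0r.
  have mI : measurable (Int s2 B) by exact: mInt.
  have iI : P.-integrable setT (EFin \o \1_(Int s2 B)) by exact: indic_integrableP.
  rewrite (RintegralZl _ measurableT iI) Rintegral_indicP//.
  rewrite big_nil oppr0 mul0r expR0 mulr1; congr (_ * _).
  rewrite /Int indep//; last first.
    by move=> i is2; split; [exact: sD|exists (B i)].
  have -> : (\prod_(i <- s2) P (X i @^-1` B i) =
      (\prod_(i <- s2) fine (P (X i @^-1` B i)))%:E)%E.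
    rewrite -prodEFin big_seq [RHS]big_seq; apply: eq_bigr => i is2.
    rewrite fineK// fin_num_measure// -[X in measurable X]setTI.
    by apply: mX => //; exact: sD.
  by [].
have xs : x \notin s1 ++ s2 by move: us => /= /andP[].
have us12 : uniq (s1 ++ s2) by move: us => /= /andP[].
have s12D i : i \in s1 ++ s2 -> D i by move=> h; apply: sD; rewrite /= inE h orbT.
have Dx : D x by apply: sD; rewrite /= mem_head.
have s1D i : i \in s1 -> D i by move=> h; apply: s12D; rewrite mem_cat h.
have s2D i : i \in s2 -> D i by move=> h; apply: s12D; rewrite mem_cat h orbT.
pose c b' := (cos b' * expR (- (\sum_(i <- s1) th i ^+ 2 * v i) / 2)) *
      \prod_(i <- s2) fine (P (X i @^-1` B i)).
pose W b' w := cos (\sum_(i <- s1) th i * X i w + b') * \1_(Int s2 B) w.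
have mW b' : measurable_fun setT (W b').
  apply: measurable_funM; [exact: mS|apply: measurable_indic; exact: mInt].
have W1 b' w : `|W b' w| <= 1.
  rewrite normrM mulr_ile1// ?cos_max// indicE.
  by case: (_ \in _); rewrite ?normr1 ?normr0.
have iW b' : P.-integrable setT (EFin \o W b') by exact: bounded_integrableP (W1 b').
have key (h : R -> R) b' : measurable_fun setT h -> (forall y, `|h y| <= 1) ->
    \int[P]_w (W b' w * h (X x w)) = c b' * \int[P]_w h (X x w).
  move=> mh h1.
  have ic : P.-integrable setT (EFin \o cst (c b')).
    by apply: (@bounded_integrableP _ `|c b'|).
  have eqB (A : set R) : measurable A -> \int[P]_w (W b' w * \1_A (X x w)) =
      \int[P]_w (c b' * \1_A (X x w)).
    (* The event A on the current variable joins the events of the untreated ones. *)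
    move=> mA; pose B' i := if i == x then A else B i.
    have Bx : B' x = A by rewrite /B' eqxx.
    have := IH (x :: s2) B' b'.
    have -> : \int[P]_w (c b' * \1_A (X x w)) = c b' * fine (P (X x @^-1` A)).
      have mXA : measurable (X x @^-1` A).
        by rewrite -[X in measurable X]setTI; exact: mX.
      have iXA : P.-integrable setT (EFin \o \1_(X x @^-1` A)) by exact: indic_integrableP.
      by rewrite -(Rintegral_indicP mXA) -(RintegralZl _ measurableT iXA).
    rewrite big_cons Bx.
    have -> : \prod_(j <- s2) fine (P (X j @^-1` B' j)) =
        \prod_(j <- s2) fine (P (X j @^-1` B j)).
      rewrite big_seq [RHS]big_seq; apply: eq_bigr => j js2.
      rewrite /B' ifN//; apply: contraNneq xs => <-.
      by rewrite mem_cat js2 orbT.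
    move=> IH'; apply: etrans (etrans (IH' _ _ _) _).
    - apply: eq_Rintegral => w _; rewrite /W -mulrA; congr (_ * _).
      have -> : Int (x :: s2) B' = X x @^-1` A `&` Int s2 B.
        rewrite /Int big_cons Bx; congr (_ `&` _).
        rewrite big_seq [RHS]big_seq; apply: eq_bigr => j js2.
        rewrite /B' ifN//; apply: contraNneq xs => <-.
        by rewrite mem_cat js2 orbT.
      by rewrite indicI/= mulrC.
    - by rewrite uniq_catC /= uniq_catC us12 andbT mem_cat orbC -mem_cat.
    - move=> j; rewrite mem_cat inE => jx; apply: sD.
      by rewrite /= inE mem_cat orbCA.
    - by move=> j; rewrite /B'; case: ifP.
    - by rewrite /c; ring.
  rewrite (@eq_expectation_of_law R _ _ _ _ P P (W b') (cst (c b')) (X x) (X x)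
    (iW b') ic (mX x Dx) (mX x Dx) eqB h 1 mh h1).
  rewrite RintegralZl//; apply: (@bounded_integrableP _ 1) => //.
  by apply: measurableT_comp => //; exact: mX.
have mt (F : R -> R) : continuous F -> measurable_fun setT (fun y : R => F (th x * y)).
  move=> cF; apply: (measurableT_comp (f := F)); first exact: continuous_measurable_fun.
  exact: measurable_funM.
have mc := mt _ (@continuous_cos R); have ms := mt _ (@continuous_sin R).
have mX' := mX x Dx.
have iWc : P.-integrable setT (EFin \o (fun w => W b w * cos (th x * X x w))).
  apply: (@bounded_integrableP _ 1) => [|w].
    apply: measurable_funM; first exact: mW.
    exact: (measurableT_comp mc).
  by rewrite normrM mulr_ile1// cos_max.
have iWs : P.-integrable setT
    (EFin \o (fun w => W (b - pi / 2) w * sin (th x * X x w))).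
  apply: (@bounded_integrableP _ 1) => [|w].
    apply: measurable_funM; first exact: mW.
    exact: (measurableT_comp ms).
  by rewrite normrM mulr_ile1// sin_max.
transitivity (\int[P]_w (W b w * cos (th x * X x w)
    - W (b - pi / 2) w * sin (th x * X x w))).
  apply: eq_Rintegral => w _; rewrite big_cons -addrA cosD /W.
  by rewrite addrA cosBpihalf; ring.
rewrite (RintegralB measurableT iWc iWs).
rewrite (key (fun y => cos (th x * y)) b mc (fun y => cos_max _)).
rewrite (key (fun y => sin (th x * y)) _ ms (fun y => sin_max _)).
have -> : \int[P]_w cos (th x * X x w) = expR (- (th x ^+ 2 * v x) / 2).
  have := cX x Dx (th x) 0; rewrite cos0 mul1r => <-.
  by apply: eq_Rintegral => w _; rewrite addr0.
have -> : \int[P]_w sin (th x * X x w) = 0.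
  have := cX x Dx (th x) (- (pi / 2)); rewrite cosN cos_pihalf mul0r => <-.
  by apply: eq_Rintegral => w _; rewrite cosBpihalf.
rewrite mulr0 subr0 /c big_cons.
set A := th x ^+ 2 * v x; set S := \sum_(j <- s1) _.
have -> : expR (- (A + S) / 2) = expR (- S / 2) * expR (- A / 2).
  by rewrite -expRD; congr expR; ring.
by ring.
Qed.

End gaussian_sums.

(** * Wiener integrals *)

Lemma cos_lipschitz (R : realType) (x y : R) : `|cos x - cos y| <= `|x - y|.
Proof.
wlog xy : x y / x < y.
  move=> H; have [xy|xy|->] := ltgtP x y; [exact: H| |by rewrite !subrr normr0].
  by rewrite distrC [leRHS]distrC; exact: H.
have [c _ cE] := @MVT R cos (fun z => - sin z) x y xy (fun z _ => is_derive_cos z)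
  (continuous_subspaceT (@continuous_cos R)).
rewrite distrC cE [leRHS]distrC normrM normrN ler_piMl//; exact: sin_max.
Qed.

Section wiener_integrals.
Context {R : realType} {d : measure_display} {Omega : measurableType d}.
Variable P : probability Omega R.
Local Notation mu := (@lebesgue_measure R).

Lemma Rintegral_cstP (r : R) : \int[P]_w r = r.
Proof.
have -> : \int[P]_w r = r * fine (P setT) by exact: Rintegral_cst.
by rewrite probability_setT mulr1.
Qed.

Definition step_variance (m : nat) (tau c : nat -> R) : R :=
  \sum_(i < m) c i ^+ 2 * (tau i.+1 - tau i).

Lemma measurable_step_integral (B : R -> {RV P >-> R}) m tau c :
  measurable_fun setT (step_integral (fun t => B t) m tau c).
Proof.
apply: measurable_sum => i; apply: measurable_funM => //.
by apply: measurable_funB; exact: measurable_funP.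
Qed.

(** The increments of the Brownian motion along a subdivision are independent centred
    Gaussian variables, whose variances add up to the step variance. *)
Lemma step_integral_charfun (B : R -> {RV P >-> R}) (t : R) m tau c :
  is_brownian B -> is_subdivision t m tau -> forall th b,
  \int[P]_w cos (th * step_integral (fun t => B t) m tau c w + b)
    = cos b * expR (- (th ^+ 2 * step_variance m tau c) / 2).
Proof.
move=> bB [tau0 taum taui] th b.
(* Freezing the subdivision after step m gives an infinite nondecreasing sequence. *)
pose tau' i := tau (minn i m).
have tau'nd i : tau' i <= tau' i.+1.
  rewrite /tau'; have [im|] := boolP (i < m)%N.
    by rewrite (minn_idPl im) (minn_idPl (ltnW im)); exact: taui.
  by rewrite -leqNgt => im; rewrite (minn_idPr im) (minn_idPr (leqW im)).
have tau'0 i : 0 <= tau' i.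
  elim: i => [|i IH]; last exact: le_trans IH (tau'nd i).
  by rewrite /tau' min0n tau0.
pose X i w := B (tau' i.+1) w - B (tau' i) w.
have mX i : measurable_fun setT (X i).
  by apply: measurable_funB; exact: measurable_funP.
have cX i : setT i -> forall t b, \int[P]_w cos (t * X i w + b)
    = cos b * expR (- (t ^+ 2 * (tau' i.+1 - tau' i)) / 2).
  move=> _ u b'; have := tau'nd i; rewrite le_eqVlt => /predU1P[e|lt].
    under eq_Rintegral do rewrite /X -e subrr mulr0 add0r.
    by rewrite e subrr mulr0 oppr0 mul0r expR0 mulr1 Rintegral_cstP.
  have s0 : 0 < Num.sqrt (tau' i.+1 - tau' i) by rewrite sqrtr_gt0 subr_gt0.
  rewrite (normal_law_charfun s0 (mX i)) ?sqr_sqrtr ?subr_ge0 ?ltW//.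
  by move=> V mV; exact: (brownian_gauss bB (tau'0 i) lt mV).
have := @charfun_sum_indep _ _ _ P nat setT X (fun i => tau' i.+1 - tau' i)
  (fun i => th * c i) (fun i _ => mX i)
  (brownian_indep bB (tau'0 0%N) tau'nd) cX (iota 0 m) (iota_uniq 0 m) (fun _ _ => I) b.
have sumE (F : nat -> R) : \sum_(i <- iota 0 m) F i = \sum_(i < m) F i.
  by rewrite -(big_mkord xpredT) /index_iota subn0.
have -> : \sum_(i <- iota 0 m) (th * c i) ^+ 2 * (tau' i.+1 - tau' i) =
    th ^+ 2 * step_variance m tau c.
  rewrite sumE /step_variance mulr_sumr; apply: eq_bigr => i _.
  by rewrite /tau' (minn_idPl (ltn_ord i)) (minn_idPl (ltnW (ltn_ord i))); ring.
move=> <-; apply: eq_Rintegral => w _; congr (cos (_ + _)).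
rewrite sumE /step_integral mulr_sumr; apply: eq_bigr => i _.
by rewrite /X /tau' (minn_idPl (ltn_ord i)) (minn_idPl (ltnW (ltn_ord i))); ring.
Qed.

(** This transfers the independence of the Brownian motions to their step integrals. *)
Lemma sigma_var_step_integral (B : R -> {RV P >-> R}) (t : R) m tau c :
  is_subdivision t m tau ->
  sigma_var (step_integral (fun t => B t) m tau c) `<=`
    sigma_process `[0, +oo[ (fun t => B t : Omega -> R).
Proof.
move=> [tau0 taum taui].
have tau_ge0 i : (i <= m)%N -> 0 <= tau i.
  elim: i => [|i IH] im; first by rewrite tau0.
  exact: le_trans (IH (ltnW im)) (taui i im).
move=> _ [V mV ->]; rewrite /sigma_process.
set G := [set A | _].
pose T := g_sigma_algebraType G.
have mB s : 0 <= s -> measurable_fun (setT : set T) (B s : T -> R).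
  move=> s0 _ Y mY; rewrite setTI; apply: sub_sigma_algebra.
  by exists s, Y; split => //; rewrite /= in_itv/= s0.
have : measurable_fun (setT : set T) (step_integral (fun t => B t) m tau c : T -> R).
  apply: measurable_sum => i; apply: measurable_funM => //.
  by apply: measurable_funB; apply: mB; apply: tau_ge0 => //; exact: ltnW.
by move=> /(_ measurableT V mV); rewrite setTI.
Qed.

Lemma measurable_step_fun m tau c (D : set R) : measurable_fun D (step_fun m tau c).
Proof.
by apply: measurable_sum => i; exact: measurable_funM.
Qed.

(** The intervals of a subdivision are disjoint, so the square of a step function is the
    step function with squared coefficients. *)
Lemma integral_step_fun_sqr_le (t : R) m tau c : is_subdivision t m tau ->
  (\int[mu]_(s in `[0%R, t]) ((step_fun m tau c s) ^+ 2)%:E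
     <= (step_variance m tau c)%:E)%E.
Proof.
move=> [tau0 taum taui].
have nd i j : (i <= j)%N -> (j <= m)%N -> tau i <= tau j.
  elim: j => [|j IH]; first by rewrite leqn0 => /eqP ->.
  rewrite leq_eqVlt => /predU1P[-> //|ij jm].
  by apply: le_trans (IH ij (ltnW jm)) (taui j jm).
have sqE s : step_fun m tau c s ^+ 2 =
    \sum_(i < m) c i ^+ 2 * \1_(`[tau i, tau i.+1[) s.
  rewrite /step_fun.
  have [[i si]|no] := pselect (exists i : 'I_m, s \in `[tau i, tau i.+1[).
    have other (j : 'I_m) : j != i -> \1_(`[tau j, tau j.+1[) s = 0 :> R.
      move=> ji; rewrite indicE memNset//= => sj.
      move: si sj; rewrite !in_itv/= => /andP[h1 h2] /andP[h3 h4].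
      have [ij|ij|ij] := ltngtP i j.
      - by have := nd _ _ ij (ltnW (ltn_ord j)); lra.
      - by have := nd _ _ ij (ltnW (ltn_ord i)); lra.
      - by move/eqP: ji; apply; apply: val_inj.
    rewrite (bigD1 i)//= big1 ?addr0; last by move=> j ji; rewrite other ?mulr0.
    rewrite [RHS](bigD1 i)//= [X in _ = _ + X]big1 ?addr0; last by move=> j ji; rewrite other ?mulr0.
    by rewrite indicE mem_set// !mulr1.
  rewrite !big1 ?expr0n//= => j _; rewrite indicE memNset ?mulr0//;
    by move=> sj; apply: no; exists j.
apply: (@le_trans _ _ (\int[mu]_s (\sum_(i < m) (c i ^+ 2)%:E *
    (\1_(`[tau i, tau i.+1[) s)%:E))%E).
  rewrite integral_mkcond; apply: le_lower_integral => s _.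
    by apply: erestrict_ge0 => x _; rewrite lee_fin sqr_ge0.
  have -> : (\sum_(i < m) (c i ^+ 2)%:E * (\1_(`[tau i, tau i.+1[) s)%:E)%E
      = (step_fun m tau c s ^+ 2)%:E.
    by rewrite sqE -sumEFin; apply: eq_bigr => i _; rewrite EFinM.
  by rewrite patchE; case: ifP => // _; rewrite lee_fin sqr_ge0.
rewrite ge0_integral_sum//; first last.
- by move=> i s _; rewrite mule_ge0// lee_fin ?sqr_ge0.
- move=> i; apply: measurable_funeM; apply/measurable_EFinP.
  by apply: measurable_indic; exact: measurable_itv.
rewrite /step_variance -sumEFin; apply: lee_sum => i _.
rewrite ge0_integralZl//; first last.
- by rewrite lee_fin sqr_ge0.
- by apply/measurable_EFinP; apply: measurable_indic; exact: measurable_itv.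
rewrite [leRHS]EFinM; apply: lee_wpmul2l; first by rewrite lee_fin sqr_ge0.
rewrite integral_indic//= setIT lebesgue_measure_itv/= lte_fin.
by case: ltP => [_|]; rewrite ?lee_fin ?subr_ge0 ?taui.
Qed.

End wiener_integrals.

Section wiener_charfun.
Context {R : realType} {d : measure_display} {Omega : measurableType d}.
Variable P : probability Omega R.
Local Notation mu := (@lebesgue_measure R).

(** A single step integral that is close in L^1 and loses at most e of the variance.  The
    distance in L^1 comes from |D| <= e / 2 + D^2 / (2 e), and the variance from
    y^2 <= (1 + a) x^2 + (1 + 1 / a) (y - x)^2. *)
Lemma wiener_approx (B : R -> {RV P >-> R}) (t : R) (phi : R -> R)
    (X : {RV P >-> R}) (q e : R) :
  measurable_fun setT phi -> is_wiener_integral B t phi X ->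
  0 <= q -> (q%:E <= \int[mu]_(s in `[0%R, t]) ((phi s) ^+ 2)%:E)%E -> 0 < e ->
  exists (m : nat) (tau c : nat -> R), [/\ is_subdivision t m tau,
    (\int[P]_w `|X w - step_integral (fun t => B t) m tau c w|%:E <= e%:E)%E &
    q - e <= step_variance m tau c].
Proof.
move=> mphi [m [tau [c [sub cphi cX]]]] q0 qphi e0.
(* These values make both error terms a (q + 1) and (1 + 1 / a) dl equal to e / 2. *)
pose a := e / (2 * (q + 1)).
have a0 : 0 < a by rewrite divr_gt0// mulr_gt0// ltr_wpDl.
pose dl := e / (2 * (1 + a^-1)).
have dl0 : 0 < dl by rewrite divr_gt0// mulr_gt0// addr_gt0// invr_gt0.
have near0 (u : nat -> \bar R) (r : R) : 0 < r -> u @ \oo --> 0%E ->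
    \forall n \near \oo, (u n <= r%:E)%E.
  move=> r0 /fine_cvgP[ufin /cvgrPdist_le /(_ r r0) ur].
  apply: filterS2 ufin ur => n unf; rewrite sub0r normrN => /(le_trans (ler_norm _)).
  by rewrite -lee_fin fineK.
have n1 := near0 _ _ dl0 cphi; have n2 := near0 _ (e ^+ 2) (exprn_gt0 2 e0) cX.
have [n [h1 h2]] : exists n,
    (\int[mu]_(s in `[0%R, t]) ((phi s - step_fun (m n) (tau n) (c n) s) ^+ 2)%:E <= dl%:E)%E
    /\ (\int[P]_w ((X w - step_integral (fun t => B t) (m n) (tau n) (c n) w) ^+ 2)%:E
      <= (e ^+ 2)%:E)%E.
  have [n _ h] := filterI n1 n2.
  by exists n; exact: (h n (leqnn n)).
exists (m n), (tau n), (c n); split => //.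
- have mD : measurable_fun setT (fun w => X w - step_integral (fun t => B t) (m n) (tau n) (c n) w).
    by apply: measurable_funB; [exact: measurable_funP|exact: measurable_step_integral].
  pose D w := X w - step_integral (fun t => B t) (m n) (tau n) (c n) w.
  apply: (@le_trans _ _ (\int[P]_w ((e / 2)%:E + (2 * e)^-1%:E * (D w ^+ 2)%:E))%E).
    apply: le_lower_integral => w _; first by rewrite lee_fin.
    rewrite -EFinM -EFinD lee_fin -[D w ^+ 2]real_normK ?num_real//.
    rewrite -/(D w); move: (`|D w|) => y.
    rewrite -subr_ge0 (_ : _ - _ = (e - y) ^+ 2 / (2 * e)).
      by rewrite divr_ge0 ?sqr_ge0// mulr_ge0// ltW.
    by field; exact: lt0r_neq0.
  rewrite ge0_integralD//; first last.
  - apply: measurable_funeM; apply/measurable_EFinP; exact: measurable_funX.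
  - by move=> w _; rewrite mule_ge0// lee_fin ?sqr_ge0// invr_ge0 mulr_ge0// ltW.
  - by move=> w _; rewrite lee_fin divr_ge0// ltW.
  rewrite ge0_integralZl//; first last.
  - by rewrite lee_fin invr_ge0 mulr_ge0// ltW.
  - by move=> w _; rewrite lee_fin sqr_ge0.
  - by apply/measurable_EFinP; exact: measurable_funX.
  have -> : (\int[P]_w (e / 2)%:E = (e / 2)%:E)%E.
    transitivity ((e / 2)%:E * P setT)%E; first exact: integral_cst.
    by rewrite probability_setT mule1.
  apply: (@le_trans _ _ ((e / 2)%:E + (2 * e)^-1%:E * (e ^+ 2)%:E)%E).
    by rewrite leeD2l// lee_wpmul2l// lee_fin invr_ge0 mulr_ge0// ltW.
  rewrite -EFinM -EFinD lee_fin (_ : _ + _ = e)//.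
  by field; exact: lt0r_neq0.
- set V := step_variance _ _ _.
  have hq : q <= (1 + a) * V + (1 + a^-1) * dl.
    rewrite -lee_fin; apply: le_trans qphi _.
    pose S s := step_fun (m n) (tau n) (c n) s.
    have mS : measurable_fun `[0, t]%classic S by exact: measurable_step_fun.
    have mE : measurable_fun `[0, t]%classic (fun s => phi s - S s).
      by apply: measurable_funB => //; exact: measurable_funTS.
    apply: (@le_trans _ _ (\int[mu]_(s in `[0%R, t])
      ((1 + a)%:E * (S s ^+ 2)%:E + (1 + a^-1)%:E * ((phi s - S s) ^+ 2)%:E))%E).
      apply: le_lower_integral => s _; first by rewrite lee_fin sqr_ge0.
      rewrite -!EFinM -EFinD lee_fin; move: (S s) (phi s) => x y.
      rewrite -subr_ge0 (_ : _ - _ = (a * x - (y - x)) ^+ 2 / a).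
        by rewrite divr_ge0 ?sqr_ge0 ?ltW.
      by field; exact: lt0r_neq0.
    rewrite ge0_integralD//; first last.
    - apply: measurable_funeM; apply/measurable_EFinP; exact: measurable_funX.
    - by move=> s _; rewrite mule_ge0// lee_fin ?sqr_ge0// addr_ge0// invr_ge0 ltW.
    - apply: measurable_funeM; apply/measurable_EFinP; exact: measurable_funX.
    - by move=> s _; rewrite mule_ge0// lee_fin ?sqr_ge0// addr_ge0// ltW.
    rewrite !ge0_integralZl//.
    + rewrite [leRHS]EFinD; apply: leeD; rewrite [leRHS]EFinM; apply: lee_wpmul2l => //.
      * by rewrite lee_fin addr_ge0// ltW.
      * exact: integral_step_fun_sqr_le (sub n).
      * by rewrite lee_fin addr_ge0// invr_ge0 ltW.
    + by apply/measurable_EFinP; exact: measurable_funX.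
    + by move=> s _; rewrite lee_fin sqr_ge0.
    + by rewrite lee_fin addr_ge0// invr_ge0 ltW.
    + by apply/measurable_EFinP; exact: measurable_funX.
    + by move=> s _; rewrite lee_fin sqr_ge0.
    + by rewrite lee_fin addr_ge0// ltW.
  have hd : (1 + a^-1) * dl = e / 2.
    rewrite /dl; field; rewrite (gt_eqF a0)/=.
    by rewrite gt_eqF// addr_gt0.
  have ha : a * (q + 1) = e / 2.
    by rewrite /a; field; rewrite gt_eqF// ltr_wpDl.
  rewrite leNgt; apply/negP => Vq.
  have : (1 + a) * V < (1 + a) * (q - e) by rewrite ltr_pM2l// addr_gt0.
  have : 0 < a * e by rewrite mulr_gt0.
  rewrite hd in hq; nra.
Qed.

Lemma measurable_cos_sum (I : eqType) (s : seq I) (th : I -> R)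
    (X : I -> Omega -> R) (b : R) : (forall i, measurable_fun setT (X i)) ->
  measurable_fun setT (fun w => cos (\sum_(i <- s) th i * X i w + b)).
Proof.
move=> mX; apply: measurable_cos_comp.
apply: measurable_funD => //; apply: measurable_sum => i.
by apply: measurable_funM => //; exact: mX.
Qed.

Lemma charfun_approx (I : eqType) (s : seq I) (th e : I -> R)
    (X Y : I -> Omega -> R) (b : R) :
  (forall i, measurable_fun setT (X i)) -> (forall i, measurable_fun setT (Y i)) ->
  (forall i, i \in s -> (\int[P]_w `|X i w - Y i w|%:E <= (e i)%:E)%E) ->
  `|\int[P]_w cos (\sum_(i <- s) th i * X i w + b)
    - \int[P]_w cos (\sum_(i <- s) th i * Y i w + b)|
  <= \sum_(i <- s) `|th i| * e i.
Proof.
move=> mX mY XY.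
have ic (V : I -> Omega -> R) : (forall i, measurable_fun setT (V i)) ->
    P.-integrable setT (EFin \o (fun w => cos (\sum_(i <- s) th i * V i w + b))).
  move=> mV; apply: (@bounded_integrableP _ _ _ _ _ 1) => [|w].
    exact: measurable_cos_sum.
  exact: cos_max.
rewrite -(RintegralB measurableT (ic X mX) (ic Y mY)) -lee_fin.
apply: le_trans (normr_Rintegral_le _ _ _) _.
apply: (@le_trans _ _ (\int[P]_w \sum_(i <- s) ((`|th i|%R)%:E * (`|X i w - Y i w|%R)%:E))%E).
  apply: le_lower_integral => w _; first by rewrite lee_fin.
  have -> : (\sum_(i <- s) (`|th i|%R)%:E * (`|X i w - Y i w|%R)%:E)%E =
      (\sum_(i <- s) `|th i| * `|X i w - Y i w|)%:E.
    by rewrite -sumEFin; apply: eq_bigr => i _; rewrite EFinM.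
  rewrite lee_fin; apply: le_trans (cos_lipschitz _ _) _.
  rewrite opprD addrACA subrr addr0 -sumrB.
  apply: le_trans (ler_norm_sum _ _ _) _; apply: ler_sum => i _.
  by rewrite -mulrBr normrM.
have mD i : measurable_fun setT (fun w => `|X i w - Y i w|%:E).
  apply/measurable_EFinP; apply: measurableT_comp => //.
  by apply: measurable_funB; [exact: mX|exact: mY].
rewrite ge0_integral_sum; first last.
- by move=> i w _; rewrite mule_ge0 ?lee_fin.
- by move=> i; exact: measurable_funeM.
- exact: measurableT.
rewrite -sumEFin big_seq [leRHS]big_seq; apply: lee_sum => i si.
rewrite ge0_integralZl// [leRHS]EFinM; apply: lee_wpmul2l => //.
exact: XY.
Qed.

(** Each Wiener integral is replaced by a step integral, for which independence and the
    Gaussian law are at hand; the error then tends to 0.  A lower bound q on the variances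
    is enough for an upper bound on the characteristic function. *)
Lemma charfun_wiener_le (beta : int * int -> R -> {RV P >-> R})
    (Z : int * int -> {RV P >-> R}) (phi : int * int -> R -> R) (t : R)
    (q : int * int -> R) (s : seq (int * int)) :
  iid_brownian beta -> uniq s -> (forall k, k \in s -> k != 0) ->
  (forall k, measurable_fun setT (phi k)) ->
  (forall k, k \in s -> is_wiener_integral (beta k) t (phi k) (Z k)) ->
  (forall k, 0 <= q k) ->
  (forall k, k \in s ->
    ((q k)%:E <= \int[mu]_(u in `[0%R, t]) ((phi k u) ^+ 2)%:E)%E) ->
  forall (th : int * int -> R) (b : R),
  `|\int[P]_w cos (\sum_(k <- s) th k * Z k w + b)|
    <= expR (- (\sum_(k <- s) th k ^+ 2 * q k) / 2).
Proof.
move=> [bm indep] us s0 mphi wZ q0 qphi th b.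
pose A := \sum_(k <- s) `|th k|; pose Q := \sum_(k <- s) th k ^+ 2.
set S := \sum_(k <- s) th k ^+ 2 * q k.
suff le e : 0 < e -> `|\int[P]_w cos (\sum_(k <- s) th k * Z k w + b)|
    <= A * e + expR (- S / 2 + Q * e / 2).
  have cv : (A * harmonic n + expR (- S / 2 + Q * harmonic n / 2)) @[n --> \oo]
      --> A * 0 + expR (- S / 2 + Q * 0 / 2).
    apply: cvgD.
      by apply: cvgM; [exact: cvg_cst|exact: cvg_harmonic].
    apply: (@cvg_comp _ _ _ (fun n => - S / 2 + Q * harmonic n / 2) expR _ _ _ _
      (@continuous_expR R _)).
    apply: cvgD; first exact: cvg_cst.
    apply: cvgM; last exact: cvg_cst.
    by apply: cvgM; [exact: cvg_cst|exact: cvg_harmonic].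
  rewrite mulr0 add0r mulr0 mul0r addr0 in cv.
  rewrite -(cvg_lim _ cv)//; apply: limr_ge; first exact: (cvgP _ cv).
  by apply: nearW => n; apply: le; exact: harmonic_gt0.
move=> e0.
have /choice[F FP] k : exists y : nat * (nat -> R) * (nat -> R), k \in s ->
    [/\ is_subdivision t y.1.1 y.1.2,
    (\int[P]_w `|Z k w - step_integral (fun t => beta k t) y.1.1 y.1.2 y.2 w|%:E <= e%:E)%E &
    q k - e <= step_variance y.1.1 y.1.2 y.2].
  have [ks|] := boolP (k \in s); last by exists (0%N, (fun=> 0), (fun=> 0)).
  have [m [tau [c h]]] := wiener_approx (mphi k) (wZ k ks) (q0 k) (qphi k ks) e0.
  by exists (m, tau, c).
pose Y k := step_integral (fun t => beta k t) (F k).1.1 (F k).1.2 (F k).2.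
have mY k : measurable_fun setT (Y k) by exact: measurable_step_integral.
have mZ k : measurable_fun setT (Z k) by exact: measurable_funP.
have h1 := @charfun_approx _ s th (fun=> e) Z Y b mZ mY (fun k ks => let: And3 _ h _ := FP k ks in h).
rewrite -mulr_suml -/A in h1.
have indY : mutually_independent P [set` s] (fun k => sigma_var (Y k)).
  move=> r B ur rB; apply: indep => // k kr; have [ks YB] := rB k kr.
  split; first exact: s0 ks.
  have [sub _ _] := FP k ks.
  exact: (sigma_var_step_integral sub) YB.
have cY k : [set` s] k -> forall u b', \int[P]_w cos (u * Y k w + b')
    = cos b' * expR (- (u ^+ 2 * step_variance (F k).1.1 (F k).1.2 (F k).2) / 2).
  move=> ks u b'; have [sub _ _] := FP k ks.
  exact: (@step_integral_charfun _ _ _ P _ _ _ _ _ (bm k (s0 k ks)) sub).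
have h2 := @charfun_sum_indep _ _ _ P _ [set` s] Y _ th (fun k _ => mY k) indY cY s us
  (fun k ks => ks) b.
rewrite h2 in h1.
set V := \sum_(i <- s) _ in h1.
have SV : S - Q * e <= V.
  rewrite /S /Q /V mulr_suml -sumrB big_seq [leRHS]big_seq; apply: ler_sum => k ks.
  by have [_ _ h] := FP k ks; rewrite -mulrBr ler_wpM2l// sqr_ge0.
have h3 : `|cos b * expR (- V / 2)| <= expR (- S / 2 + Q * e / 2).
  rewrite normrM (ger0_norm (expR_ge0 _)); apply: le_trans (_ : expR (- V / 2) <= _).
    by rewrite ler_piMl ?expR_ge0// cos_max.
  by rewrite ler_expR; lra.
apply: le_trans (_ : _ <= _) (lerD h1 h3).
by apply: le_trans (ler_normD _ _); rewrite subrK.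
Qed.

End wiener_charfun.

(** * Small balls from characteristic functions *)

Lemma Rintegral_sum d (T : measurableType d) (R : realType)
    (m : {measure set T -> \bar R}) (I : Type) (s : seq I) (f : I -> T -> R) :
  (forall i, m.-integrable setT (EFin \o f i)) ->
  \int[m]_x (\sum_(i <- s) f i x) = \sum_(i <- s) \int[m]_x f i x.
Proof.
move=> fi; elim: s => [|i s IH].
  rewrite big_nil; under eq_Rintegral do rewrite big_nil.
  by rewrite /Rintegral integral0.
rewrite big_cons -IH -RintegralD//.
- by apply: eq_Rintegral => x _; rewrite big_cons.
- apply: (eq_integrable measurableT (fun x => \sum_(j <- s) (f j x)%:E)%E).
    by move=> x _; rewrite /= sumEFin.
  by apply: integrable_sum => // j _; exact: fi.
Qed.

Section fejer_kernel.
Context {R : realType}.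

Lemma sum_gauss_weights_le (n : nat) :
  \sum_(0 <= i < n) expR (- (i%:R ^+ 2) / 2) <= 8 :> R.
Proof.
have -> : 8 = 2 * 4 :> R by lra.
apply: le_trans (_ : _ <= 2 * \sum_(0 <= i < n) weight i) _; last first.
  by rewrite ler_wpM2l// sum_weight.
rewrite mulr_sumr; apply: ler_sum => i _; rewrite /weight.
case: i => [|i].
  by rewrite expr0n/= oppr0 mul0r expR0 maxnE/= sqrtr1 expr1n invr1; lra.
rewrite (maxn_idPr (ltn0Sn i)); set x : R := i.+1%:R.
have x1 : 1 <= x by rewrite /x ler1n.
have x0 : 0 < x by exact: lt_le_trans x1.
rewrite mulNr expRN ler_pdivlMr ?exprn_gt0 ?sqrtr_gt0//.
rewrite ler_pdivrMl ?expR_gt0//.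
have h1 : Num.sqrt x ^+ 3 <= x ^+ 2.
  rewrite -[x in leRHS](sqr_sqrtr (ltW x0)) -exprM.
  apply: ler_weXn2l => //; rewrite -sqrtr1; exact: ler_wsqrtr.
have := expR_ge1Dx (x ^+ 2 / 2); lra.
Qed.

Lemma sum_gauss_weights2_le (n : nat) :
  \sum_(0 <= j < n) \sum_(0 <= l < n) expR (- ((j%:R - l%:R) ^+ 2) / 2)
    <= 16 * n%:R :> R.
Proof.
have one j : (j < n)%N ->
    \sum_(0 <= l < n) expR (- ((j%:R - l%:R) ^+ 2) / 2) <= 16 :> R.
  move=> jn; rewrite (big_cat_nat (leq0n j) (ltnW jn))/=.
  have -> : 16 = 8 + 8 :> R by lra.
  apply: lerD.
    rewrite big_nat_rev/= add0n.
    apply: le_trans (sum_gauss_weights_le j.+1); rewrite big_nat_recl//=.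
    apply: le_trans (_ : \sum_(0 <= i < j) expR (- (i.+1%:R ^+ 2) / 2) <= _); last first.
      by rewrite lerDr expR_ge0.
    rewrite big_nat [leRHS]big_nat; apply: ler_sum => i /andP[_ ij].
    by rewrite -natrB ?leq_subr// subKn.
  rewrite -{1}[j]add0n big_addn.
  apply: le_trans (sum_gauss_weights_le (n - j)); apply: ler_sum => i _.
  by rewrite natrD opprD addrCA subrr addr0 sqrrN.
rewrite big_nat; apply: le_trans (_ : \sum_(0 <= j < n) 16 <= _).
  rewrite [leRHS]big_nat; apply: ler_sum => j /andP[_ jn]; exact: one.
by rewrite sumr_const_nat subn0 mulr_natr.
Qed.

(** The squared modulus of the sum of e^{ijy} over j < n, that is n times the Fejer kernel. *)
Definition fejer (n : nat) (y : R) : R :=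
  \sum_(0 <= j < n) \sum_(0 <= l < n) cos ((j%:R - l%:R) * y).

Lemma fejerE n y : fejer n y =
  (\sum_(0 <= j < n) cos (j%:R * y)) ^+ 2 + (\sum_(0 <= j < n) sin (j%:R * y)) ^+ 2.
Proof.
rewrite !expr2 !mulr_suml -big_split/=; apply: eq_bigr => j _.
rewrite !mulr_sumr -big_split/=; apply: eq_bigr => l _.
by rewrite mulrBl cosB.
Qed.

Lemma fejer_ge0 n y : 0 <= fejer n y.
Proof. by rewrite fejerE addr_ge0// sqr_ge0. Qed.

Lemma fejer_ge n y : n%:R * `|y| <= 1 -> (n%:R * cos 1) ^+ 2 <= fejer n y.
Proof.
move=> ny; rewrite fejerE; apply: le_trans (_ : (\sum_(0 <= j < n) cos (j%:R * y)) ^+ 2 <= _); last first.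
  by rewrite lerDl sqr_ge0.
have c0 := @cos1_gt0 R.
have h : n%:R * cos 1 <= \sum_(0 <= j < n) cos (j%:R * y).
  rewrite mulrC mulr_natr -[n in leLHS]subn0 -sumr_const_nat.
  rewrite big_nat [leRHS]big_nat; apply: ler_sum => j /andP[_ jn].
  rewrite -[cos (_ * _)]cos_norm.
  have jy : `|j%:R * y| <= 1.
    rewrite normrM normr_nat; apply: le_trans ny.
    by rewrite ler_wpM2r// ler_nat ltnW.
  have pi1 : 1 <= pi :> R by apply: le_trans (@pi_ge2 R); rewrite ler1n.
  have h1 : (1 : R) \in `[0, pi] by rewrite in_itv/= ler01 pi1.
  have h2 : `|j%:R * y| \in `[0, pi] by rewrite in_itv/= normr_ge0 (le_trans jy pi1).
  have [->//|ne] := eqVneq `|j%:R * y| 1.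
  by apply: ltW; rewrite (ltr_cos h2 h1) lt_neqAle ne.
by rewrite ler_pXn2r// ?nnegrE ?mulr_ge0 ?(ltW c0)//; apply: le_trans h; rewrite mulr_ge0// ltW.
Qed.

Context {d : measure_display} {Omega : measurableType d}.
Variable P : probability Omega R.

(** With y_i = (Y_i + m_i) / s, the product of the kernels at y_1 and y_2 is nonnegative,
    and at least (n cos 1)^4 on the ball as soon as n rho <= s.  Its expectation is a sum
    of values of the characteristic function, which is at most (16 n)^2 by the Gaussian
    decay.  Markov's inequality with n close to s / rho concludes. *)
Lemma small_ball (Y1 Y2 : Omega -> R) (s rho m1 m2 : R) :
  measurable_fun setT Y1 -> measurable_fun setT Y2 -> 0 < s -> 0 < rho ->
  (forall a b c, `|\int[P]_w cos (a * Y1 w + b * Y2 w + c)|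
     <= expR (- (s ^+ 2 * (a ^+ 2 + b ^+ 2)) / 2)) ->
  (P [set w | (Y1 w + m1) ^+ 2 + (Y2 w + m2) ^+ 2 <= rho ^+ 2]%R
    <= (1024 / cos 1 ^+ 4 * (rho ^+ 2 / s ^+ 2))%:E)%E.
Proof.
move=> mY1 mY2 s0 rho0 cY; set B := [set w | _].
have c0 := @cos1_gt0 R; have c1 := @cos_le1 R 1.
(* This settles the case s < rho, where n would be 0. *)
have c4 : 1 <= 1024 / cos 1 ^+ 4 :> R.
  rewrite ler_pdivlMr ?exprn_gt0// mul1r; apply: le_trans (_ : 1 <= _); last by lra.
  by rewrite exprn_ile1// ltW.
have mB : measurable B.
  have : measurable_fun setT (fun w => (Y1 w + m1) ^+ 2 + (Y2 w + m2) ^+ 2).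
    by apply: measurable_funD; apply: measurable_funX; exact: measurable_funD.
  move=> /(_ measurableT `]-oo, rho ^+ 2]%classic (measurable_itv _)).
  by rewrite setTI; congr measurable; apply/seteqP; split => w; rewrite /B/= in_itv.
have [srho|rhos] := ltP s rho.
  apply: le_trans (probability_le1 P mB) _; rewrite lee_fin.
  have : 1 <= rho ^+ 2 / s ^+ 2.
    by rewrite ler_pdivlMr ?exprn_gt0// mul1r ler_pXn2r ?nnegrE ?ltW.
  nra.
pose n := Num.truncn (s / rho).
have sr0 : 0 <= s / rho by rewrite divr_ge0// ltW.
have /andP[n1 n2] := truncn_itv sr0; rewrite -/n in n1 n2.
have n0 : (0 < n)%N by rewrite /n truncn_gt0 ler_pdivlMr// mul1r.
have n0' : 0 < n%:R :> R by rewrite ltr0n.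
pose D (p : nat * nat) : R := (p.1%:R - p.2%:R) / s.
pose r := [seq (j, l) | j <- index_iota 0 n, l <- index_iota 0 n].
pose rr := [seq (p, p') | p <- r, p' <- r].
pose y1 w := Y1 w + m1; pose y2 w := Y2 w + m2.
pose K w := \sum_(q <- rr) cos (D q.1 * y1 w) * cos (D q.2 * y2 w).
have KE w : K w = fejer n (y1 w / s) * fejer n (y2 w / s).
  rewrite /K /rr big_allpairs/= /fejer.
  have fE y : \sum_(0 <= j < n) \sum_(0 <= l < n) cos ((j%:R - l%:R) * (y / s)) =
      \sum_(p <- r) cos (D p * y).
    rewrite /r big_allpairs/=; apply: eq_bigr => j _; apply: eq_bigr => l _.
    by rewrite /D/= mulrAC mulrA.
  by rewrite !fE mulr_suml; apply: eq_bigr => p _; rewrite mulr_sumr.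
pose e (p : nat * nat) : R := expR (- ((p.1%:R - p.2%:R) ^+ 2) / 2).
have mc (a b c : R) : measurable_fun setT (fun w => cos (a * Y1 w + b * Y2 w + c)).
  apply: measurable_cos_comp.
  by apply: measurable_funD => //; apply: measurable_funD; exact: measurable_funM.
have ic (a b c : R) : P.-integrable setT (EFin \o (fun w => cos (a * Y1 w + b * Y2 w + c))).
  by apply: (@bounded_integrableP _ _ _ _ _ 1) => // w; exact: cos_max.
have prodE q w : cos (D q.1 * y1 w) * cos (D q.2 * y2 w) =
   2^-1 * (cos (D q.1 * Y1 w + D q.2 * Y2 w + (D q.1 * m1 + D q.2 * m2)) +
   cos (D q.1 * Y1 w + (- D q.2) * Y2 w + (D q.1 * m1 - D q.2 * m2))).
  have -> : D q.1 * Y1 w + D q.2 * Y2 w + (D q.1 * m1 + D q.2 * m2) =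
    D q.1 * y1 w + D q.2 * y2 w by rewrite /y1 /y2; ring.
  have -> : D q.1 * Y1 w + (- D q.2) * Y2 w + (D q.1 * m1 - D q.2 * m2) =
    D q.1 * y1 w - D q.2 * y2 w by rewrite /y1 /y2; ring.
  by move: (D q.1 * y1 w) (D q.2 * y2 w) => a b; rewrite cosD cosB; field.
have iprod q : P.-integrable setT (EFin \o (fun w => cos (D q.1 * y1 w) * cos (D q.2 * y2 w))).
  apply: (@bounded_integrableP _ _ _ _ _ 1) => [|w]; last first.
    by rewrite normrM mulr_ile1// cos_max.
  by under eq_fun do rewrite prodE; apply: measurable_funM => //; exact: measurable_funD.
have Eprod q : \int[P]_w (cos (D q.1 * y1 w) * cos (D q.2 * y2 w)) <= e q.1 * e q.2.
  under eq_Rintegral do rewrite prodE.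
  rewrite (RintegralZl _ measurableT); last exact: (integrableD measurableT (ic _ _ _) (ic _ _ _)).
  rewrite (RintegralD measurableT (ic _ _ _) (ic _ _ _)).
  have ee : expR (- (s ^+ 2 * (D q.1 ^+ 2 + D q.2 ^+ 2)) / 2) = e q.1 * e q.2.
    rewrite /e -expRD; congr expR; rewrite /D; field; exact: lt0r_neq0.
  have h1 := cY (D q.1) (D q.2) (D q.1 * m1 + D q.2 * m2).
  have h2 := cY (D q.1) (- D q.2) (D q.1 * m1 - D q.2 * m2).
  rewrite sqrrN in h2; rewrite ee in h1 h2.
  have := le_trans (ler_norm _) h1; have := le_trans (ler_norm _) h2; lra.
have EK : \int[P]_w K w <= (16 * n%:R) ^+ 2.
  rewrite /K Rintegral_sum//; apply: le_trans (ler_sum _ (fun q _ => Eprod q)) _.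
  rewrite /rr big_allpairs/=.
  under eq_bigr do rewrite -mulr_sumr.
  rewrite -mulr_suml -expr2 ler_pXn2r ?nnegrE ?mulr_ge0//.
    by rewrite /r big_allpairs/=; exact: sum_gauss_weights2_le.
  by apply: sumr_ge0 => p _; exact: expR_ge0.
have iK : P.-integrable setT (EFin \o K).
  apply: (eq_integrable measurableT (fun w => \sum_(q <- rr)
     (cos (D q.1 * y1 w) * cos (D q.2 * y2 w))%:E)%E).
    by move=> w _; rewrite /= sumEFin.
  by apply: integrable_sum => // i _; exact: iprod.
have lowK w : (n%:R * cos 1) ^+ 4 * \1_B w <= K w.
  rewrite indicE; case: (boolP (w \in B)) => [/set_mem wB|_]; last first.
    by rewrite mulr0 KE mulr_ge0// fejer_ge0.
  rewrite mulr1 KE (exprM _ 2 2) expr2.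
  have small y : y ^+ 2 <= rho ^+ 2 -> n%:R * `|y / s| <= 1.
    move=> yr; have yr' : `|y| <= rho.
      by rewrite -(@ler_pXn2r _ 2) ?nnegrE ?(ltW rho0)// real_normK ?num_real.
    rewrite normrM normfV (gtr0_norm s0) mulrA ler_pdivrMr// mul1r.
    apply: le_trans (_ : n%:R * rho <= _); first by rewrite ler_wpM2l.
    by rewrite -ler_pdivlMr.
  have := sqr_ge0 (Y1 w + m1); have := sqr_ge0 (Y2 w + m2); move: wB; rewrite /B/= => h h2 h1.
  apply: ler_pM; rewrite ?sqr_ge0//; apply: fejer_ge; apply: small; rewrite /y1 /y2; lra.
have iB : P.-integrable setT (EFin \o \1_B) by exact: indic_integrableP.
have : (n%:R * cos 1) ^+ 4 * fine (P B) <= (16 * n%:R) ^+ 2.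
  apply: le_trans EK; rewrite -(Rintegral_indicP P mB) -(RintegralZl _ measurableT iB).
  apply: (le_Rintegral measurableT (integrableZl measurableT _ iB) iK) => w _; exact: lowK.
move=> h; rewrite -(fineK (fin_num_measure P _ mB)) lee_fin.
have nc : (0 : R) < (n%:R * cos 1) ^+ 4 by apply: exprn_gt0; exact: mulr_gt0.
rewrite -(ler_pM2l nc); apply: le_trans h _.
have -> : (n%:R * cos 1) ^+ 4 * (1024 / cos 1 ^+ 4 * (rho ^+ 2 / s ^+ 2)) =
   1024 * n%:R ^+ 2 * (n%:R * rho / s) ^+ 2.
  by field; rewrite !gt_eqF.
have -> : (16 * n%:R) ^+ 2 = 1024 * n%:R ^+ 2 * (2^-1) ^+ 2 :> R by field.
apply: ler_wpM2l; first by apply: mulr_ge0; [exact: ler0n|exact: sqr_ge0].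
have nr0 : 0 <= n%:R * rho / s by rewrite divr_ge0 ?(ltW s0)// mulr_ge0 ?(ltW rho0).
suff : 2^-1 <= n%:R * rho / s by move=> h2; apply: lerXn2r => //; rewrite nnegrE invr_ge0.
rewrite ler_pdivlMr//.
move: n2; rewrite ltr_pdivrMr// -natr1 => n2.
have : 1 <= n%:R :> R by rewrite ler1n.
nra.
Qed.

End fejer_kernel.

(** * Covariance of the gradient of the noise *)

(** Both signs of a frequency are taken together: this cancels the mixed products and
    completes squared sines to 1 with squared cosines. *)
Definition signed_range (m : nat) : seq int :=
  [seq Posz i | i <- iota m.+1 m] ++ [seq - Posz i | i <- iota m.+1 m].

Lemma signed_range_uniq m : uniq (signed_range m).
Proof.
rewrite cat_uniq !map_inj_uniq ?iota_uniq; last 2 first.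
- by move=> i j /oppr_inj [].
- by move=> i j [].
rewrite andbT /=; apply/hasPn => _ /mapP[i + ->]; rewrite mem_iota => /andP[mi _].
by apply/mapP => -[j _] ij; lia.
Qed.

Lemma mem_signed_range m j : j \in signed_range m -> (m < `|j|%N <= m + m)%N.
Proof.
rewrite mem_cat => /orP[] /mapP[i]; rewrite mem_iota => /andP[h1 h2] ->; lia.
Qed.

Section covariance.
Context {R : realType}.
Variable L : R.
Hypothesis L_gt0 : 0 < L.
Implicit Types (x : R * R) (k : int * int).

Lemma sum_signed_range m (F : int -> R) :
  \sum_(j <- signed_range m) F j = \sum_(i <- iota m.+1 m) (F (Posz i) + F (- Posz i)).
Proof. by rewrite big_cat/= !big_map big_split. Qed.

Lemma sum_iota_const m (c : R) : \sum_(i <- iota m.+1 m) c = m%:R * c.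
Proof. by rewrite big_const_seq count_predT size_iota iter_addr_0 mulr_natl. Qed.

Lemma omega_sqrD (i : nat) z : (0 < i)%N ->
  omega L (Posz i) z ^+ 2 + omega L (- Posz i) z ^+ 2 = 2 / L.
Proof.
move=> i0; have h : 0 <= 2 / L by rewrite divr_ge0// ltW.
rewrite /omega ifT; last by lia.
rewrite ifF; last by apply/negbTE; lia.
rewrite ifF; last by apply/negbTE; lia.
have -> : 2 * pi * (- Posz i)%:~R * z / L = - (2 * pi * (Posz i)%:~R * z / L).
  by rewrite rmorphN/= mulrN !mulNr.
by rewrite cosN !exprMn sqr_sqrtr// -mulrDr addrC cos2Dsin2 mulr1.
Qed.

Lemma lamN j : lam L (- j) = - lam L j.
Proof. by rewrite /lam rmorphN/= mulrN mulNr. Qed.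

(** Over the two signs of each frequency, squares add up to constants (omega_sqrD) and
    the products of the two partial derivatives cancel.  The sum is thus isotropic, and
    the same at all points x. *)
Lemma sum_grad_sqr_ge (m : nat) (a b : R) x :
  (4 / L ^+ 2) * (2 * pi / L) ^+ 2 * m%:R ^+ 4 * (a ^+ 2 + b ^+ 2) <=
  \sum_(k <- [seq (j, l) | j <- signed_range m, l <- signed_range m])
    (a * d1e_ L k x + b * d2e_ L k x) ^+ 2.
Proof.
have iota_gt i : i \in iota m.+1 m -> (m < i)%N by rewrite mem_iota => /andP[].
pose A z j := lam L j ^+ 2 * omega L (- j) z ^+ 2.
pose Bq z j := omega L j z ^+ 2.
pose C z j := lam L j * omega L (- j) z * omega L j z.
have sumB z : \sum_(j <- signed_range m) Bq z j = m%:R * (2 / L).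
  rewrite sum_signed_range -sum_iota_const big_seq [RHS]big_seq.
  by apply: eq_bigr => i /iota_gt mi; rewrite /Bq omega_sqrD//; lia.
have sumC z : \sum_(j <- signed_range m) C z j = 0.
  rewrite sum_signed_range big1 // => i _.
  by rewrite /C lamN opprK; ring.
have sumA z : m%:R * (2 / L) * ((2 * pi / L) ^+ 2 * m%:R ^+ 2) <= \sum_(j <- signed_range m) A z j.
  have -> : m%:R * (2 / L) * ((2 * pi / L) ^+ 2 * m%:R ^+ 2) =
      \sum_(i <- iota m.+1 m) ((2 / L) * ((2 * pi / L) ^+ 2 * m%:R ^+ 2)).
    by rewrite sum_iota_const; ring.
  rewrite sum_signed_range big_seq [leRHS]big_seq.
  apply: ler_sum => i /iota_gt mi; rewrite /A lamN sqrrN opprK -mulrDr addrC omega_sqrD//; last by lia.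
  rewrite mulrC ler_wpM2r ?divr_ge0 ?(ltW L_gt0)//.
  rewrite /lam -exprMn lerXn2r ?nnegrE//.
  - by rewrite mulr_ge0// divr_ge0 ?(ltW L_gt0)// mulr_ge0// pi_ge0.
  - by rewrite divr_ge0 ?(ltW L_gt0)// !mulr_ge0// ?pi_ge0.
  - rewrite mulrAC ler_wpM2r ?invr_ge0 ?(ltW L_gt0)//.
    by rewrite ler_wpM2l ?mulr_ge0 ?pi_ge0// -pmulrn ler_nat ltnW.
rewrite big_allpairs/=.
have -> : \sum_(j <- signed_range m) \sum_(l <- signed_range m)
    (a * d1e_ L (j, l) x + b * d2e_ L (j, l) x) ^+ 2 =
  a ^+ 2 * ((\sum_(j <- signed_range m) A x.1 j) * (\sum_(l <- signed_range m) Bq x.2 l)) +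
  b ^+ 2 * ((\sum_(j <- signed_range m) Bq x.1 j) * (\sum_(l <- signed_range m) A x.2 l)) +
  2 * a * b * ((\sum_(j <- signed_range m) C x.1 j) * (\sum_(l <- signed_range m) C x.2 l)).
  rewrite !mulr_suml !mulr_sumr -!big_split/=; apply: eq_bigr => j _.
  rewrite !mulr_sumr -!big_split/=; apply: eq_bigr => l _.
  by rewrite d1eE// d2eE// /e_ /A /Bq /C/=; ring.
rewrite !sumB !sumC mulr0 mulr0 addr0.
have h1 := sumA x.1; have h2 := sumA x.2.
have mL : 0 <= m%:R * (2 / L) by rewrite mulr_ge0// divr_ge0// ltW.
have -> : 4 / L ^+ 2 * (2 * pi / L) ^+ 2 * m%:R ^+ 4 * (a ^+ 2 + b ^+ 2) =
  a ^+ 2 * ((m%:R * (2 / L) * ((2 * pi / L) ^+ 2 * m%:R ^+ 2)) * (m%:R * (2 / L))) +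
  b ^+ 2 * ((m%:R * (2 / L)) * (m%:R * (2 / L) * ((2 * pi / L) ^+ 2 * m%:R ^+ 2))).
  by field; exact: lt0r_neq0.
apply: lerD; apply: ler_wpM2l; rewrite ?sqr_ge0//; first by apply: ler_wpM2r.
exact: ler_wpM2l.
Qed.

Lemma nu_box m k : k \in [seq (j, l) | j <- signed_range m, l <- signed_range m] ->
  2 * pi / L * m%:R <= nu L k <= 2 * pi / L * (4 * m)%:R.
Proof.
move=> /allpairsP[[j l] /= [/mem_signed_range/andP[j1 j2] /mem_signed_range/andP[l1 l2] ->]].
have c0 : 0 < 2 * pi / L by rewrite divr_gt0// mulr_gt0// pi_gt0.
rewrite nuE !ler_pM2l//.
rewrite -(@ler_pXn2r _ 2)// ?nnegrE ?freq_norm_ge0//.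
rewrite -(@ler_pXn2r _ 2 isT (freq_norm _)) ?nnegrE ?freq_norm_ge0//.
rewrite freq_norm_natE/= -!natrX !ler_nat; apply/andP; split; nia.
Qed.

(** On the last interval of length 1 / v the integrand is at least e^-2. *)
Lemma semigroup_sqr_integral_ge (t v : R) : 0 < v -> 1 <= t * v ->
  ((expR (-2) / v)%:E <=
   \int[@lebesgue_measure R]_(s in `[0%R, t]) ((expR (- (t - s) * v) ^+ 2)%:E))%E.
Proof.
move=> v0 tv; have tv' : v^-1 <= t by rewrite -[v^-1]mul1r ler_pdivrMr.
have t0 : 0 < t by apply: lt_le_trans tv'; rewrite invr_gt0.
pose I : set R := [set` `[t - v^-1, t]].
have -> : (expR (-2) / v)%:E = ((expR (-2))%:E *
    \int[@lebesgue_measure R]_(s in `[0%R, t]) (\1_I s)%:E)%E.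
  rewrite integral_indic; [|exact: measurable_itv|exact: measurable_itv].
  have It : I `&` `[0, t]%classic = I.
    apply/seteqP; split => s; rewrite /I/= !in_itv/=; first by case.
    by move=> /andP[h1 h2]; rewrite h1 h2 andbT; split => //; lra.
  have mI : @lebesgue_measure R I = (v^-1)%:E.
    rewrite /I lebesgue_measure_itv/= lte_fin ifT; last by rewrite gtrBl invr_gt0.
    by rewrite -EFinB; congr EFin; lra.
  by rewrite It [LHS]EFinM; congr (_ * _)%E; exact: (esym mI).
refine (le_trans (lower_integralZ _ (expR_ge0 _) _) _).
  by move=> s _; rewrite lee_fin indicE.
apply: le_lower_integral => s; rewrite /= in_itv/= => /andP[s0 st].
  by rewrite -EFinM lee_fin mulr_ge0 ?expR_ge0// indicE.
rewrite -EFinM lee_fin indicE; case: (boolP (s \in I)) => [/set_mem|_]; last first.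
  by rewrite mulr0 sqr_ge0.
rewrite /I/= in_itv/= => /andP[h1 _]; rewrite mulr1 -expRM_natl ler_expR.
have : (t - s) * v <= 1.
  by rewrite -ler_pdivlMr// mul1r; lra.
by lra.
Qed.

End covariance.

Section noise.
Context {R : realType}.
Variables (L alpha sigma : R).
Hypotheses (L_gt0 : 0 < L) (alpha01 : 0 < alpha < 1) (sigma_gt0 : 0 < sigma).

(** The factor e^-2 stems from semigroup_sqr_integral_ge, and 8 from the inner radius
    N / 8 <= N %/ 4 of the box of frequencies. *)
Definition noise_const : R := sigma ^+ 2 * expR (-2) *
  ((2 * pi / L) ^+ 2) `^ (alpha - 2) * (4 / L ^+ 2 * (2 * pi / L) ^+ 2) / 8 ^+ 4.

Let c_gt0 : 0 < 2 * pi / L.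
Proof. by rewrite divr_gt0// mulr_gt0// pi_gt0. Qed.

Lemma noise_const_gt0 : 0 < noise_const.
Proof.
rewrite /noise_const divr_gt0 ?exprn_gt0//.
apply: mulr_gt0; last by rewrite mulr_gt0 ?exprn_gt0// divr_gt0 ?exprn_gt0.
by rewrite !mulr_gt0 ?expR_gt0 ?exprn_gt0// powR_gt0// exprn_gt0.
Qed.

Definition noise_amp (k : int * int) : R := sigma * mu_ L k `^ (alpha / 2).

Definition box (N : nat) : seq (int * int) :=
  [seq (j, l) | j <- signed_range (N %/ 4), l <- signed_range (N %/ 4)].

Lemma box_uniq N : uniq (box N).
Proof.
have u := signed_range_uniq (N %/ 4).
by apply: allpairs_uniq => // [[a b] [a' b']] _ _ [-> ->].
Qed.

Lemma box_nu N k : (4 <= N)%N -> k \in box N ->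
  [/\ 0 < nu L k, 2 * pi / L * (N%:R / 8) <= nu L k & nu L k <= 2 * pi / L * N%:R].
Proof.
move=> N4 /(nu_box L_gt0)/andP[h1 h2].
have mN : N%:R / 8 <= (N %/ 4)%:R :> R.
  by rewrite ler_pdivrMr// -natrM ler_nat; lia.
have h : 2 * pi / L * (N%:R / 8) <= nu L k.
  by apply: le_trans h1; rewrite ler_pM2l.
split => //.
  apply: lt_le_trans h; rewrite mulr_gt0// divr_gt0// ltr0n; lia.
by apply: le_trans h2 _; rewrite ler_pM2l// ler_nat; lia.
Qed.

Lemma box_low N k : (4 <= N)%N -> k \in box N -> k \in low_seq R N.
Proof.
move=> N4 kb; have [h0 _ h] := box_nu N4 kb.
rewrite mem_low_seq; apply/andP; split.
  by move: h0; rewrite nuE pmulr_rgt0.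
by move: h; rewrite nuE ler_pM2l.
Qed.

(** A lower bound, after small_time, for the variance of Z_k (t), cut to 0 outside the box. *)
Definition box_var (N : nat) (k : int * int) : R :=
  if k \in box N then expR (-2) / mu_ L k ^+ 2 else 0.

Lemma box_var_ge0 N k : 0 <= box_var N k.
Proof.
rewrite /box_var; case: ifP => // _.
by rewrite divr_ge0 ?expR_ge0// exprn_ge0// mu_nu sqr_ge0.
Qed.

(** A box around the frequencies of size N has about N^2 elements.  For each of them the
    variance of Z_k is of order N^-4, the squared amplitude mu_k^alpha of order
    N^{2 alpha}, and the squared gradient of e_k of order N^2. *)
Lemma noise_variance_ge (N : nat) (a b : R) (x : R * R) : (4 <= N)%N ->
  noise_const * N%:R `^ (2 * alpha) * (a ^+ 2 + b ^+ 2) <=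
  \sum_(k <- low_seq R N) (a * (noise_amp k * d1e_ L k x)
     + b * (noise_amp k * d2e_ L k x)) ^+ 2 * box_var N k.
Proof.
move=> N4; have N0 : 0 < N%:R :> R by rewrite ltr0n; lia.
apply: le_trans (_ : \sum_(k <- box N) (a * (noise_amp k * d1e_ L k x)
     + b * (noise_amp k * d2e_ L k x)) ^+ 2 * box_var N k <= _); last first.
  apply: ler_sum_subset; rewrite ?box_uniq ?low_seq_uniq//.
    by move=> k; exact: box_low.
  by move=> k; rewrite mulr_ge0 ?sqr_ge0 ?box_var_ge0.
pose M : R := ((2 * pi / L) ^+ 2) `^ (alpha - 2) * (N%:R `^ (2 * alpha) / N%:R ^+ 4).
apply: (@le_trans _ _ (sigma ^+ 2 * expR (-2) * M *
    \sum_(k <- box N) (a * d1e_ L k x + b * d2e_ L k x) ^+ 2)); last first.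
  rewrite mulr_sumr big_seq [leRHS]big_seq; apply: ler_sum => k kb.
  have [v0 _ vN] := box_nu N4 kb.
  have mu0 : 0 < mu_ L k by rewrite mu_nu exprn_gt0.
  have amp2 : noise_amp k ^+ 2 = sigma ^+ 2 * mu_ L k `^ alpha.
    rewrite /noise_amp exprMn; congr (_ * _).
    by rewrite -powR_mulrn ?powR_ge0// -powRrM divfK.
  rewrite /box_var kb.
  rewrite [leRHS](_ : _ = sigma ^+ 2 * expR (-2) * (mu_ L k `^ alpha / mu_ L k ^+ 2)
     * (a * d1e_ L k x + b * d2e_ L k x) ^+ 2); last first.
    have -> : (a * (noise_amp k * d1e_ L k x) + b * (noise_amp k * d2e_ L k x)) ^+ 2
       = noise_amp k ^+ 2 * (a * d1e_ L k x + b * d2e_ L k x) ^+ 2 by ring.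
    by rewrite amp2; ring.
  apply: ler_wpM2r; first exact: sqr_ge0.
  apply: ler_wpM2l; first by rewrite mulr_ge0 ?sqr_ge0 ?expR_ge0.
  have powB (y : R) : 0 < y -> y `^ (alpha - 2) = y `^ alpha / y ^+ 2.
    move=> y0; rewrite powRB; last by rewrite (gt_eqF y0) implybT.
    by rewrite (powR_mulrn 2 (ltW y0)).
  rewrite -powB//.
  have -> : M = ((2 * pi / L * N%:R) ^+ 2) `^ (alpha - 2).
    rewrite /M [(_ * N%:R) ^+ 2]exprMn [RHS]powRM ?sqr_ge0//; congr (_ * _).
    rewrite powB ?exprn_gt0// -exprM; congr (_ / _).
    by rewrite -powR_mulrn ?ltW// -powRrM.
  have am : alpha - 2 = - (2 - alpha) by lra.
  have cN0 : 0 < 2 * pi / L * N%:R by exact: mulr_gt0.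
  rewrite am !powRN lef_pV2 ?posrE ?powR_gt0 ?exprn_gt0//.
  apply: ge0_ler_powR; rewrite ?nnegrE ?sqr_ge0//.
    by move/andP: alpha01 => [_ h]; lra.
  by rewrite mu_nu; apply: lerXn2r; rewrite ?nnegrE ?(ltW v0)// mulr_ge0 ?(ltW c_gt0) ?(ltW N0).
have gs := sum_grad_sqr_ge L_gt0 (N %/ 4) a b x.
have M0 : 0 <= sigma ^+ 2 * expR (-2) * M.
  apply: mulr_ge0; first by rewrite mulr_ge0 ?sqr_ge0 ?expR_ge0.
  by rewrite /M mulr_ge0 ?powR_ge0// divr_ge0 ?powR_ge0 ?exprn_ge0.
refine (le_trans _ (ler_wpM2l M0 gs)).
have mN : N%:R / 8 <= (N %/ 4)%:R :> R.
  by rewrite ler_pdivrMr// -natrM ler_nat; lia.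
have m4 : N%:R ^+ 4 / 8 ^+ 4 <= (N %/ 4)%:R ^+ 4 :> R.
  by rewrite -expr_div_n; apply: lerXn2r; rewrite ?nnegrE// divr_ge0.
rewrite /M /noise_const.
set E1 := expR (-2); set P1 := _ `^ (alpha - 2); set P2 := N%:R `^ _.
set G := 4 / L ^+ 2 * (2 * pi / L) ^+ 2.
have E10 : 0 <= E1 by exact: expR_ge0.
have P10 : 0 <= P1 by exact: powR_ge0.
have P20 : 0 <= P2 by exact: powR_ge0.
have G0 : 0 <= G by rewrite mulr_ge0 ?sqr_ge0// divr_ge0// sqr_ge0.
have ab0 : 0 <= a ^+ 2 + b ^+ 2 by rewrite addr_ge0 ?sqr_ge0.
rewrite [leLHS](_ : _ = sigma ^+ 2 * E1 * P1 * P2 * G * (a ^+ 2 + b ^+ 2) / N%:R ^+ 4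
   * (N%:R ^+ 4 / 8 ^+ 4)); last by field; exact: lt0r_neq0.
rewrite [leRHS](_ : _ = sigma ^+ 2 * E1 * P1 * P2 * G * (a ^+ 2 + b ^+ 2) / N%:R ^+ 4
   * (N %/ 4)%:R ^+ 4); last by ring.
apply: ler_wpM2l m4; apply: divr_ge0; last exact: exprn_ge0.
apply: mulr_ge0 => //; apply: mulr_ge0 => //; apply: mulr_ge0 => //.
by apply: mulr_ge0 => //; apply: mulr_ge0 => //; exact: sqr_ge0.
Qed.

(** From this time on, t mu_k^2 >= 1 for all k in the box. *)
Definition small_time (N : nat) : R := (8 * L / (2 * pi)) ^+ 4 / N%:R ^+ 4.

Context {d : measure_display} {Omega : measurableType d}.
Variables (P : probability Omega R) (beta Z : int * int -> R -> {RV P >-> R}).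
Hypotheses (bmP : iid_brownian beta) (ZP : is_stoch_conv L beta Z).

Definition noise1 (N : nat) (t : R) (x : R * R) (w : Omega) : R :=
  \sum_(k <- low_seq R N) (noise_amp k * d1e_ L k x) * Z k t w.
Definition noise2 (N : nat) (t : R) (x : R * R) (w : Omega) : R :=
  \sum_(k <- low_seq R N) (noise_amp k * d2e_ L k x) * Z k t w.

Lemma noise_charfun_le (N : nat) (t : R) (x : R * R) (a b c : R) :
  (4 <= N)%N -> small_time N <= t ->
  `|\int[P]_w cos (a * noise1 N t x w + b * noise2 N t x w + c)| <=
    expR (- (noise_const * N%:R `^ (2 * alpha) * (a ^+ 2 + b ^+ 2)) / 2).
Proof.
move=> N4 Nt; have N0 : 0 < N%:R :> R by rewrite ltr0n; lia.
have t0 : 0 <= t.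
  apply: le_trans Nt; rewrite divr_ge0 ?exprn_ge0//.
  by rewrite divr_ge0 ?mulr_ge0 ?pi_ge0 ?(ltW L_gt0).
pose th k := a * (noise_amp k * d1e_ L k x) + b * (noise_amp k * d2e_ L k x).
pose phi k s : R := expR (- (t - s) * mu_ L k ^+ 2).
have mphi k : measurable_fun setT (phi k).
  apply: (measurableT_comp (f := expR)); first exact: measurable_expR.
  apply: measurable_funM => //; apply: measurableT_comp => //.
  exact: measurable_funB.
have wZ k : k \in low_seq R N -> is_wiener_integral (beta k) t (phi k) (Z k t).
  by move=> /low_seq_neq0 k0; exact: (ZP k0).1.
have qphi k : k \in low_seq R N -> ((box_var N k)%:E <=
    \int[@lebesgue_measure R]_(u in `[0%R, t]) ((phi k u) ^+ 2)%:E)%E.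
  move=> kl; rewrite /box_var; case: ifP => [kb|_]; last first.
    by apply: integral_ge0 => u _; rewrite lee_fin sqr_ge0.
  have [v0 vN _] := box_nu N4 kb.
  apply: semigroup_sqr_integral_ge; first by rewrite mu_nu !exprn_gt0.
  have h : (2 * pi / L * (N%:R / 8)) ^+ 4 <= nu L k ^+ 4.
    apply: lerXn2r => //; rewrite nnegrE; last exact: ltW.
    by apply: mulr_ge0; [exact: ltW|exact: divr_ge0].
  rewrite mu_nu -exprM; apply: le_trans (ler_wpM2l t0 h).
  apply: le_trans (_ : small_time N * (2 * pi / L * (N%:R / 8)) ^+ 4 <= _); last first.
    apply: ler_wpM2r => //; apply: exprn_ge0; apply: mulr_ge0; first exact: ltW.
    by rewrite divr_ge0.
  rewrite /small_time le_eqVlt; apply/orP; left; apply/eqP.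
  have := @pi_gt0 R; move: (@pi R) => p p0.
  by field; rewrite (gt_eqF L_gt0) (gt_eqF N0) (gt_eqF p0).
have := charfun_wiener_le bmP (low_seq_uniq N) (@low_seq_neq0 R N) mphi wZ
  (box_var_ge0 N) qphi th c.
have -> : (fun w => cos (\sum_(k <- low_seq R N) th k * Z k t w + c)) =
   (fun w => cos (a * noise1 N t x w + b * noise2 N t x w + c)).
  apply/funext => w; congr (cos (_ + _)).
  rewrite /noise1 /noise2 !mulr_sumr -big_split/=; apply: eq_bigr => k _.
  by rewrite /th; ring.
move=> h; apply: le_trans h _; rewrite ler_expR.
have := noise_variance_ge a b x N4; rewrite -/th; lra.
Qed.

Lemma measurable_noise (N : nat) (t : R) (x : R * R) :
  measurable_fun setT (noise1 N t x) /\ measurable_fun setT (noise2 N t x).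
Proof.
by split; apply: measurable_sum => k; apply: measurable_funM => //;
  exact: measurable_funP.
Qed.

Lemma noise_small_ball (N : nat) (t : R) (x : R * R) (m1 m2 rho : R) :
  (4 <= N)%N -> small_time N <= t -> 0 < rho ->
  (P [set w | (noise1 N t x w + m1) ^+ 2 + (noise2 N t x w + m2) ^+ 2 <= rho ^+ 2]%R
    <= (1024 / cos 1 ^+ 4 / noise_const * rho ^+ 2 * N%:R `^ (- (2 * alpha)))%:E)%E.
Proof.
move=> N4 Nt rho0; have N0 : 0 < N%:R :> R by rewrite ltr0n; lia.
have [n1 n2] := measurable_noise N t x.
pose s := Num.sqrt (noise_const * N%:R `^ (2 * alpha)).
have v0 : 0 < noise_const * N%:R `^ (2 * alpha).
  by rewrite mulr_gt0 ?noise_const_gt0 ?powR_gt0.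
have s0 : 0 < s by rewrite sqrtr_gt0.
have s2 : s ^+ 2 = noise_const * N%:R `^ (2 * alpha) by rewrite sqr_sqrtr// ltW.
have := @small_ball R d Omega P _ _ s rho m1 m2 n1 n2 s0 rho0.
rewrite s2 => /(_ (fun a b c => noise_charfun_le x a b c N4 Nt)).
move=> h; apply: le_trans h _; rewrite lee_fin powRN.
rewrite le_eqVlt; apply/orP; left; apply/eqP.
have := noise_const_gt0; have := powR_gt0 (2 * alpha) N0; have := @cos1_gt0 R.
move: noise_const (N%:R `^ _) (cos 1) => K X c c0 X0 K0.
by field; rewrite (gt_eqF c0) (gt_eqF X0) (gt_eqF K0).
Qed.

End noise.

(** * Measurability in time and almost sure statements *)

Section joint_measurability.
Context {R : realType} {d : measure_display} {Omega : measurableType d}.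

Let grid (n : nat) (t : R) : R := (Num.truncn (t * n.+1%:R))%:R / n.+1%:R.

Let grid_bounds n (t : R) : 0 <= t -> grid n t <= t < grid n t + n.+1%:R^-1.
Proof.
move=> t0; have n0 : 0 < n.+1%:R :> R by [].
have /andP[h1 h2] := truncn_itv (mulr_ge0 t0 (ltW n0)).
rewrite /grid ler_pdivrMr// h1/= -[X in _ + X]mul1r -mulrDl ltr_pdivlMr//.
by rewrite natr1.
Qed.

(** The process frozen at the grid point of mesh 1 / (n + 1) to the left of t is a finite
    sum of products of measurable functions, and converges by continuity. *)
Lemma measurable_continuous_process (X : R -> Omega -> R) (A : set Omega) (T : R) :
  measurable A -> (forall t, measurable_fun setT (X t)) ->
  (forall w, A w -> {within `[0, +oo[, continuous (fun t => X t w)}) ->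
  measurable_fun (A `*` `[0, T]) (fun z : Omega * R => X z.2 z.1).
Proof.
move=> mA mX cX.
have mAT : measurable (A `*` (`[0, T]%classic : set R)).
  by apply: measurableX => //; exact: measurable_itv.
pose J n := (Num.truncn (T * n.+1%:R)).+1.
pose h n (z : Omega * R) : R :=
  \sum_(i < J n) X (i%:R / n.+1%:R) z.1 *
     \1_([set` `[i%:R / n.+1%:R, i.+1%:R / n.+1%:R[ ]) z.2.
have mh n : measurable_fun (A `*` (`[0, T]%classic : set R)) (h n).
  apply: measurable_sum => i; apply: measurable_funM; apply: measurable_funTS.
    by apply: (measurableT_comp (mX _)); exact: measurable_fst.
  have m1 : measurable_fun setT
      (\1_([set` `[(i%:R / n.+1%:R : R), i.+1%:R / n.+1%:R[ ]) : R -> R).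
    by apply: measurable_indic; exact: measurable_itv.
  exact: (measurableT_comp m1 measurable_snd).
apply: (measurable_fun_cvg mh) => -[w t] [/= Aw]; rewrite in_itv/= => /andP[t0 tT].
have hE n : h n (w, t) = X (grid n t) w.
  have n0 : 0 < n.+1%:R :> R by [].
  have jn : (Num.truncn (t * n.+1%:R) < J n)%N.
    by rewrite ltnS; apply: le_truncn; rewrite ler_pM2r.
  have /andP[h1 h2] := truncn_itv (mulr_ge0 t0 (ltW n0)).
  rewrite /h (bigD1 (Ordinal jn))//= big1 ?addr0.
    by rewrite indicE mem_set ?mulr1//= in_itv/= ler_pdivrMr// h1 ltr_pdivlMr.
  move=> i ij; rewrite indicE memNset ?mulr0//= in_itv/=.
  rewrite ler_pdivrMr// ltr_pdivlMr// => h3.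
  by move/eqP: ij; apply; apply: val_inj => /=; apply/esym/truncn_def.
under eq_fun do rewrite hE.
have cw : X s w @[s --> within `[0, +oo[ (nbhs t)] --> X t w.
  by apply: ((subspace_continuousP _ _).1 (cX w Aw) t); rewrite /= in_itv/= t0.
have cd : grid n t @[n --> \oo] --> t.
  have cl : t - harmonic n @[n --> \oo] --> t.
    by rewrite -[X in _ --> X]subr0; apply: cvgB; [exact: cvg_cst|exact: cvg_harmonic].
  apply: squeeze_cvgr cl (cvg_cst t); apply: nearW => n.
  by have /andP[h1 h2] := grid_bounds n t0; rewrite h1 andbT lerBlDr ltW.
have cd' : grid n t @[n --> \oo] --> within (`[0, +oo[%classic : set R) (nbhs t).
  move=> U hU.
  have H : \forall n \near \oo, (`[0, +oo[%classic : set R) (grid n t) -> U (grid n t).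
    exact: cd _ hU.
  apply: filterS H => n; apply.
  by rewrite /= in_itv/= andbT /grid divr_ge0.
exact: (cvg_comp _ _ cd' cw).
Qed.

End joint_measurability.

Lemma ae_forall_seq d (T : measurableType d) (R : realType)
    (mu : {measure set T -> \bar R}) (I : eqType) (s : seq I) (Q : I -> T -> Prop) :
  (forall i, i \in s -> {ae mu, forall x, Q i x}) ->
  {ae mu, forall x i, i \in s -> Q i x}.
Proof.
elim: s => [_|j s IH sQ]; first exact: aeW.
have h1 := sQ j (mem_head _ _).
have h2 := IH (fun i si => sQ i (mem_behead (s := j :: s) si)).
apply: filterS2 h1 h2 => x Qj Qs i; rewrite inE => /predU1P[-> //|]; exact: Qs.
Qed.

Lemma integral_dichotomy d (T : measurableType d) (R : realType)
    (mu : {measure set T -> \bar R}) (D B : set T) (F : T -> R) (c : R) :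
  measurable D -> measurable B -> 0 <= c -> measurable_fun D F ->
  (forall x, D x -> 0 <= F x <= 1) ->
  {ae mu, forall x, D x -> F x <= c \/ B x} ->
  (\int[mu]_(x in D) (F x)%:E <= c%:E * mu D + mu (B `&` D))%E.
Proof.
move=> mD mB c0 mF F01 FB.
have mI : measurable_fun D (fun x => (\1_B x)%:E : \bar R).
  by apply/measurable_EFinP; exact: measurable_indic.
have -> : (c%:E * mu D + mu (B `&` D) =
    \int[mu]_(x in D) (c%:E + (\1_B x)%:E))%E.
  rewrite ge0_integralD//.
  by rewrite integral_cst// integral_indic.
apply: ae_ge0_le_integral => //.
- by move=> x /F01/andP[h _]; rewrite lee_fin.
- exact/measurable_EFinP.
- by move=> x _; rewrite -EFinD lee_fin addr_ge0// indicE.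
- exact: emeasurable_funD.
apply: filterS FB => x h Dx; rewrite -EFinD lee_fin indicE.
have /andP[_ F1] := F01 x Dx.
case: (h Dx) => [Fc|Bx].
  by apply: le_trans Fc _; rewrite lerDl.
by rewrite mem_set//; apply: le_trans F1 _; rewrite lerDr.
Qed.

Lemma ae_and_imply d (T : measurableType d) (R : realType)
    (mu : {measure set T -> \bar R}) (A B C : T -> Prop) :
  {ae mu, forall x, A x} -> {ae mu, forall x, B x} ->
  (forall x, A x -> B x -> C x) -> {ae mu, forall x, C x}.
Proof. by move=> h1 h2 h; apply: filterS2 h1 h2. Qed.

(** * Decomposition of the gradient *)

Section gradient_decomposition.
Context {R : realType}.
Variable L : R.
Hypothesis L_gt0 : 0 < L.
Local Notation mu2 := ((@lebesgue_measure R) \x (@lebesgue_measure R))%E.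
Implicit Types (u a V : @coef R).

Definition abs_summable u : Prop :=
  exists B, forall n, \sum_(k <- low_seq R n) nu L k * `|u k| <= B.

Lemma normr_lam_le k : `|lam L k.1| <= nu L k /\ `|lam L k.2| <= nu L k.
Proof.
have h : nu L k ^+ 2 = lam L k.1 ^+ 2 + lam L k.2 ^+ 2 by rewrite -mu_nu mu_lam.
have v0 := nu_ge0 L_gt0 k.
by split; rewrite -(@ler_pXn2r _ 2) ?nnegrE// real_normK ?num_real// h ?lerDl ?lerDr sqr_ge0.
Qed.

Let bt k := 2 / L * nu L k.

Lemma normr_d1e_le k x : `|d1e_ L k x| <= bt k.
Proof.
have [h _] := normr_lam_le k.
rewrite d1eE// normrM mulrC; apply: ler_pM => //; exact: normr_e_le.
Qed.

Lemma normr_d2e_le k x : `|d2e_ L k x| <= bt k.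
Proof.
have [_ h] := normr_lam_le k.
rewrite d2eE// normrM mulrC; apply: ler_pM => //; exact: normr_e_le.
Qed.

Lemma measurable_d1e k (D : set (R * R)) : measurable_fun D (d1e_ L k).
Proof.
have mf : measurable_fun D (fun x => lam L k.1 * e_ L (- k.1, k.2) x).
  by apply: measurable_funM => //; exact: measurable_e.
by apply: eq_measurable_fun mf => x _; rewrite d1eE.
Qed.

Lemma measurable_d2e k (D : set (R * R)) : measurable_fun D (d2e_ L k).
Proof.
have mf : measurable_fun D (fun x => lam L k.2 * e_ L (k.1, - k.2) x).
  by apply: measurable_funM => //; exact: measurable_e.
by apply: eq_measurable_fun mf => x _; rewrite d2eE.
Qed.

Lemma grad_weight_sum u B : (forall n, \sum_(k <- low_seq R n) nu L k * `|u k| <= B) ->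
  forall n, \sum_(k <- low_seq R n) bt k * `|u k| <= 2 / L * B.
Proof.
move=> uB n; under eq_bigr do rewrite /bt -mulrA.
by rewrite -mulr_sumr ler_wpM2l// divr_ge0// ltW.
Qed.

(** Absolute summability allows to compute the gradient pointwise, off a null set. *)
Lemma grad_abs_sum u : abs_summable u ->
  {ae mu2, forall x, torus L x ->
    grad L u x = (abs_sum (d1e_ L) u x, abs_sum (d2e_ L) u x)}.
Proof.
move=> [B /grad_weight_sum uB].
have h1 := L2sum_ae (fun k => @measurable_d1e k (torus L))
  (is_L2sum_abs_sum L_gt0 (fun k => @measurable_d1e k (torus L)) normr_d1e_le uB).
have h2 := L2sum_ae (fun k => @measurable_d2e k (torus L))
  (is_L2sum_abs_sum L_gt0 (fun k => @measurable_d2e k (torus L)) normr_d2e_le uB).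
by refine (ae_and_imply h1 h2 _) => x e1 e2 tx; rewrite /grad e1// e2.
Qed.

(** For t > 0, e^{-t nu^4} <= 1 / (t c nu^3) with c the smallest nu_k, and nu_k^-3 is
    summable.  The bound blows up as t tends to 0, which is harmless: it is only used
    to give a meaning to the sums. *)
Lemma semigroup_abs_summable a (t Ba : R) : 0 < t ->
  (forall k, k != 0 -> nu L k * `|a k| <= Ba) -> abs_summable (semigroup L t a).
Proof.
move=> t0 aB; pose c := 2 * pi / L.
have c0 : 0 < c by rewrite divr_gt0// mulr_gt0// pi_gt0.
have Ba0 : 0 <= Ba.
  apply: le_trans (aB (1, 0) isT); rewrite mulr_ge0// nu_ge0//.
exists (Ba / (t * c) * sum_nu3 L) => n.
apply: (@le_trans _ _ (\sum_(k <- low_seq R n) Ba / (t * c) * nu L k ^- 3)); last first.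
  by rewrite -mulr_sumr ler_wpM2l ?sum_nu3_le// divr_ge0// mulr_ge0 ?ltW.
rewrite big_seq [leRHS]big_seq; apply: ler_sum => k /low_seq_neq0 k0.
have v0 := nu_gt0 L_gt0 k0.
have cv : c <= nu L k by rewrite nuE ler_peMr ?(ltW c0)// freq_norm_ge1.
rewrite /semigroup normrM ger0_norm ?expR_ge0// mulrCA mu_nu -exprM.
have E : expR (- t * nu L k ^+ 4) <= (t * c)^-1 * nu L k ^- 3.
  have tcv : 0 < t * c * nu L k ^+ 3 by apply: mulr_gt0; [exact: mulr_gt0|exact: exprn_gt0].
  rewrite mulNr expRN -invfM lef_pV2 ?posrE ?expR_gt0//.
  apply: le_trans (_ : t * nu L k ^+ 4 <= _).
    by rewrite -mulrA ler_pM2l// [leRHS]exprS ler_pM2r// exprn_gt0.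
  by apply: le_trans (expR_ge1Dx _); rewrite lerDr.
rewrite -mulrA [leRHS]mulrC.
apply: ler_pM; [exact: expR_ge0| |exact: E|exact: aB].
by apply: mulr_ge0; [exact: ltW|exact: normr_ge0].
Qed.

(** After subtraction of the low frequencies of the noise and of the semigroup term, V
    alone remains, and its series is dominated uniformly in x. *)
Lemma abs_sum_near (b : int * int -> R * R -> R) (u a V : @coef R) (N : nat)
    (nz : int * int -> R) (K : R) (x : R * R) :
  (forall k x, `|b k x| <= bt k) -> abs_summable u -> abs_summable a ->
  (forall n, \sum_(k <- low_seq R n) nu L k * `|V k| <= K) ->
  (forall k, u k = a k + V k + (if k \in low_seq R N then nz k else 0)) ->
  `|abs_sum b u x - (\sum_(k <- low_seq R N) nz k * b k x + abs_sum b a x)|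
    <= 2 / L * K.
Proof.
move=> bb [Bu /grad_weight_sum uB] [Ba /grad_weight_sum aB] /grad_weight_sum VK uE.
have cu := @abs_sum_cvg _ _ _ _ _ bb uB x.
have ca := @abs_sum_cvg _ _ _ _ _ bb aB x.
set S := \sum_(k <- low_seq R N) nz k * b k x.
have cv : (fun n => `|\sum_(k <- low_seq R n) u k * b k x
    - (S + \sum_(k <- low_seq R n) a k * b k x)|) @ \oo
    --> `|abs_sum b u x - (S + abs_sum b a x)|.
  apply: cvg_norm; apply: cvgB => //; apply: cvgD => //; exact: cvg_cst.
rewrite -(cvg_lim _ cv)//; apply: limr_le; first exact: (cvgP _ cv).
near=> n.
have Nn : (N <= n)%N by near: n; exact: nbhs_infty_ge.
have -> : \sum_(k <- low_seq R n) u k * b k x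
    - (S + \sum_(k <- low_seq R n) a k * b k x) = \sum_(k <- low_seq R n) V k * b k x.
  have -> : S = \sum_(k <- low_seq R n) (if k \in low_seq R N then nz k else 0) * b k x.
    have := low_sum_diff (fun k => (if k \in low_seq R N then nz k else 0) * b k x) Nn.
    rewrite [X in _ = X -> _]big1; last by move=> k /negbTE ->; rewrite mul0r.
    move/eqP; rewrite subr_eq0 => /eqP ->.
    by rewrite /S big_seq [RHS]big_seq; apply: eq_bigr => k ->.
  rewrite opprD -!sumrN -!big_split/=; apply: eq_bigr => k _.
  by rewrite uE; case: ifP => _; move: (a k) (V k) (b k x) (nz k) => A B C D; ring.
apply: le_trans (ler_norm_sum _ _ _) _; apply: le_trans (VK n).
by apply: ler_sum => k _; rewrite normrM mulrC ler_wpM2r.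
Unshelve. all: by end_near. Qed.

Lemma abs_summableD u V : abs_summable u -> abs_summable V ->
  abs_summable (fun k => u k + V k).
Proof.
move=> [B uB] [B' VB]; exists (B + B') => n.
apply: le_trans (lerD (uB n) (VB n)); rewrite -big_split/=; apply: ler_sum => k _.
by rewrite -mulrDr ler_wpM2l ?nu_ge0// ler_normD.
Qed.

Lemma abs_summable_low (N : nat) (nz : int * int -> R) :
  abs_summable (fun k => if k \in low_seq R N then nz k else 0).
Proof.
exists (\sum_(k <- low_seq R N) nu L k * `|nz k|) => n.
rewrite (bigID (mem (low_seq R N)))/= [X in _ + X]big1 ?addr0; last first.
  by move=> k /negbTE ->; rewrite normr0 mulr0.
rewrite (eq_bigr (fun k => nu L k * `|nz k|)); last by move=> k ->.
rewrite -big_filter; apply: ler_sum_subset; rewrite ?filter_uniq ?low_seq_uniq//.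
- by move=> k; rewrite mem_filter => /andP[].
- by move=> k; rewrite mulr_ge0// nu_ge0.
Qed.

End gradient_decomposition.

(** * Integration over the probability space *)

Section product_sigma_finite.
Context {R : realType} {d1 d2 : measure_display}.
Context {T1 : measurableType d1} {T2 : measurableType d2}.
Variables (m1 : {sigma_finite_measure set T1 -> \bar R}).
Variables (m2 : {sigma_finite_measure set T2 -> \bar R}).

Lemma sigma_finite_product : sigma_finite setT (m1 \x m2)%E.
Proof.
have /sigma_finiteP[F [FT Fnd Foo]] := sigma_finiteT m1.
have /sigma_finiteP[G [GT Gnd Goo]] := sigma_finiteT m2.
exists (fun n => F n `*` G n) => [|n].
  apply/seteqP; split => // -[x y] _.
  have [i _ Fx] : (\bigcup_n F n) x by rewrite -FT.
  have [j _ Gy] : (\bigcup_n G n) y by rewrite -GT.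
  exists (maxn i j) => //; split.
    exact: (subsetPset _ _ (Fnd _ _ (leq_maxl i j))) _ Fx.
  exact: (subsetPset _ _ (Gnd _ _ (leq_maxr i j))) _ Gy.
have [mF Fy] := Foo n; have [mG Gy] := Goo n.
by split; [exact: measurableX|rewrite product_measure1E// lte_mul_pinfty// ge0_fin_numE].
Qed.

Definition product_sigma_finite : {sigma_finite_measure set (T1 * T2)%type -> \bar R} :=
  HB.pack (m1 \x m2)%E
    (Measure_isSigmaFinite.Build _ _ _ (m1 \x m2)%E sigma_finite_product).

End product_sigma_finite.

Section expectation_of_time_integral.
Context {R : realType} {d d1 d2 : measure_display}.
Context {W : measurableType d} {T1 : measurableType d1} {T2 : measurableType d2}.
Variables (P : probability W R).
Variables (m1 : {sigma_finite_measure set T1 -> \bar R}).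
Variables (m2 : {sigma_finite_measure set T2 -> \bar R}).
Local Open Scope ereal_scope.

Lemma integral_section_le (E : set (W * (T1 * T2))) (D : set (T1 * T2)) (c : R) :
  measurable E -> measurable D -> (forall z, E z -> D z.2) -> (0 <= c)%R ->
  (forall y, D y -> P (ysection E y) <= c%:E) ->
  \int[P]_w (m1 \x m2) (xsection E w) <= c%:E * (m1 \x m2) D.
Proof.
move=> mE mD ED c0 Ec.
have := indic_fubini_tonelli P (product_sigma_finite m1 m2) mE.
rewrite indic_fubini_tonelli_FE// indic_fubini_tonelli_GE//= => ->.
rewrite -integral_cst// [leRHS]integral_mkcond; apply: le_lower_integral => //= y _.
rewrite patchE; case: ifPn => [/set_mem/Ec //|yD].
rewrite (_ : ysection E y = set0) ?measure0//.
by rewrite -subset0 => w; rewrite /ysection/= inE => /ED /mem_set; rewrite (negbTE yD).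
Qed.

(** The bound b serves on S and on a null set of w; elsewhere I is below a measurable
    function of (w, t), and Fubini's theorem concerns the event E only. *)
Lemma expectation_integral_le (E : set (W * (T1 * T2))) (D1 S : set T1) (D2 : set T2)
    (I : W -> T1 -> \bar R) (a b c : R) :
  measurable E -> measurable D1 -> measurable S -> measurable D2 ->
  (forall z, E z -> (D1 `*` D2) z.2) -> m1 D1 < +oo ->
  (0 <= a)%R -> (0 <= b)%R -> (0 <= c)%R ->
  (forall y, (D1 `*` D2) y -> P (ysection E y) <= c%:E) ->
  (forall w t, 0 <= I w t <= b%:E) ->
  {ae P, forall w t, D1 t -> ~ S t ->
     I w t <= a%:E + m2 (xsection (xsection E w) t)} ->
  \int[P]_w \int[m1]_(t in D1) I w t <=
    b%:E * m1 (S `&` D1) + a%:E * m1 D1 + c%:E * (m1 \x m2) (D1 `*` D2).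
Proof.
move=> mE mD1 mS mD2 ED D1y a0 b0 c0 Ec I0b [X [mX PX XI]].
have I0 w t : 0 <= I w t by case/andP: (I0b w t).
have Ib w t : I w t <= b%:E by case/andP: (I0b w t).
have mXs w : measurable (xsection E w) by exact: measurable_xsection.
pose h w t := (b%:E * (\1_S t)%:E + a%:E) + m2 (xsection (xsection E w) t).
have mh1 : measurable_fun D1 (fun t => b%:E * (\1_S t)%:E : \bar R).
  by apply/measurable_EFinP; apply: measurable_funM => //; exact: measurable_indic.
have mh2 w : measurable_fun D1 (fun t => m2 (xsection (xsection E w) t)).
  by apply: measurable_funTS; exact: measurable_fun_xsection.
have h10 t : 0 <= b%:E * (\1_S t)%:E :> \bar R.
  by rewrite -EFinM lee_fin mulr_ge0// indicE.
have goodE w : ~ X w -> \int[m1]_(t in D1) I w t <=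
    b%:E * m1 (S `&` D1) + a%:E * m1 D1 + (m1 \x m2) (xsection E w).
  move=> Xw; have HI : forall t, D1 t -> ~ S t ->
      I w t <= a%:E + m2 (xsection (xsection E w) t).
    by apply: contrapT => H; exact: Xw (XI _ H).
  apply: (@le_trans _ _ (\int[m1]_(t in D1) h w t)).
    apply: le_lower_integral => // t Dt; rewrite /h indicE.
    have [St|St] := pselect (S t).
      rewrite mem_set// mule1 -addeA; apply: le_trans (Ib w t) _.
      by rewrite leeDl// adde_ge0.
    by rewrite memNset// mule0 add0e; exact: HI.
  rewrite /h ge0_integralD//; last 2 first.
  - by move=> t _; rewrite adde_ge0.
  - by apply: emeasurable_funD => //; exact: measurable_cst.
  rewrite ge0_integralD//.
  rewrite ge0_integralZl//; last by apply/measurable_EFinP; exact: measurable_indic.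
  rewrite integral_cst// integral_indic//; apply: leeD => //.
  rewrite [leRHS]/product_measure1; apply: ge0_subset_integral => //.
  exact: measurable_fun_xsection.
have badE w : \int[m1]_(t in D1) I w t <= b%:E * m1 D1.
  by rewrite -integral_cst//; apply: le_lower_integral.
set c1 := b%:E * m1 (S `&` D1) + a%:E * m1 D1.
have c10 : 0 <= c1 by rewrite adde_ge0// mule_ge0.
apply: (@le_trans _ _ (\int[P]_w ((c1 + (m1 \x m2) (xsection E w))
    + b%:E * m1 D1 * (\1_X w)%:E))).
  apply: le_lower_integral => w _; first exact: integral_ge0.
  rewrite indicE; have [Xw|Xw] := pselect (X w).
    rewrite mem_set// mule1; apply: le_trans (badE w) _.
    by rewrite leeDr// adde_ge0.
  by rewrite memNset// mule0 adde0; exact: goodE.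
have bm0 : 0 <= b%:E * m1 D1 by rewrite mule_ge0.
have mEx : measurable_fun setT (fun w => (m1 \x m2) (xsection E w)).
  exact: (measurable_fun_xsection (product_sigma_finite m1 m2)).
have m1X : measurable_fun setT (fun w => (\1_X w)%:E : \bar R).
  by apply/measurable_EFinP; exact: measurable_indic.
rewrite ge0_integralD//; last 4 first.
- by move=> w _; rewrite adde_ge0.
- by apply: emeasurable_funD => //; exact: measurable_cst.
- by move=> w _; rewrite mule_ge0// lee_fin.
- exact: measurable_funeM.
rewrite ge0_integralD//.
have -> : \int[P]_w c1 = c1.
  rewrite integral_cst// -[RHS]mule1; congr (_ * _); exact: probability_setT.
have IX : \int[P]_w (\1_X w)%:E = 0.
  by rewrite integral_indic// setIT; exact: PX.
rewrite ge0_integralZl// IX mule0 adde0.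
rewrite leeD2l//; apply: integral_section_le => //; exact: measurableX.
Qed.

End expectation_of_time_integral.

(** * The event of a small gradient *)

Section bad_event.
Context {R : realType}.
Variables (L alpha sigma : R).
Hypotheses (L_gt0 : 0 < L).
Context {d : measure_display} {Omega : measurableType d}.
Variables (P : probability Omega R) (Z : int * int -> R -> {RV P >-> R}).
Variables (a : @coef R) (Ba : R).
Hypothesis aB : forall k, k != 0 -> nu L k * `|a k| <= Ba.
Variables (A : set Omega) (N : nat) (s T : R).
Hypotheses (mA : measurable A) (s_gt0 : 0 < s).
Hypothesis ZA : forall w, A w -> forall k, k \in low_seq R N ->
  {within `[0, +oo[, continuous (fun t => Z k t w)}.

Let D0 : set (Omega * (R * (R * R))) := A `*` (`[s, T] `*` torus L).

Let mD0 : measurable D0.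
Proof.
apply: measurableX => //; apply: measurableX; first exact: measurable_itv.
exact: measurable_torus.
Qed.

Let mt : measurable_fun D0 (fun z : Omega * (R * (R * R)) => z.2.1).
Proof. by apply: measurable_funTS; exact: (measurableT_comp measurable_fst measurable_snd). Qed.

Let mx (f : R * R -> R) : measurable_fun setT f ->
  measurable_fun D0 (fun z : Omega * (R * (R * R)) => f z.2.2).
Proof.
move=> mf; apply: measurable_funTS; apply: (measurableT_comp mf).
exact: (measurableT_comp measurable_snd measurable_snd).
Qed.

Lemma measurable_shift (b : int * int -> R * R -> R) :
  (forall k, measurable_fun setT (b k)) ->
  (forall k x, `|b k x| <= 2 / L * nu L k) ->
  measurable_fun D0 (fun z => abs_sum b (semigroup L z.2.1 a) z.2.2).
Proof.
move=> mb bb.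
apply: (@measurable_fun_cvg _ _ _ _ (fun n (z : Omega * (R * (R * R))) =>
  \sum_(k <- low_seq R n) semigroup L z.2.1 a k * b k z.2.2)).
- move=> n; apply: measurable_sum => k; apply: measurable_funM; last exact: mx.
  apply: measurable_funM => //; apply: (measurableT_comp (f := expR)) => //.
  by apply: measurable_funM => //; apply: measurableT_comp mt.
- move=> [w [t x]] [_ [/= + _]]; rewrite in_itv/= => /andP[st _].
  have [B /(grad_weight_sum L_gt0) uB] := semigroup_abs_summable L_gt0 (lt_le_trans s_gt0 st) aB.
  exact: (@abs_sum_cvg _ _ _ _ _ bb uB x).
Qed.

Lemma measurable_noise_joint (b : int * int -> R * R -> R) :
  (forall k, measurable_fun setT (b k)) ->
  measurable_fun D0 (fun z => \sum_(k <- low_seq R N)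
    (noise_amp L alpha sigma k * b k z.2.2) * Z k z.2.1 z.1).
Proof.
move=> mb; rewrite [X in measurable_fun _ X](_ : _ = fun z => \sum_(k <- low_seq R N)
    (if k \in low_seq R N then (noise_amp L alpha sigma k * b k z.2.2) * Z k z.2.1 z.1
     else 0)); last by apply/funext => z; rewrite [LHS]big_seq [LHS]big_mkcond.
apply: measurable_sum => k; case kN : (k \in low_seq R N); last exact: measurable_cst.
apply: measurable_funM; first by apply: measurable_funM => //; exact: mx.
have mZ : measurable_fun (A `*` `[0, T]) (fun y : Omega * R => Z k y.2 y.1).
  apply: (@measurable_continuous_process _ _ _ (fun t w => Z k t w) A T mA) => [t|w Aw].
    exact: measurable_funP.
  exact: ZA.
have mAT : measurable (A `*` (`[0, T]%classic : set R)).
  by apply: measurableX => //; exact: measurable_itv.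
have mg : measurable_fun D0 (fun z : Omega * (R * (R * R)) => (z.1, z.2.1)).
  apply: measurable_funTS; apply: measurable_fun_pair; first exact: measurable_fst.
  exact: (measurableT_comp measurable_fst measurable_snd).
apply: (measurable_comp mAT _ mZ mg) => _ [[w [t x]] [Aw [/= + _]] <-].
rewrite in_itv/= => /andP[st tT].
by split => //=; rewrite in_itv/= tT (ltW (lt_le_trans s_gt0 st)).
Qed.

Definition shifted_noise_sqr (z : Omega * (R * (R * R))) : R :=
  (noise1 L alpha sigma Z N z.2.1 z.2.2 z.1
     + abs_sum (d1e_ L) (semigroup L z.2.1 a) z.2.2) ^+ 2
  + (noise2 L alpha sigma Z N z.2.1 z.2.2 z.1
     + abs_sum (d2e_ L) (semigroup L z.2.1 a) z.2.2) ^+ 2.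

(** The sum of the gradients of the noise and of the semigroup term lies in a disc: it is
    defined without u, which makes it jointly measurable. *)
Definition bad_event (rho : R) : set (Omega * (R * (R * R))) :=
  D0 `&` [set z | shifted_noise_sqr z <= rho ^+ 2].

Lemma measurable_bad_event rho : measurable (bad_event rho).
Proof.
have mq : measurable_fun D0 shifted_noise_sqr.
  apply: measurable_funD; apply: measurable_funX; apply: measurable_funD.
  - exact: measurable_noise_joint (fun k => @measurable_d1e _ _ L_gt0 k setT).
  - exact: measurable_shift (fun k => @measurable_d1e _ _ L_gt0 k setT) (normr_d1e_le L_gt0).
  - exact: measurable_noise_joint (fun k => @measurable_d2e _ _ L_gt0 k setT).
  - exact: measurable_shift (fun k => @measurable_d2e _ _ L_gt0 k setT) (normr_d2e_le L_gt0).
have -> : bad_event rho = D0 `&` shifted_noise_sqr @^-1` `]-oo, rho ^+ 2]%classic.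
  by rewrite /bad_event; congr (_ `&` _); apply/seteqP; split=> z /=; rewrite in_itv.
by apply: mq => //; exact: measurable_itv.
Qed.

End bad_event.

Section dichotomy.
Context {R : realType}.
Variables (L alpha sigma p T K : R).
Hypotheses (L_gt0 : 0 < L) (p_gt1 : 1 < p) (K_ge0 : 0 <= K).
Local Notation mu2 := ((@lebesgue_measure R) \x (@lebesgue_measure R))%E.
Context {d : measure_display} {Omega : measurableType d}.
Variables (P : probability Omega R) (Z : int * int -> R -> {RV P >-> R}).
Variables (a : @coef R) (Ba : R).
Hypothesis aB : forall k, k != 0 -> nu L k * `|a k| <= Ba.

Definition f_grad_pow (u : @coef R) x := enorm (f_ (grad L u x)) `^ p.

Let p_gt0 : 0 < p. Proof. exact: lt_trans p_gt1. Qed.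

Lemma f_grad_pow01 u x : 0 <= f_grad_pow u x <= 1.
Proof.
rewrite powR_ge0/=; have <- : 1 `^ p = 1 :> R by rewrite powR1.
apply: ge0_ler_powR; rewrite ?nnegrE ?sqrtr_ge0//.
  exact: ltW.
exact: enorm_f_le1.
Qed.

Lemma measurable_f_grad_pow u : measurable_fun (torus L) (f_grad_pow u).
Proof.
have [mf1 mf2] := measurable_f_grad L u.
apply: (measurableT_comp (measurable_powR p)).
apply: (measurableT_comp (f := @Num.sqrt R)).
  apply: continuous_measurable_fun; exact: sqrt_continuous.
by apply: measurable_funD; exact: measurable_funX.
Qed.

(** If |grad u| <= r then each component of noise plus shift is at most r + 2 K / L in
    modulus, by abs_sum_near; otherwise |f (grad u)| <= 1 / r. *)
Lemma small_or_bad (A : set Omega) (N : nat) (s r t : R) (w : Omega)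
    (u V : @coef R) : 0 < s <= t -> t <= T -> A w -> 0 < r ->
  (forall k, u k = semigroup L t a k + V k + sigma * Defs.proj N (Zalpha L alpha Z t w) k) ->
  (forall n, \sum_(k <- low_seq R n) nu L k * `|V k| <= K) ->
  {ae mu2, forall x, torus L x -> f_grad_pow u x <= r `^ (- p) \/
    bad_event L alpha sigma Z a A N s T (2 * (r + 2 / L * K)) (w, (t, x))}.
Proof.
move=> /andP[s0 st] tT Aw r0 uE VK; set K1 := 2 / L * K.
have t0 : 0 < t by exact: lt_le_trans st.
have K10 : 0 <= K1 by rewrite mulr_ge0// divr_ge0// ltW.
pose nz k := noise_amp L alpha sigma k * Z k t w.
have {}uE k : u k = semigroup L t a k + V k + (if k \in low_seq R N then nz k else 0).
  rewrite uE /Defs.proj /Zalpha /nz /noise_amp mem_low_seq; congr (_ + _).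
  have -> : (k \in @low_freq R N) = (0 < @freq_norm R k <= N%:R).
    by apply/idP/idP => [/set_mem|h]; [|exact: mem_set].
  by case: ifP => _; rewrite ?mulr0// mulrA.
have sa := semigroup_abs_summable L_gt0 t0 aB.
have su : abs_summable L u.
  rewrite (_ : u = fun k => semigroup L t a k + V k
    + (if k \in low_seq R N then nz k else 0)); last exact/funext.
  apply: (abs_summableD L_gt0); last exact: abs_summable_low.
  by apply: (abs_summableD L_gt0) => //; exists K.
have := grad_abs_sum L_gt0 su.
move=> h; refine (ae_and_imply h h _) => x {h} gE _ /[dup] tx /gE {}gE.
have [gr|rg] := leP (enorm (grad L u x)) r; last first.
  left; have -> : r `^ (- p) = r^-1 `^ p by rewrite -(powR_inv1 (ltW r0)) -powRrM mulN1r.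
  apply: ge0_ler_powR; rewrite ?nnegrE ?sqrtr_ge0 ?invr_ge0 ?(ltW r0) ?(ltW p_gt0)//.
  have g0 := lt_trans r0 rg.
  by apply: le_trans (enorm_f_leV g0) _; rewrite lef_pV2// ltW.
right; split; first by split => //; split => //=; rewrite in_itv/= st.
have n1 := abs_sum_near L_gt0 x (normr_d1e_le L_gt0) su sa VK uE.
have n2 := abs_sum_near L_gt0 x (normr_d2e_le L_gt0) su sa VK uE.
rewrite -/K1 in n1 n2; move: (normr_fst_le (grad L u x)) (normr_snd_le (grad L u x)).
rewrite gE/= => g1 g2.
have e1 : noise1 L alpha sigma Z N t x w = \sum_(k <- low_seq R N) nz k * d1e_ L k x.
  by apply: eq_bigr => k _; rewrite mulrAC.
have e2 : noise2 L alpha sigma Z N t x w = \sum_(k <- low_seq R N) nz k * d2e_ L k x.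
  by apply: eq_bigr => k _; rewrite mulrAC.
rewrite -e1 in n1; rewrite -e2 in n2.
have bnd (y z : R) : `|y| <= r -> `|y - z| <= K1 -> z ^+ 2 <= (r + K1) ^+ 2.
  move=> yr yz; rewrite -(@real_normK _ z) ?num_real//; apply: lerXn2r.
  - by rewrite nnegrE.
  - by rewrite nnegrE addr_ge0// ltW.
  - have -> : z = y - (y - z) by rewrite opprB addrC subrK.
    by apply: le_trans (ler_normB _ _) _; exact: lerD.
rewrite gE/= in gr.
have := bnd _ _ (le_trans g1 gr) n1; have := bnd _ _ (le_trans g2 gr) n2.
move=> /= b2 b1; apply: le_trans (lerD b1 b2) _.
have := sqr_ge0 (r + K1); rewrite exprMn; lra.
Qed.

End dichotomy.

Section bad_event_probability.
Context {R : realType}.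
Variables (L alpha sigma T : R).
Hypotheses (L_gt0 : 0 < L) (alpha01 : 0 < alpha < 1) (sigma_gt0 : 0 < sigma).
Context {d : measure_display} {Omega : measurableType d}.
Variables (P : probability Omega R) (beta Z : int * int -> R -> {RV P >-> R}).
Hypotheses (bmP : iid_brownian beta) (ZP : is_stoch_conv L beta Z).
Variables (a : @coef R) (A : set Omega) (N : nat) (rho : R).
Hypotheses (N4 : (4 <= N)%N) (rho_gt0 : 0 < rho).

Definition small_ball_const : R := 1024 / cos 1 ^+ 4 / noise_const L alpha sigma.

Definition bad_prob : R := small_ball_const * rho ^+ 2 * N%:R `^ (- (2 * alpha)).

Lemma small_ball_const_ge0 : 0 <= small_ball_const.
Proof.
apply: divr_ge0; last exact: ltW (noise_const_gt0 _ _ _).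
by apply: divr_ge0; [exact: ler0n|exact: exprn_even_ge0].
Qed.

Lemma bad_prob_ge0 : 0 <= bad_prob.
Proof.
apply: mulr_ge0 (powR_ge0 _ _); apply: mulr_ge0 (sqr_ge0 _).
exact: small_ball_const_ge0.
Qed.

Lemma bad_event_prob_le (y : R * (R * R)) :
  measurable (bad_event L alpha sigma Z a A N (small_time L N) T rho) ->
  (P (ysection (bad_event L alpha sigma Z a A N (small_time L N) T rho) y) <= bad_prob%:E)%E.
Proof.
set E := bad_event _ _ _ _ _ _ _ _ _ _ => mE.
have [sy|ys] := leP (small_time L N) y.1; last first.
  rewrite (_ : ysection E y = set0) ?measure0 ?lee_fin; first exact: bad_prob_ge0.
  rewrite -subset0 => w; rewrite /ysection/= inE => -[[_ [/= + _]] _].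
  by rewrite in_itv/= leNgt ys.
have [n1 n2] := measurable_noise L alpha sigma Z N y.1 y.2.
set q1 := abs_sum (d1e_ L) (semigroup L y.1 a) y.2.
set q2 := abs_sum (d2e_ L) (semigroup L y.1 a) y.2.
pose q (w : Omega) : R := (noise1 L alpha sigma Z N y.1 y.2 w + q1) ^+ 2
  + (noise2 L alpha sigma Z N y.1 y.2 w + q2) ^+ 2.
have mq : measurable_fun setT q.
  by apply: measurable_funD; apply: measurable_funX; apply: measurable_funD.
have mQ : measurable [set w | q w <= rho ^+ 2].
  have -> : [set w | q w <= rho ^+ 2] = setT `&` q @^-1` `]-oo, rho ^+ 2]%classic.
    by apply/seteqP; split => w /=; rewrite in_itv/=; [split|case].
  by apply: mq => //; exact: measurable_itv.
have := noise_small_ball L_gt0 alpha01 sigma_gt0 bmP ZP y.2 q1 q2 N4 sy rho_gt0.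
apply: le_trans; apply: le_measure; rewrite ?inE//.
  exact: measurable_ysection.
by move=> w; rewrite /ysection/= inE => -[].
Qed.

End bad_event_probability.

Section moment_bound.
Context {R : realType}.
Variables (L alpha sigma p T K : R).
Hypotheses (L_gt0 : 0 < L) (alpha01 : 0 < alpha < 1) (sigma_gt0 : 0 < sigma)
  (p_gt1 : 1 < p) (T_gt0 : 0 < T) (K_ge0 : 0 <= K).
Local Notation mu := (@lebesgue_measure R).
Local Notation mu2 := ((@lebesgue_measure R) \x (@lebesgue_measure R))%E.

Lemma integral_f_grad_pow_le (u : @coef R) (c : R) (B : set (R * R)) :
  0 <= c -> measurable B ->
  {ae mu2, forall x, torus L x -> f_grad_pow L p u x <= c \/ B x} ->
  (\int[mu2]_(x in torus L) (f_grad_pow L p u x)%:E <= (c * L ^+ 2)%:E + mu2 B)%E.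
Proof.
move=> c0 mB h; have := @integral_dichotomy _ _ R mu2 (torus L) B (f_grad_pow L p u) c
  (measurable_torus L) mB c0 (measurable_f_grad_pow (L := L) p u) (fun x _ => f_grad_pow01 L p_gt1 u x) h.
move=> H; apply: (le_trans H); apply: leeD.
  rewrite [leRHS]EFinM; apply: lee_wpmul2l; first by rewrite lee_fin.
  by rewrite le_eqVlt; apply/orP; left; apply/eqP; exact: measure_torus.
by apply: le_measure; rewrite ?inE//; apply: measurableI => //; exact: measurable_torus.
Qed.

Lemma integral_f_grad_pow01 (u : @coef R) :
  (0 <= \int[mu2]_(x in torus L) (f_grad_pow L p u x)%:E <= (L ^+ 2)%:E)%E.
Proof.
apply/andP; split.
  by apply: integral_ge0 => x _; rewrite lee_fin; case/andP: (f_grad_pow01 L p_gt1 u x).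
have := @integral_f_grad_pow_le u 1 set0 ler01 measurable0 _.
rewrite measure0 adde0 mul1r; apply; apply: aeW => x _; left.
by case/andP: (f_grad_pow01 L p_gt1 u x).
Qed.

Context {d : measure_display} {Omega : measurableType d}.
Variables (P : probability Omega R) (beta Z : int * int -> R -> {RV P >-> R}).
Hypotheses (bmP : iid_brownian beta) (ZP : is_stoch_conv L beta Z).
Variables (a : @coef R) (Ba : R).
Hypothesis aB : forall k, k != 0 -> nu L k * `|a k| <= Ba.

(** The three terms come from the small times, from the complement of the bad event, and
    from the bad event. *)
Definition moment_const (N : nat) (r : R) : R :=
  L ^+ 2 * small_time L N + r `^ (- p) * L ^+ 2 * T
    + bad_prob L alpha sigma N (2 * (r + 2 / L * K)) * (T * L ^+ 2).

Lemma moment_le (N : nat) (r : R) (u V : R -> Omega -> @coef R) :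
  (4 <= N)%N -> 0 < r ->
  {ae P, forall w t, 0 <= t <= T -> forall k, u t w k =
     semigroup L t a k + V t w k + sigma * Defs.proj N (Zalpha L alpha Z t w) k} ->
  (forall w t n, 0 <= t <= T -> \sum_(k <- low_seq R n) nu L k * `|V t w k| <= K) ->
  (\int[P]_w \int[mu]_(t in `[0%R, T]) \int[mu2]_(x in torus L)
     (f_grad_pow L p (u t w) x)%:E <= (moment_const N r)%:E)%E.
Proof.
move=> N4 r0 uE VK.
have N0 : 0 < N%:R :> R by rewrite ltr0n; lia.
set s := small_time L N; have s0 : 0 < s.
  apply: divr_gt0; last exact: exprn_gt0.
  by apply: exprn_gt0; apply: divr_gt0; apply: mulr_gt0 => //; exact: pi_gt0.
have Zc : {ae P, forall w k, k \in low_seq R N ->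
    {within `[0, +oo[, continuous (fun t => Z k t w)}}.
  by apply: ae_forall_seq => k /low_seq_neq0 k0; exact: (ZP k0).2.
have [X [mX PX XE]] := ae_and_imply uE Zc (fun w h1 h2 => conj h1 h2).
have mA : measurable (~` X) by exact: measurableC.
have AE w : (~` X) w -> (forall t, 0 <= t <= T -> forall k, u t w k =
     semigroup L t a k + V t w k + sigma * Defs.proj N (Zalpha L alpha Z t w) k) /\
   (forall k, k \in low_seq R N -> {within `[0, +oo[, continuous (fun t => Z k t w)}).
  by move=> Xw; apply: contrapT => H; exact: Xw (XE _ H).
have uX : {ae P, forall w, (~` X) w}.
  by exists X; split => // w /= /contrapT.
set rho := 2 * (r + 2 / L * K).
have rho0 : 0 < rho.
  apply: mulr_gt0 => //; apply: ltr_pwDl => //.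
  by apply: mulr_ge0 => //; apply: divr_ge0 => //; exact: ltW.
pose E := bad_event L alpha sigma Z a (~` X) N s T rho.
have mE : measurable E.
  by apply: (measurable_bad_event alpha sigma L_gt0 aB T mA s0) => w /AE[].
have mD1 : measurable (`[0%R, T]%classic : set R) by exact: measurable_itv.
have mS : measurable (`[0%R, s[%classic : set R) by exact: measurable_itv.
have muT : (mu `[0%R, T]%classic = T%:E)%E.
  by rewrite lebesgue_measure_itv/= lte_fin T_gt0 -EFinB subr0.
have muTle : (mu `[0%R, T]%classic <= T%:E)%E by rewrite muT.
have muTy : (mu `[0%R, T]%classic < +oo)%E by rewrite muT ltry.
have muS : (mu (`[0%R, s[ `&` `[0%R, T])%classic <= s%:E)%E.
  apply: (@le_trans _ _ (mu `[0%R, s[%classic)).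
    by apply: le_measure; rewrite ?inE//; exact: measurableI.
  by rewrite lebesgue_measure_itv/= lte_fin s0 -EFinB subr0.
have mtor : (mu2 (torus L) = (L ^+ 2)%:E)%E by exact: measure_torus.
have L20 : 0 <= L ^+ 2 by exact: sqr_ge0.
have rp0 : 0 <= r `^ (- p) * L ^+ 2 by apply: mulr_ge0 => //; exact: powR_ge0.
have ED (z : Omega * (R * (R * R))) : E z -> (`[0%R, T] `*` torus L)%classic z.2.
  move=> [[_ [/= + tz]] _]; rewrite in_itv/= => /andP[sz zT].
  by split => //=; rewrite in_itv/= zT (le_trans (ltW s0) sz).
have Ec y (_ : (`[0%R, T] `*` torus L)%classic y) :
    (P (ysection E y) <= (bad_prob L alpha sigma N rho)%:E)%E.
  exact: (bad_event_prob_le L_gt0 alpha01 sigma_gt0 bmP ZP N4 rho0 y mE).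
have IE : {ae P, forall w t, (`[0%R, T]%classic : set R) t -> ~ (`[0%R, s[%classic : set R) t ->
    (\int[mu2]_(x in torus L) (f_grad_pow L p (u t w) x)%:E
       <= (r `^ (- p) * L ^+ 2)%:E + mu2 (xsection (xsection E w) t))%E}.
  apply: (ae_and_imply uX uX) => w Xw _ t /=; rewrite !in_itv/= => /andP[t0 tT].
  rewrite t0/= => /negP; rewrite -leNgt => st.
  have [uw _] := AE w Xw.
  apply: integral_f_grad_pow_le; first exact: powR_ge0.
    by apply: measurable_xsection; exact: measurable_xsection.
  have tT' : 0 <= t <= T by rewrite t0.
  have st' : 0 < s <= t by rewrite s0.
  have := small_or_bad L_gt0 p_gt1 K_ge0 aB st' tT Xw r0 (uw t tT')
    (fun n => VK w t n tT').
  move=> h; refine (ae_and_imply h h _) => x hx _ /hx [|Ex]; first by left.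
  by right; rewrite /xsection/= inE/= inE.
have := @expectation_integral_le R _ _ _ Omega _ _ P mu
  (product_sigma_finite mu mu) E `[0%R, T]%classic `[0%R, s[%classic (torus L)
  (fun w t => \int[mu2]_(x in torus L) (f_grad_pow L p (u t w) x)%:E)%E
  (r `^ (- p) * L ^+ 2) (L ^+ 2) _ mE mD1 mS (measurable_torus L) ED muTy rp0 L20
  (bad_prob_ge0 alpha L_gt0 sigma_gt0 N rho) Ec (fun w t => integral_f_grad_pow01 (u t w)) IE.
move=> H; refine (le_trans H _).
rewrite /moment_const !EFinD; apply: leeD; first apply: leeD.
- by rewrite [leRHS]EFinM; apply: lee_wpmul2l => //; rewrite lee_fin.
- by rewrite [leRHS]EFinM; apply: lee_wpmul2l => //; rewrite lee_fin.
have -> : (mu \x product_sigma_finite mu mu)%E (`[0%R, T] `*` torus L)%classic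
    = (T * L ^+ 2)%:E.
  rewrite [RHS]EFinM -muT -mtor; apply: product_measure1E => //; exact: measurable_torus.
by rewrite [leRHS]EFinM.
Qed.

End moment_bound.

(** * Choice of the truncation level *)

Section initial_value.
Context {R : realType}.
Variable L : R.
Hypothesis L_gt0 : 0 < L.

(** One term of the series defining the norm is at most its sum, and mu_k^eta is bounded
    below away from k = 0. *)
Lemma Hs_nu_bounded (eta : R) (u : @coef R) : 0 < eta -> Hs L (1 + eta) u ->
  exists Ba, forall k, k != 0 -> nu L k * `|u k| <= Ba.
Proof.
move=> eta0 [_ uS]; pose c : R := 2 * pi / L.
have c0 : 0 < c by apply: divr_gt0 => //; apply: mulr_gt0 => //; exact: pi_gt0.
have ce0 : 0 < (c ^+ 2) `^ eta by apply: powR_gt0; exact: exprn_gt0.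
have S0 : (0 <= Hs_sqnorm L (1 + eta) u)%E.
  by apply: esum_ge0 => k _; rewrite lee_fin mulr_ge0 ?powR_ge0// sqr_ge0.
have Sfin : Hs_sqnorm L (1 + eta) u \is a fin_num by rewrite ge0_fin_numE.
pose S := fine (Hs_sqnorm L (1 + eta) u).
exists (Num.sqrt (S / (c ^+ 2) `^ eta)) => k k0.
have v0 := nu_gt0 L_gt0 k0.
have cv : c <= nu L k by rewrite nuE ler_peMr ?(ltW c0)// freq_norm_ge1.
have kS : mu_ L k `^ (1 + eta) * `|u k| ^+ 2 <= S.
  rewrite -lee_fin fineK//; apply: esum_ge; exists [set k].
    by split; [exact: finite_set1|move=> _ ->].
  by rewrite fsbig_set1.
have vu0 : 0 <= nu L k * `|u k| by apply: mulr_ge0 => //; exact: ltW.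
rewrite -[leLHS]ger0_norm// -sqrtr_sqr; apply: ler_wsqrtr.
rewrite ler_pdivlMr//; apply: le_trans kS.
have m0 : 0 < mu_ L k by rewrite mu_nu exprn_gt0.
rewrite powRD; last by rewrite (gt_eqF m0) implybT.
rewrite powRr1 ?(ltW m0)// exprMn mu_nu mulrAC; apply: ler_wpM2r; first exact: sqr_ge0.
apply: ler_wpM2l; first exact: sqr_ge0.
apply: ge0_ler_powR; rewrite ?nnegrE ?sqr_ge0 ?(ltW eta0)//.
by apply: lerXn2r; rewrite ?nnegrE ?(ltW c0) ?(ltW v0).
Qed.

End initial_value.

Section rate.
Context {R : realType}.
Variables (L alpha sigma p T K : R).
Hypotheses (L_gt0 : 0 < L) (alpha01 : 0 < alpha < 1) (sigma_gt0 : 0 < sigma)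
  (p_gt1 : 1 < p) (T_gt0 : 0 < T) (K_ge0 : 0 <= K).

Let e := 2 * alpha * p / (p + 2).
Let q := 2 * alpha / (p + 2).
Let Cn := small_ball_const L alpha sigma.

(** The summands account for N < 4, and for the three terms of moment_const. *)
Definition rate_const : R := 16 * (T * L ^+ 2) + L ^+ 2 * (8 * L / (2 * pi)) ^+ 4
  + L ^+ 2 * T + Cn * (2 * (1 + 2 / L * K)) ^+ 2 * (T * L ^+ 2).

Let p2 : 0 < p + 2. Proof. by move: p_gt1; lra. Qed.

Let Cn0 : 0 <= Cn. Proof. exact: small_ball_const_ge0. Qed.

Let e_le2 : 0 < e <= 2.
Proof.
move/andP: alpha01 => [a0 a1]; have p0 : 0 < p by exact: lt_trans p_gt1.
rewrite /e divr_gt0 ?mulr_gt0//= ler_pdivrMr//; nra.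
Qed.

Let parts_ge0 : [/\ 0 <= 16 * (T * L ^+ 2), 0 <= L ^+ 2 * (8 * L / (2 * pi)) ^+ 4,
  0 <= L ^+ 2 * T & 0 <= Cn * (2 * (1 + 2 / L * K)) ^+ 2 * (T * L ^+ 2)].
Proof.
have L2 : 0 <= L ^+ 2 by exact: sqr_ge0.
have TL : 0 <= T * L ^+ 2 by apply: mulr_ge0 => //; exact: ltW.
split.
- exact: mulr_ge0.
- apply: mulr_ge0 => //; apply: exprn_ge0; apply: divr_ge0.
    by apply: mulr_ge0 => //; exact: ltW.
  by apply: mulr_ge0 => //; exact: pi_ge0.
- by apply: mulr_ge0 => //; exact: ltW.
- by apply: mulr_ge0 => //; apply: mulr_ge0 => //; exact: sqr_ge0.
Qed.

Lemma rate_const_gt0 : 0 < rate_const.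
Proof.
have [h1 h2 h3 h4] := parts_ge0.
have : 0 < 16 * (T * L ^+ 2) by apply: mulr_gt0 => //; apply: mulr_gt0 => //; exact: exprn_gt0.
by rewrite /rate_const; move: h1 h2 h3 h4; lra.
Qed.

Lemma small_N_rate (N : nat) : (0 < N < 4)%N ->
  T * L ^+ 2 <= rate_const * N%:R `^ (- e).
Proof.
move=> /andP[N0 N4]; have [h1 h2 h3 h4] := parts_ge0; have /andP[e0 e2] := e_le2.
have NR : 1 <= N%:R :> R by rewrite ler1n.
have Ne : N%:R `^ e <= 16.
  apply: le_trans (ler_powR NR e2) _; rewrite powR_mulrn//.
  by rewrite -natrX ler_nat (@leq_exp2r N 4 2)// ltnW.
have Ne0 : 0 < N%:R `^ e by apply: powR_gt0; exact: lt_le_trans NR.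
rewrite powRN ler_pdivlMr//.
have TL : 0 <= T * L ^+ 2 by apply: mulr_ge0; [exact: ltW|exact: sqr_ge0].
apply: le_trans (ler_wpM2l TL Ne) _.
by rewrite /rate_const; move: h1 h2 h3 h4; lra.
Qed.

(** With e = p q, both r^-p and r^2 N^{-2 alpha} are equal to N^{-e} at r = N^q, and
    N^-4 <= N^{-e} because e <= 2. *)
Lemma moment_const_rate (N : nat) : (4 <= N)%N ->
  moment_const L alpha sigma p T K N (N%:R `^ q) <= rate_const * N%:R `^ (- e).
Proof.
move=> N4; have [h1 h2 h3 h4] := parts_ge0; have /andP[e0 e2] := e_le2.
have NR : 1 <= N%:R :> R by rewrite ler1n; exact: leq_trans N4.
have N0 : 0 < N%:R :> R by exact: lt_le_trans NR.
have pe : q * p = e by rewrite /q /e; field; rewrite gt_eqF.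
have X0 : 0 <= N%:R `^ (- e) by exact: powR_ge0.
have t1 : L ^+ 2 * small_time L N <= L ^+ 2 * (8 * L / (2 * pi)) ^+ 4 * N%:R `^ (- e).
  rewrite /small_time mulrA; apply: ler_wpM2l => //.
  rewrite powRN lef_pV2 ?posrE ?powR_gt0 ?exprn_gt0// -powR_mulrn ?(ltW N0)//.
  by apply: ler_powR => //; apply: le_trans e2 _; rewrite ler_nat.
have t2 : (N%:R `^ q) `^ (- p) * L ^+ 2 * T = L ^+ 2 * T * N%:R `^ (- e).
  by rewrite -powRrM mulrN pe; ring.
have r1 : 1 <= N%:R `^ q.
  rewrite -[leLHS](powRr0 N%:R); apply: ler_powR => //.
  by apply: divr_ge0; [apply: mulr_ge0 => //; case/andP: alpha01 => /ltW|exact: ltW].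
set K1 := 2 / L * K; have K10 : 0 <= K1.
  by apply: mulr_ge0 => //; apply: divr_ge0 => //; exact: ltW.
have rK : (2 * (N%:R `^ q + K1)) ^+ 2 <= (2 * (1 + K1)) ^+ 2 * (N%:R `^ q) ^+ 2.
  rewrite -exprMn; apply: lerXn2r; rewrite ?nnegrE.
  - by apply: mulr_ge0 => //; apply: addr_ge0 => //; exact: powR_ge0.
  - by apply: mulr_ge0; [apply: mulr_ge0 => //; exact: addr_ge0|exact: powR_ge0].
  - by rewrite -mulrA ler_pM2l// mulrDl mul1r lerD2l ler_peMr.
have rN : (N%:R `^ q) ^+ 2 * N%:R `^ (- (2 * alpha)) = N%:R `^ (- e).
  rewrite -powR_mulrn ?powR_ge0// -powRrM -powRD; last by rewrite (gt_eqF N0) implybT.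
  by congr (_ `^ _); rewrite /q /e; field; rewrite gt_eqF.
have t3 : bad_prob L alpha sigma N (2 * (N%:R `^ q + K1)) * (T * L ^+ 2) <=
    Cn * (2 * (1 + K1)) ^+ 2 * (T * L ^+ 2) * N%:R `^ (- e).
  rewrite -rN [leRHS](_ : _ = Cn * ((2 * (1 + K1)) ^+ 2 * (N%:R `^ q) ^+ 2)
    * N%:R `^ (- (2 * alpha)) * (T * L ^+ 2)); last by ring.
  apply: ler_wpM2r; first by apply: mulr_ge0; [exact: ltW|exact: sqr_ge0].
  by apply: ler_wpM2r; [exact: powR_ge0|exact: ler_wpM2l].
rewrite /moment_const t2 /rate_const -/K1 [leRHS]mulrDl [X in _ <= X + _]mulrDl [X in _ <= X + _ + _]mulrDl.
apply: (lerD _ t3); apply: lerD => //; apply: le_trans t1 _.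
by rewrite lerDr mulr_ge0.
Qed.

End rate.

Section Lp_rate.
Context {R : realType}.
Variables (L alpha sigma p T K : R).
Hypotheses (L_gt0 : 0 < L) (alpha01 : 0 < alpha < 1) (sigma_gt0 : 0 < sigma)
  (p_gt1 : 1 < p) (T_gt0 : 0 < T) (K_ge0 : 0 <= K).
Local Notation mu := (@lebesgue_measure R).
Local Notation mu2 := ((@lebesgue_measure R) \x (@lebesgue_measure R))%E.
Context {d : measure_display} {Omega : measurableType d}.
Variables (P : probability Omega R) (beta Z : int * int -> R -> {RV P >-> R}).
Hypotheses (bmP : iid_brownian beta) (ZP : is_stoch_conv L beta Z).
Variables (a : @coef R) (Ba : R).
Hypothesis aB : forall k, k != 0 -> nu L k * `|a k| <= Ba.

Let space_time_ge0 (u : R -> @coef R) :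
  (0 <= \int[mu]_(t in `[0%R, T]) \int[mu2]_(x in torus L) (f_grad_pow L p (u t) x)%:E)%E.
Proof. by apply: integral_ge0 => t _; case/andP: (integral_f_grad_pow01 L_gt0 p_gt1 (u t)). Qed.

Lemma Lp_norm_pow (u : R -> @coef R) : (Lp_norm_f_grad L p T u `^ p =
  \int[mu]_(t in `[0%R, T]) \int[mu2]_(x in torus L) (f_grad_pow L p (u t) x)%:E)%E.
Proof.
have p0 : p != 0 by rewrite gt_eqF// (lt_trans _ p_gt1).
by rewrite /Lp_norm_f_grad -poweRrM mulVf// poweRe1//; exact: space_time_ge0.
Qed.

Lemma moment_trivial (u : R -> Omega -> @coef R) :
  (\int[P]_w \int[mu]_(t in `[0%R, T]) \int[mu2]_(x in torus L)
     (f_grad_pow L p (u t w) x)%:E <= (T * L ^+ 2)%:E)%E.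
Proof.
apply: (@le_trans _ _ (\int[P]_w (T * L ^+ 2)%:E)%E); last first.
  rewrite integral_cst// -[leRHS]mule1; apply: lee_wpmul2l.
    by rewrite lee_fin mulr_ge0 ?sqr_ge0 ?(ltW T_gt0).
  by rewrite le_eqVlt; apply/orP; left; apply/eqP; exact: probability_setT.
apply: le_lower_integral => w _; first exact: space_time_ge0.
apply: (@le_trans _ _ (\int[mu]_(t in `[0%R, T]) (L ^+ 2)%:E)%E).
  by apply: le_lower_integral => t _; case/andP: (integral_f_grad_pow01 L_gt0 p_gt1 (u t w)).
rewrite integral_cst//= mulrC [leRHS]EFinM; apply: lee_wpmul2l.
  by rewrite lee_fin sqr_ge0.
by rewrite lebesgue_measure_itv/= lte_fin T_gt0 -EFinB subr0.
Qed.

Lemma Lp_rate (N : nat) (u V : R -> Omega -> @coef R) : (0 < N)%N ->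
  {ae P, forall w t, 0 <= t <= T -> forall k, u t w k =
     semigroup L t a k + V t w k + sigma * Defs.proj N (Zalpha L alpha Z t w) k} ->
  (forall w t n, 0 <= t <= T -> \sum_(k <- low_seq R n) nu L k * `|V t w k| <= K) ->
  ((\int[P]_w (Lp_norm_f_grad L p T (fun t => u t w) `^ p)) `^ p^-1
     <= (rate_const L alpha sigma T K `^ p^-1 * N%:R `^ (- (2 * alpha / (p + 2))))%:E)%E.
Proof.
move=> N0 uE VK; have p0 : 0 < p by exact: lt_trans p_gt1.
have p20 : 0 < p + 2 by exact: addr_gt0.
have C0 := rate_const_gt0 alpha K L_gt0 sigma_gt0 T_gt0.
have NR : 0 < N%:R :> R by rewrite ltr0n.
set e := 2 * alpha * p / (p + 2).
under eq_integral do rewrite Lp_norm_pow.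
have main : (\int[P]_w \int[mu]_(t in `[0%R, T]) \int[mu2]_(x in torus L)
    (f_grad_pow L p (u t w) x)%:E <= (rate_const L alpha sigma T K * N%:R `^ (- e))%:E)%E.
  have [N4|N4] := leqP 4 N.
    have r0 : 0 < N%:R `^ (2 * alpha / (p + 2)) :> R by exact: powR_gt0.
    apply: le_trans (moment_le L_gt0 alpha01 sigma_gt0 p_gt1 T_gt0 K_ge0 bmP ZP aB N4 r0 uE VK) _.
    by rewrite lee_fin; exact: moment_const_rate.
  apply: le_trans (moment_trivial _) _.
  by rewrite lee_fin; apply: small_N_rate => //; rewrite N0.
have -> : (rate_const L alpha sigma T K `^ p^-1 * N%:R `^ (- (2 * alpha / (p + 2))))%:E
    = (((rate_const L alpha sigma T K * N%:R `^ (- e))%:E) `^ p^-1)%E.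
  rewrite poweR_EFin powRM ?powR_ge0 ?(ltW C0)// -powRrM.
  congr (_ * _ `^ _)%:E; rewrite /e; field.
  by rewrite (gt_eqF p0) (gt_eqF p20).
apply: gt0_ler_poweR => //; rewrite ?invr_ge0 ?(ltW p0)//.
  rewrite in_itv/= leey andbT; apply: integral_ge0 => w _; exact: space_time_ge0.
by rewrite in_itv/= leey andbT lee_fin mulr_ge0 ?powR_ge0 ?(ltW C0).
Qed.

End Lp_rate.

Lemma sum_proj_frakF_le {R : realType} (L : R) (L_gt0 : 0 < L) (N n : nat) (u : @coef R) :
  \sum_(k <- low_seq R n) Defs.proj N (frakF L u) k ^+ 2 / mu_ L k <= 2 * L ^+ 2.
Proof.
refine (le_trans _ (sum_frakF_le L_gt0 u (low_seq_uniq n) (low_seq0 n))).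
apply: ler_sum => k _; apply: ler_wpM2r; first by rewrite invr_ge0 mu_nu sqr_ge0.
by rewrite /Defs.proj; case: ifP => // _; rewrite expr0n sqr_ge0.
Qed.

Theorem lemma4p5 (R : realType) (L T alpha sigma p M : R)
    (L_gt0 : 0 < L) (T_gt0 : 0 < T) (alpha01 : 0 < alpha < 1)
    (sigma_gt0 : 0 < sigma) (p_gt1 : 1 < p) :
  exists2 C : R, 0 < C &
  forall (eta : R) (u0 : coef),
    0 < eta < 4 -> Hs L (1 + eta) u0 -> W1infty_norm L u0 = M%:E ->
  forall (d : measure_display) (Omega : measurableType d)
    (P : probability Omega R) (beta Z : int * int -> R -> {RV P >-> R}),
    iid_brownian beta -> is_stoch_conv L beta Z ->
  forall N : nat, (0 < N)%N ->
    (forall u : R -> Omega -> coef,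
       is_mild_solution L T alpha sigma Z u0 N u ->
       ((\int[P]_w (Lp_norm_f_grad L p T (fun t => u t w) `^ p)) `^ p^-1
          <= (C * N%:R `^ (- (2 * alpha / (p + 2))))%:E)%E) /\
    (forall (n : nat) (uh : R -> Omega -> coef), (0 < n)%N ->
       is_approximation L T alpha sigma Z u0 N n uh ->
       ((\int[P]_w (Lp_norm_f_grad L p T (fun t => uh t w) `^ p)) `^ p^-1
          <= (C * N%:R `^ (- (2 * alpha / (p + 2))))%:E)%E).
Proof.
have B0 : 0 <= 2 * L ^+ 2 by rewrite mulr_ge0// sqr_ge0.
have [K K0 driftK] := drift_sum_bounded L_gt0 B0 T_gt0.
exists (rate_const L alpha sigma T K `^ p^-1).
  by apply: powR_gt0; exact: rate_const_gt0.
move=> eta u0 /andP[eta0 _] u0H _ d Omega P beta Z bmP ZP N N0.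
have [Ba u0B] := Hs_nu_bounded L_gt0 eta0 u0H; split.
- move=> u [_ _ _ uE].
  pose V t w : @coef R := fun k =>
    \int[lebesgue_measure]_(s in `[0, t]) semigroup L (t - s) (frakF L (u s w)) k.
  apply: (@Lp_rate _ L alpha sigma p T K L_gt0 alpha01 sigma_gt0 p_gt1 T_gt0 K0
    _ _ P beta Z bmP ZP u0 Ba u0B N u V N0 uE) => w t n tT.
  apply: (driftK (fun s => frakF L (u s w))) => // s m.
  exact: (sum_frakF_le L_gt0 _ (low_seq_uniq m) (low_seq0 m)).
- move=> n u n0 [_ uE].
  pose V t w : @coef R := fun k => \int[lebesgue_measure]_(s in `[0, t])
    semigroup L (t - s) (Defs.proj N (frakF L (u (floor_h (T / n%:R) s) w))) k.
  have projB k : k != 0 -> nu L k * `|Defs.proj N u0 k| <= Ba.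
    move=> k0; apply: le_trans (u0B k k0); apply: ler_wpM2l; first exact: nu_ge0.
    by rewrite /Defs.proj; case: ifP => // _; rewrite normr0.
  apply: (@Lp_rate _ L alpha sigma p T K L_gt0 alpha01 sigma_gt0 p_gt1 T_gt0 K0
    _ _ P beta Z bmP ZP (Defs.proj N u0) Ba projB N u V N0 uE) => w t m tT.
  apply: (driftK (fun s => Defs.proj N (frakF L (u (floor_h (T / n%:R) s) w)))) => // s l.
  exact: sum_proj_frakF_le.
Qed.
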